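(* Let $I_0,I_1,I_*\subseteq\mathbb{R}$ be any nonempty convex subsets. Let $f\colon\{0,1\}^n\to\{0,1\}$ be a given function with $\deg_{I_0,I_1,I_*}(f)\ge n^{1-\frac1k}$ for some real number $k\ge1$. Suppose further that $f$ is computable by a Boolean circuit of size $s$ and depth $d$, where $d\ge1$. Then there is a function $F\colon\{0,1\}^N\to\{0,1\}$ on $N=\Theta(n^{1+\frac1k}\log^2n)$ variables with \[ \deg_{I_0,I_1,I_*}(F)\ge\Omega\left(\frac{N^{1-\frac1{k+1}}}{\log^{1-\frac{2}{k+1}}N}\right). \] Moreover, $F$ is computable by a Boolean circuit of size $s+n^{O(1)}$, bottom fan-in $O(\log n)$, depth $d+2$ if the circuit for $f$ is monotone, and depth $d+3$ otherwise.
   Context: For $g\colon X\to\{0,1\}$ on a finite $X\subset\mathbb{R}^N$, an $(I_0,I_1,I_* )$-approximant is a real polynomial mapping $g^{-1}(0)$ into $I_0$ and $g^{-1}(1)$ into $I_1$ (and any don't-care inputs into $I_*$), and $\deg_{I_0,I_1,I_*}(g)$ is the least degree of such an approximant (e.g., threshold degree is the case $I_0=(0,\infty)$, $I_1=(-\infty,0)$, $I_*=\mathbb{R}$). Boolean circuits have inputs $x_i,\neg x_i$ and AND/OR gates of unbounded fan-in; a circuit is monotone if it uses no negated inputs; size = number of gates; depth = maximum number of gates on an input-output path; bottom fan-in = maximum fan-in of gates fed only by inputs. Logarithms base 2. *)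

(* Defs.v *)
From HB Require Import structures.
From mathcomp Require Import all_boot all_order all_algebra.
From mathcomp Require mpoly.

Set Implicit Arguments.
Unset Strict Implicit.
Unset Printing Implicit Defensive.

(* Importing [mpoly] at top level clashes with the notations of the analysis
   library. *)
Module TotalDegree.
Import mpoly.

(* The zero polynomial gets degree 0. *)
Definition tdeg (R : nzRingType) (n : nat) (p : {mpoly R[n]}) : nat := (msize p).-1.

End TotalDegree.
Export TotalDegree.

From mathcomp Require Import boolp classical_sets reals ereal exp convex.

Import Order.TTheory GRing.Theory Num.Theory.

Definition cube (n : nat) := {ffun 'I_n -> bool}.

Section ApproximateDegree.
Local Open Scope ring_scope.
Local Open Scope classical_set_scope.
Variable R : realType.

Definition log2 (x : R) : R := ln x / ln 2.

(* The finite domain is a family [pt] of points of R^n indexed by a finite type;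
   [None] is the value of [g] at don't-care inputs. *)
Definition approximant (I0 I1 Is : set R) (n : nat) (T : finType)
    (pt : T -> 'I_n -> R) (g : T -> option bool) (p : mpoly.mpoly n R) : Prop :=
  forall t : T,
    let y := mpoly.meval (pt t) p in
    match g t with
    | Some false => I0 y
    | Some true => I1 y
    | None => Is y
    end.

(* A least element of a set of naturals, or +oo if there is no approximant. *)
Definition adeg (I0 I1 Is : set R) (n : nat) (T : finType)
    (pt : T -> 'I_n -> R) (g : T -> option bool) : \bar R :=
  ereal_inf [set ((tdeg p)%:R)%:E | p in approximant I0 I1 Is pt g].

Definition cube_pt (n : nat) (x : cube n) : 'I_n -> R := fun i => (x i)%:R.

Definition bool_adeg (I0 I1 Is : set R) (n : nat) (f : cube n -> bool) : \bar R :=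
  adeg I0 I1 Is (@cube_pt n) (fun x => Some (f x)).

End ApproximateDegree.

Arguments log2 {R} x.

Section Circuits.
Variable n : nat.

(* [Input false i] is x_i, [Input true i] is its negation, and [Gate j] is the
   output of the j-th gate. *)
Inductive wire : Type := Input (neg : bool) (i : 'I_n) | Gate (j : nat).

Inductive gate_op : Type := And | Or.

Record gate : Type := MkGate { op : gate_op; fan : seq wire }.

Definition wire_below (m : nat) (w : wire) : bool :=
  if w is Gate j then j < m else true.

(* Directed acyclic graphs, with the gates listed in topological order. Gates
   have nonzero fan-in, so each of them is reached by a path from an input. *)
Definition gates_wf (gs : seq gate) : Prop :=
  forall (gs1 gs2 : seq gate) (g : gate), gs = gs1 ++ g :: gs2 ->
    0 < size (fan g) /\ all (wire_below (size gs1)) (fan g).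

Record circuit : Type := MkCircuit {
  gates : seq gate;
  output : wire;
  gates_wfP : gates_wf gates;
  output_wfP : wire_below (size gates) output
}.

Definition wire_val (x : cube n) (vs : seq bool) (w : wire) : bool :=
  match w with
  | Input neg i => neg (+) x i
  | Gate j => nth false vs j
  end.

Definition gate_val (x : cube n) (vs : seq bool) (g : gate) : bool :=
  match op g with
  | And => all (wire_val x vs) (fan g)
  | Or => has (wire_val x vs) (fan g)
  end.

Definition gate_vals (x : cube n) (gs : seq gate) : seq bool :=
  foldl (fun vs g => rcons vs (gate_val x vs g)) [::] gs.

Definition circuit_eval (C : circuit) (x : cube n) : bool :=
  wire_val x (gate_vals x (gates C)) (output C).

Definition computes (C : circuit) (f : cube n -> bool) : Prop :=
  forall x : cube n, circuit_eval C x = f x.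

Definition circuit_size (C : circuit) : nat := size (gates C).

(* The maximum number of gates on a path from an input to the wire. *)
Definition wire_height (hs : seq nat) (w : wire) : nat :=
  match w with
  | Input _ _ => 0
  | Gate j => nth 0 hs j
  end.

Definition gate_heights (gs : seq gate) : seq nat :=
  foldl (fun hs g => rcons hs (\max_(w <- fan g) wire_height hs w).+1) [::] gs.

Definition circuit_depth (C : circuit) : nat :=
  wire_height (gate_heights (gates C)) (output C).

Definition is_input (w : wire) : bool := if w is Input _ _ then true else false.

Definition bottom_fanin (C : circuit) : nat :=
  \max_(g <- gates C | all is_input (fan g)) size (fan g).

Definition positive_wire (w : wire) : bool := if w is Input true _ then false else true.

Definition monotone_circuit (C : circuit) : bool :=
  all (fun g => all positive_wire (fan g)) (gates C) && positive_wire (output C).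

End Circuits.

(* Main.v *)
(** The inputs of [f] are replaced by copies of the AND-OR function
    "every one of [m] counters is positive", with [m] about [n^(1/k)], and the
    vector of all [n * m] counters is presented as [theta] slots, each of which
    names one counter through a code of length and distance [O(log n)]. An
    approximant of the resulting function becomes an approximant of [f] in two
    averaging steps. Averaging over the encodings of a slot and over the order
    of the slots leaves a polynomial in the counters and divides the degree by
    the distance of the code. Averaging over counters drawn from two
    distributions, supported on the two values of the AND-OR function and
    agreeing on all moments of degree less than [m], divides it by [m] again.

    The second average involves counter vectors of total weight larger than
    [theta], which no input encodes. Their contribution is harmless: for a product
    of light-tailed distributions and a polynomial [P] of degree at most [n],
    thinning the counters and extrapolating shows that the heavy vectors carry at
    most half of the [L1] norm of [P]. Hence if [P] is at least [a] on the light
    vectors, then so is its mean, and the mean stays in every interval that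
    contains the values of [P] at light vectors. *)

Require Import Defs.
From HB Require Import structures.
From mathcomp Require Import all_boot all_order all_algebra all_fingroup.
From mathcomp Require mpoly.
From mathcomp Require Import zify ring lra.

Set Implicit Arguments.
Unset Strict Implicit.
Unset Printing Implicit Defensive.

Import Order.TTheory GRing.Theory Num.Theory.
Local Open Scope ring_scope.

(** * Polynomial functions of bounded total degree *)

(** With [m] near n^(1/k) and [t] near log n, an approximant of degree below [n * t] would drop to
    degree below [n] after the first averaging and below [n / m <= n^(1 - 1/k)] after the second,
    which the degree of [f] forbids. The obstacle is the number of slots. A single counter may be as
    large as [100 * m ^ 2], while the bound on [N] leaves room for about [n * m * t] slots only, and
    cutting the laws off at light total weight would spoil their matching moments. So the heavy
    vectors stay, and a comparison of exponents disposes of them. Tilting a counter value [s] by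
    [(1 + x) ^ s] with [x = 1 / (200 m)] costs a factor [1 + 1/m], hence [2 ^ O(n)] over all [n * m]
    counters; extrapolation costs [n ^ O(n)]; weight above [theta] gains [(1 + x) ^ theta], which
    outweighs both once the constant in [theta] is large. The pair of laws is built for this
    purpose: it has the small exponential moment, and a geometric lower bound that lets it dominate
    a thinned counter. *)

Definition polyfun (R : comNzRingType) (I : finType) (D : nat) (P : (I -> R) -> R) : Prop :=
  exists s : seq (R * {ffun I -> nat}),
    (forall ce, ce \in s -> \sum_i ce.2 i <= D)%N /\
    forall z, P z = \sum_(ce <- s) ce.1 * \prod_i z i ^+ ce.2 i.

Section PolyFun.
Variables (R : comNzRingType) (I : finType).
Implicit Types (P Q : (I -> R) -> R) (D : nat).

Lemma eq_polyfun D P Q : P =1 Q -> polyfun D P -> polyfun D Q.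
Proof. by move=> PQ [s [sD sP]]; exists s; split => // z; rewrite -PQ. Qed.

Lemma polyfunW D D' P : (D <= D')%N -> polyfun D P -> polyfun D' P.
Proof. by move=> DD' [s [sD sP]]; exists s; split => // ce /sD /leq_trans; apply. Qed.

Lemma polyfun_monomial D (c : R) (e : {ffun I -> nat}) :
  (\sum_i e i <= D)%N -> polyfun D (fun z => c * \prod_i z i ^+ e i).
Proof.
move=> eD; exists [:: (c, e)]; split => [ce|z]; first by rewrite inE => /eqP ->.
by rewrite big_seq1.
Qed.

Lemma polyfun_cst D (c : R) : polyfun D (fun _ : I -> R => c).
Proof.
apply: (@eq_polyfun D (fun z => c * \prod_i z i ^+ [ffun=> 0%N] i)).
  by move=> z; rewrite big1 ?mulr1 // => i _; rewrite ffunE.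
by apply: polyfun_monomial; rewrite big1 // => i _; rewrite ffunE.
Qed.

Lemma polyfun_var i : polyfun 1 (fun z : I -> R => z i).
Proof.
apply: (@eq_polyfun _ (fun z => 1 * \prod_j z j ^+ [ffun j => (j == i : nat)] j)).
  move=> z; rewrite mul1r (bigD1 i) //= ffunE eqxx big1 ?mulr1 ?expr1 // => j ji.
  by rewrite ffunE (negbTE ji).
apply: polyfun_monomial; rewrite (bigD1 i) //= ffunE eqxx big1 // => j ji.
by rewrite ffunE (negbTE ji).
Qed.

Lemma polyfunD D P Q : polyfun D P -> polyfun D Q -> polyfun D (fun z => P z + Q z).
Proof.
move=> [s [sD sP]] [t [tD tQ]]; exists (s ++ t); split => [ce|z].
  by rewrite mem_cat => /orP [/sD|/tD].
by rewrite big_cat /= sP tQ.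
Qed.

Lemma polyfunM D E P Q :
  polyfun D P -> polyfun E Q -> polyfun (D + E) (fun z => P z * Q z).
Proof.
move=> [s [sD sP]] [t [tE tQ]].
exists [seq (a.1 * b.1, [ffun i => (a.2 i + b.2 i)%N]) | a : R * {ffun I -> nat} <- s,
   b : R * {ffun I -> nat} <- t].
split => [ce /allpairsP [[a b] /= [/sD aD /tE bE ->]] /=|z].
  under eq_bigr do rewrite ffunE.
  by rewrite big_split leq_add.
rewrite sP tQ big_allpairs_dep mulr_suml; apply: eq_bigr => a _.
rewrite mulr_sumr; apply: eq_bigr => b _ /=.
rewrite mulrACA -big_split /=; congr (_ * _).
by apply: eq_bigr => i _; rewrite ffunE exprD.
Qed.

Lemma polyfunZ D c P : polyfun D P -> polyfun D (fun z => c * P z).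
Proof. exact: (@polyfunM 0 D (fun=> c) P (polyfun_cst 0 c)). Qed.

Lemma polyfun_sum D (J : Type) (s : seq J) (S : pred J) (P : J -> (I -> R) -> R) :
  (forall j, S j -> polyfun D (P j)) -> polyfun D (fun z => \sum_(j <- s | S j) P j z).
Proof.
move=> H; elim: s => [|j s IHs].
  by apply: (@eq_polyfun _ (fun=> 0)); [move=> z; rewrite big_nil|exact: polyfun_cst].
case Sj: (S j); last first.
  by apply: eq_polyfun IHs => z; rewrite big_cons Sj.
apply: (@eq_polyfun _ (fun z => P j z + \sum_(j <- s | S j) P j z)).
  by move=> z; rewrite big_cons Sj.
by apply: polyfunD IHs; apply: H.
Qed.

Lemma polyfun_prod (J : Type) (s : seq J) (D : J -> nat) (P : J -> (I -> R) -> R) :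
  (forall j, polyfun (D j) (P j)) ->
  polyfun (\sum_(j <- s) D j) (fun z => \prod_(j <- s) P j z).
Proof.
move=> H; elim: s => [|j s IHs].
  by apply: (@eq_polyfun _ (fun=> 1)); [move=> z; rewrite big_nil|exact: polyfun_cst].
rewrite big_cons.
apply: (@eq_polyfun _ (fun z => P j z * \prod_(j <- s) P j z)).
  by move=> z; rewrite big_cons.
exact: polyfunM.
Qed.

End PolyFun.

Module PolyFunMpoly.
Import mpoly.

(** Formal polynomials occur only at the two ends of the argument, where an approximant is given and
    where one is produced. In between, averages are formed on functions, with variables indexed by
    any finite type. *)
Lemma polyfun_meval (R : comNzRingType) (n : nat) (p : {mpoly R[n]}) :
  polyfun (tdeg p) (fun z : 'I_n -> R => meval z p).
Proof.
apply: (@eq_polyfun _ _ _ (fun z => \sum_(m <- msupp p | m \in msupp p)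
    p@_m * \prod_i z i ^+ [ffun i => m i] i)).
  move=> z; rewrite mevalE [RHS]big_seq; apply: eq_bigr => m _.
  by congr (_ * _); apply: eq_bigr => i _; rewrite ffunE.
apply: polyfun_sum => m mp; apply: polyfun_monomial.
under eq_bigr do rewrite ffunE.
by rewrite -mdegE /tdeg; have := msize_mdeg_lt mp; case: (msize p).
Qed.

Lemma polyfun_mpoly (R : comNzRingType) (n D : nat) (P : ('I_n -> R) -> R) :
  polyfun D P -> exists2 p : {mpoly R[n]}, (tdeg p <= D)%N & forall z, meval z p = P z.
Proof.
move=> [s [sD sP]].
exists (\sum_(ce <- s) ce.1 *: 'X_[[multinom ce.2 i | i < n]]).
  suff : (msize (\sum_(ce <- s) ce.1 *: 'X_[[multinom ce.2 i | i < n]] : {mpoly R[n]}) <= D.+1)%N.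
    by rewrite /tdeg; case: (msize _).
  apply: leq_trans (msize_sum _ _ _) _.
  rewrite big_seq; apply/bigmax_leqP_seq => ce _ /sD ceD.
  apply: leq_trans (msizeZ_le _ _) _; rewrite msizeX ltnS mdegE.
  by under eq_bigr do rewrite mnmE.
move=> z; rewrite sP raddf_sum /=; apply: eq_bigr => ce _.
by rewrite mevalZ mevalX; congr (_ * _); apply: eq_bigr => i _; rewrite mnmE.
Qed.

End PolyFunMpoly.
Export PolyFunMpoly.

(** * Finite differences *)

Section Difference.
Variable R : realFieldType.
Implicit Types (p : {poly R}) (d : nat).

Definition pdiff p : {poly R} := (p \Po ('X + 1%:P)) - p.

Lemma size_pdiff p d : (size p <= d.+1)%N -> (size (pdiff p) <= d)%N.
Proof.
suff H : (size (pdiff p) <= (size p).-1)%N.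
  by move=> pd; apply: leq_trans H _; case: (size p) pd.
rewrite /pdiff; elim/poly_ind: p => [|p c IHp]; first by rewrite comp_poly0 subrr size_poly0.
have [->|p0] := eqVneq p 0.
  by rewrite mul0r add0r comp_polyC subrr size_poly0.
rewrite size_MXaddC (negbTE p0) /= comp_poly_MXaddC.
have -> : (p \Po ('X + 1%:P)) * ('X + 1%:P) + c%:P - (p * 'X + c%:P) =
          ((p \Po ('X + 1%:P)) - p) * 'X + (p \Po ('X + 1%:P)) by rewrite polyC1; ring.
apply: leq_trans (size_polyD _ _) _; rewrite geq_max; apply/andP; split.
  apply: leq_trans (size_polyMleq _ _) _; rewrite size_polyX addn2 /=.
  by move: p0 IHp; rewrite -size_poly_gt0; case: (size p).
by rewrite size_comp_poly2 // polyC1 size_XaddC.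
Qed.

Lemma horner_pdiff p x : (pdiff p).[x] = p.[x + 1] - p.[x].
Proof. by rewrite /pdiff hornerD hornerN horner_comp !hornerE. Qed.

(** Writing [p.[H]] as [p.[0]] plus a sum of differences reduces to degree [d - 1]. The factor
    [2 * H + 1] per degree is crude, but with [H] polynomial in [n] it only costs [n ^ O(n)]. *)
Lemma horner_extrapolation d p (H : nat) : (size p <= d.+1)%N ->
  `|p.[H%:R]| <= (2 * H%:R + 1) ^+ d * \sum_(l < d.+1) `|p.[l%:R]|.
Proof.
elim: d p H => [|d IHd] p H sp.
  by rewrite expr0 mul1r big_ord1 (size1_polyC sp) !hornerC.
set S := \sum_(l < d.+2) _.
have S0 : 0 <= S by apply: sumr_ge0.
have SD : \sum_(l < d.+1) `|(pdiff p).[l%:R]| <= 2 * S.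
  apply: le_trans (_ : \sum_(l < d.+1) (`|p.[l.+1%:R]| + `|p.[l%:R]|) <= _).
    apply: ler_sum => l _; rewrite horner_pdiff natr1.
    exact: ler_normB.
  rewrite big_split /= mulr_natl mulr2n; apply: lerD.
    by rewrite /S [leRHS]big_ord_recl /= lerDr.
  by rewrite /S [leRHS]big_ord_recr /= lerDl.
have step h : (h <= H)%N -> `|p.[h%:R]| <= S + h%:R * ((2 * H%:R + 1) ^+ d * (2 * S)).
  elim: h => [_|h IHh hH].
    by rewrite mul0r addr0 /S big_ord_recl /= lerDl sumr_ge0.
  have -> : p.[h.+1%:R] = p.[h%:R] + (pdiff p).[h%:R].
    by rewrite horner_pdiff natr1 addrCA subrr addr0.
  apply: le_trans (ler_normD _ _) _.
  rewrite -[h.+1%:R]natr1 mulrDl mul1r addrA; apply: lerD; first exact: IHh (ltnW hH).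
  apply: le_trans (IHd _ h (size_pdiff sp)) _.
  apply: ler_pM => //; first by rewrite exprn_ge0 // addr_ge0 ?mulr_ge0.
    exact: sumr_ge0.
  rewrite lerXn2r ?nnegrE ?addr_ge0 ?mulr_ge0 // lerD2r ler_pM2l // ler_nat.
  exact: ltnW.
apply: le_trans (step H (leqnn H)) _.
rewrite exprS; set A := (2 * H%:R + 1) ^+ d.
have A1 : 1 <= A by rewrite /A exprn_ege1 // lerDr mulr_ge0.
have -> : (2 * H%:R + 1) * A * S = S + H%:R * (A * (2 * S)) + (A - 1) * S by ring.
by rewrite lerDl mulr_ge0 // subr_ge0.
Qed.

(** Up to sign this is the [M]-th finite difference of [p] at 0. *)
Lemma alternating_binomial_sum M p : (size p <= M)%N ->
  \sum_(i < M.+1) (-1) ^+ i * 'C(M, i)%:R * p.[i%:R] = 0.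
Proof.
elim: M p => [|M IHM] p sp.
  by rewrite big_ord1 bin0 (size_poly_leq0P _ sp) horner0 mulr0.
have -> : \sum_(i < M.+2) (-1) ^+ i * 'C(M.+1, i)%:R * p.[i%:R] =
    - \sum_(i < M.+1) (-1) ^+ i * 'C(M, i)%:R * (pdiff p).[i%:R].
  under [in RHS]eq_bigr do rewrite horner_pdiff natr1 mulrBr.
  rewrite sumrB opprB big_ord_recl /= bin0 expr0 !mul1r.
  under eq_bigr do rewrite /bump /= add1n binS natrD mulrDr mulrDl.
  rewrite big_split /= addrA; congr (_ + _).
    rewrite big_ord_recr /= bin_small // mulr0 mul0r addr0.
    by rewrite [in RHS]big_ord_recl /= bin0 expr0 !mul1r.
  by rewrite -sumrN; apply: eq_bigr => i _; rewrite exprS mulN1r !mulNr.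
by rewrite IHM ?oppr0 // size_pdiff.
Qed.

End Difference.

(** * Binomial thinning *)

Section Thinning.
Variable R : realFieldType.
Implicit Types (p : {poly R}) (x : R) (T s : nat).

(** Recursion on the coins, instead of the closed formula, lets [thinning_poly] peel off one coin as
    a finite difference. *)
Fixpoint binomial_pmf T x s : R :=
  if T is T'.+1 then
    (1 - x) * binomial_pmf T' x s + x * (if s is s'.+1 then binomial_pmf T' x s' else 0)
  else (s == 0%N)%:R.

Lemma binomial_pmf_ge0 T x s : 0 <= x <= 1 -> 0 <= binomial_pmf T x s.
Proof.
move=> /andP [x0 x1]; elim: T s => [|T IHT] s /=; first by rewrite ler0n.
by rewrite addr_ge0 // mulr_ge0 ?subr_ge0 //; case: s.
Qed.

(** This is the union bound over [s]-tuples of coins. It is applied with [T * x] at most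
    [1 / (100 m)]. *)
Lemma binomial_pmf_le T x s : 0 <= x <= 1 -> binomial_pmf T x s <= (T%:R * x) ^+ s.
Proof.
move=> x01; elim: T s => [|T IHT] s /=; first by rewrite mul0r expr0n.
have x0 : 0 <= x by case/andP: x01.
have Tx0 : 0 <= T%:R * x :> R by rewrite mulr_ge0.
case: s => [|s].
  rewrite mulr0 addr0; apply: le_trans (ler_piMl _ _) (IHT 0%N).
    exact: binomial_pmf_ge0.
  by rewrite gerBl.
apply: le_trans (_ : (T%:R * x) ^+ s.+1 + x * (T%:R * x) ^+ s <= _).
  apply: lerD.
    apply: le_trans (ler_piMl _ _) (IHT _); first exact: binomial_pmf_ge0.
    by rewrite gerBl.
  by rewrite ler_wpM2l ?IHT.
have -> : (T%:R * x) ^+ s.+1 + x * (T%:R * x) ^+ s = (T.+1%:R * x) * (T%:R * x) ^+ s.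
  by rewrite -natr1 exprS; ring.
rewrite exprS ler_wpM2l ?mulr_ge0 // lerXn2r ?nnegrE ?mulr_ge0 //.
by rewrite ler_wpM2r // ler_nat.
Qed.

Lemma binomial_pmf_big T x s : (T < s)%N -> binomial_pmf T x s = 0.
Proof.
elim: T s => [|T IHT] s /=; first by case: s.
by case: s => [//|s] Ts; rewrite !IHT ?mulr0 ?addr0 // ltnW.
Qed.

Lemma binomial_pmf1 T s : binomial_pmf T 1 s = (s == T)%:R.
Proof. by elim: T s => [|T IHT] [|s] //=; rewrite subrr mul0r add0r mul1r. Qed.

(** One more coin changes the mean of [p] by [x] times the mean of [pdiff p], so every power of [x]
    uses up one degree of [p]. Hence the degree in [x] does not grow with the number [T] of
    coins. *)
Lemma thinning_poly T p : exists2 q : {poly R}, (size q <= size p)%N &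
  forall x N, (T < N)%N -> q.[x] = \sum_(s < N) binomial_pmf T x s * p.[s%:R].
Proof.
elim: T p => [|T IHT] p.
  exists p.[0]%:P => [|x [//|N] _].
    have [->|p0] := eqVneq p 0; first by rewrite horner0 polyC0.
    by apply: leq_trans (size_polyC_leq1 _) _; rewrite lt0n size_poly_eq0.
  rewrite hornerC big_ord_recl /= mul1r big1 ?addr0 // => i _.
  by rewrite mul0r.
have [q sq qE] := IHT p; have [r sr rE] := IHT (pdiff p).
exists (q + r * 'X) => [|x [//|N] TN].
  have [p0|p0] := eqVneq p 0.
    have [q0 r0] : q = 0 /\ r = 0.
      split; apply/eqP; rewrite -size_poly_leq0.
        by rewrite (leq_trans sq) // p0 size_poly0.
      by rewrite (leq_trans sr) // /pdiff p0 comp_poly0 subrr size_poly0.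
    by rewrite q0 r0 mul0r addr0 size_poly0.
  apply: leq_trans (size_polyD _ _) _; rewrite geq_max sq /=.
  apply: leq_trans (size_polyMleq _ _) _; rewrite size_polyX addn2 /=.
  rewrite -size_poly_gt0 in p0; case E: (size p) p0 => [//|d] _.
  by rewrite ltnS (leq_trans sr) // size_pdiff // E.
rewrite hornerD hornerMX /=.
under eq_bigr do rewrite mulrDl.
rewrite big_split /= [X in _ = _ + X]big_ord_recl /= mulr0 mul0r add0r.
rewrite (qE x N.+1) ?(ltnW TN) // (rE x N) //.
rewrite [X in X + _ = _]big_ord_recr [X in _ = X + _]big_ord_recr /=.
rewrite binomial_pmf_big // mulr0 !mul0r !addr0 mulr_suml -!big_split /=.
apply: eq_bigr => s _; rewrite horner_pdiff natr1 /bump /= add1n; ring.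
Qed.

End Thinning.

(** * A pair of light-tailed mass functions with matching moments *)

Lemma sum_ord_delta (R : pzSemiRingType) (N s : nat) (h : nat -> R) : (s < N)%N ->
  \sum_(t < N) (nat_of_ord t == s)%:R * h t = h s.
Proof.
move=> sN; rewrite (bigD1 (Ordinal sN)) //= eqxx mul1r big1 ?addr0 // => t.
by rewrite -val_eqE /= => /negbTE ->; rewrite mul0r.
Qed.

Lemma bernoulli_ge (R : realFieldType) (x : R) (N : nat) :
  -1 <= x -> 1 + N%:R * x <= (1 + x) ^+ N.
Proof.
move=> x1; elim: N => [|N IHN]; first by rewrite mul0r addr0 expr0.
have x0 : 0 <= 1 + x by lra.
rewrite exprS; apply: le_trans (ler_wpM2l x0 IHN).
have -> : (1 + x) * (1 + N%:R * x) = 1 + N.+1%:R * x + N%:R * x ^+ 2 by rewrite -natr1; ring.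
by rewrite lerDl mulr_ge0 // sqr_ge0.
Qed.

Lemma geometric_sum_le2 (R : realFieldType) (y : R) (N : nat) :
  0 <= y <= 2^-1 -> \sum_(i < N) y ^+ i <= 2.
Proof.
move=> /andP [y0 y1]; elim: N => [|N IHN]; first by rewrite big_ord0.
rewrite big_ord_recl expr0; under eq_bigr do rewrite lift0 exprS.
rewrite -mulr_sumr.
have : y * (\sum_(i < N) y ^+ i) <= 2^-1 * 2 by apply: ler_pM => //; apply: sumr_ge0 => i _; rewrite exprn_ge0.
by rewrite mulVf //; lra.
Qed.

Lemma sum_inv_square_le2 (R : realFieldType) (m : nat) :
  \sum_(i < m) (i.+1%:R ^- 2 : R) <= 2.
Proof.
suff H : \sum_(i < m.+1) (i.+1%:R ^- 2 : R) <= 2 - m.+1%:R^-1.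
  apply: le_trans (_ : \sum_(i < m.+1) (i.+1%:R ^- 2 : R) <= _).
    by rewrite big_ord_recr /= lerDl invr_ge0 exprn_ge0.
  by apply: le_trans H _; rewrite gerBl invr_ge0.
elim: m => [|m IHm]; first by rewrite big_ord1 expr1n invr1; lra.
rewrite big_ord_recr /=; apply: le_trans (lerD IHm (lexx _)) _.
rewrite -subr_ge0.
have a0 : (0 : R) < m.+1%:R by rewrite ltr0Sn.
rewrite -[m.+2%:R]natr1; move: (m.+1%:R : R) a0 => a a0.
have -> : 2 - (a + 1)^-1 - (2 - a^-1 + (a + 1) ^- 2) = (a * (a + 1) ^+ 2)^-1.
  by field; rewrite !gt_eqF //; lra.
by rewrite invr_ge0 mulr_ge0 ?exprn_ge0 //; lra.
Qed.

(** The factor 100 keeps these points away from the extra nodes 1 and 3 and makes their total mass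
    small. *)
Definition node (j : nat) : nat := (100 * j ^ 2)%N.

(** Vanishing at 0 makes every sampled counter positive. The geometric lower bound lets [l] dominate
    the binomial thinning of a counter at rate [1 / (100 m * node m)]. The bound on the exponential
    moment makes the tilt cost only [2 ^ O(n)] over [n * m] counters. *)
Definition light_mass (R : realFieldType) (m : nat) (l : nat -> R) : Prop :=
  [/\ l 0%N = 0, forall t, (0 < t)%N -> 4^-1 * (100 * m%:R) ^- t.-1 <= l t,
      \sum_(t < (node m).+1) l t = 1 &
      \sum_(t < (node m).+1) l t * (1 + (200 * m%:R)^-1) ^+ t <= 1 + m%:R^-1].

Section HardPair.
Variables (R : realFieldType) (m : nat).
Hypothesis m_gt0 : (0 < m)%N.

Let s (j : nat) : R := (node j)%:R.
Let rho (j : nat) : R := 'C(m.*2, m + j)%:R / 'C(m.*2, m)%:R.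
Variable x : R.
Hypothesis xE : x = (200 * m%:R)^-1.

Let mR_gt0 : 0 < m%:R :> R. Proof. by rewrite ltr0n. Qed.
Let x_gt0 : 0 < x. Proof. by rewrite xE invr_gt0 mulr_gt0. Qed.
Let x_le : x <= 200^-1.
Proof. by rewrite xE lef_pV2 ?posrE ?mulr_gt0 // ler_peMr // ler1n. Qed.

Let tilt_ge1 : 1 <= 1 + x. Proof. by rewrite lerDl ltW. Qed.
Let tilt_ge0 : 0 <= 1 + x. Proof. exact: le_trans tilt_ge1. Qed.

Let rho_ge0 j : 0 <= rho j. Proof. by rewrite divr_ge0. Qed.

Let C0 : 'C(m.*2, m)%:R != 0 :> R.
Proof. by rewrite pnatr_eq0 -lt0n bin_gt0 -addnn leq_addr. Qed.

Lemma node_ge j : (0 < j)%N -> 100 * j%:R ^+ 2 = s j /\ 100 <= s j.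
Proof.
move=> j0; have -> : s j = 100 * j%:R ^+ 2 by rewrite /s /node natrM natrX.
by split => //; rewrite ler_peMr // exprn_ege1 // ler1n.
Qed.

(** Gaussian decay beats the tilt. From [j] to [j + 1], [rho] is multiplied by [1 - (2j+1)/(m+j+1)],
    while the tilt gains [N = 100 (2j+1)] factors [1 + x]. The choice of [x] gives
    [N x = (2j+1)/(2m)], so the decay factor is at most [1 - N x <= (1 - x) ^ N]. *)
Lemma rho_tilt j : (j <= m)%N -> rho j * (1 + x) ^+ node j <= 1.
Proof.
elim: j => [_|j IHj jm].
  by rewrite /node muln0 expr0 mulr1 /rho addn0 divff.
have rhoS : rho j.+1 = rho j * ((m%:R - j%:R) / (m%:R + j%:R + 1)).
  rewrite /rho addnS.
  have := mul_bin_left m.*2 (m + j); rewrite -addnn subnDl => E.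
  have {}E : (m%:R + j%:R + 1) * 'C(m + m, (m + j).+1)%:R = (m%:R - j%:R) * 'C(m + m, m + j)%:R :> R.
    by rewrite -natrB ?(ltnW jm) // -natrD natr1 -!natrM E.
  have a0 : m%:R + j%:R + 1 != 0 :> R by rewrite -natrD natr1 pnatr_eq0.
  have C0' : 'C(m + m, m)%:R != 0 :> R by rewrite addnn.
  rewrite (_ : _%:R / _ = (m%:R + j%:R + 1)^-1 * ((m%:R + j%:R + 1) * 'C(m + m, (m + j).+1)%:R) / 'C(m + m, m)%:R).
    by rewrite E; field; apply/andP.
  by field; apply/andP.
have -> : node j.+1 = (node j + 100 * j.*2.+1)%N by rewrite /node -addnn; ring.
set N := (100 * _)%N.
rewrite rhoS exprD mulrACA.
apply: le_trans (ler_piMr _ _) (IHj (ltnW jm)); first by rewrite mulr_ge0 ?exprn_ge0.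
have jR : j%:R + 1 <= m%:R :> R by rewrite natr1 ler_nat.
have j0 : 0 <= j%:R :> R by [].
have [x0 xl m0] : [/\ 0 < x, x <= 200^-1 & 0 < m%:R :> R] by [].
apply: le_trans (_ : (1 - x) ^+ N * (1 + x) ^+ N <= _).
  rewrite ler_wpM2r ?exprn_ge0 //.
  apply: le_trans (_ : 1 + N%:R * - x <= _); last by apply: bernoulli_ge; lra.
  have -> : N%:R * - x = - ((2 * j%:R + 1) / (2 * m%:R)).
    have -> : N%:R = 100 * (2 * j%:R + 1) :> R.
      by rewrite /N natrM -[j.*2.+1]addn1 natrD -mul2n natrM.
    by rewrite xE; field; rewrite gt_eqF.
  rewrite ler_pdivrMr; last by lra.
  rewrite -subr_ge0 (_ : _ - _ = (2 * j%:R + 1) * (1 - (m%:R + j%:R + 1) / (2 * m%:R))); last first.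
    by field; rewrite gt_eqF.
  rewrite mulr_ge0 //; first by lra.
  rewrite subr_ge0 ler_pdivrMr; lra.
rewrite -exprMn_comm; last exact: mulrC.
by apply: exprn_ile1; nra.
Qed.

Lemma rho_le1 j : (j <= m)%N -> rho j <= 1.
Proof.
move=> /rho_tilt; apply: le_trans; apply: ler_peMr => //.
exact: exprn_ege1.
Qed.

(** The polynomial p(100 (X - m)^2) has degree below [2m], so its [2m]-th finite difference
    vanishes; the terms at [m - j] and [m + j] coincide and fold together. *)
Lemma square_nodes_sum (p : {poly R}) : (size p <= m)%N ->
  p.[0] + \sum_(i < m) 2 * (-1) ^+ i.+1 * rho i.+1 * p.[s i.+1] = 0.
Proof.
move=> sp.
pose g : {poly R} := p \Po (100%:P * ('X - m%:R%:P) ^+ 2).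
have sg : (size g <= m.*2)%N.
  apply: leq_trans (size_comp_poly_leq _ _) _.
  have -> : size (100%:P * ('X - m%:R%:P) ^+ 2 : {poly R}) = 3.
    by rewrite mul_polyC size_scale ?pnatr_eq0 // size_exp_XsubC.
  by move: sp; rewrite -addnn; lia.
have gE i : g.[i%:R] = p.[100 * (i%:R - m%:R) ^+ 2].
  by rewrite horner_comp !hornerE.
have := alternating_binomial_sum sg.
under eq_bigr do rewrite gE.
have -> : \sum_(i < m.*2.+1) (-1) ^+ i * 'C(m.*2, i)%:R * p.[100 * (i%:R - m%:R) ^+ 2] =
  (-1) ^+ m * 'C(m.*2, m)%:R * (p.[0] + \sum_(i < m) 2 * (-1) ^+ i.+1 * rho i.+1 * p.[s i.+1]).
  pose T i := (-1) ^+ i * 'C(m.*2, i)%:R * p.[100 * (i%:R - m%:R) ^+ 2] : R.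
  rewrite -(big_mkord predT T) (@big_cat_nat _ _ _ m) //=; last by rewrite -addnn; lia.
  rewrite [X in _ + X]big_ltn; last by rewrite -addnn; lia.
  rewrite {2}/T subrr expr0n mulr0 mulrDr addrCA; congr (_ + _).
  rewrite -[m.+1]add1n -{1}[(1 + m)%N]add0n big_addn.
  have -> : (m.*2.+1 - (1 + m) = m)%N by rewrite -addnn; lia.
  rewrite mulr_sumr big_rev_mkord subn0 !big_mkord -big_split /=.
  apply: eq_bigr => i _.
  have im : (i < m)%N := ltn_ord i.
  rewrite /T /=.
  have -> : (i + (1 + m) = m + i.+1)%N by lia.
  have Eb : 'C(m.*2, m - i.+1) = 'C(m.*2, m + i.+1).
    rewrite -bin_sub; last by rewrite -addnn; lia.
    by congr 'C(_, _); rewrite -addnn; lia.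
  have Es : s i.+1 = 100 * i.+1%:R ^+ 2 by case: (node_ge (ltn0Sn i)).
  have Em : (-1) ^+ m = (-1) ^+ (m - i.+1) * (-1) ^+ i.+1 :> R by rewrite -exprD subnK.
  have Eo : (-1) ^+ i.+1 * (-1) ^+ i.+1 = 1 :> R by rewrite -expr2 sqrr_sign.
  rewrite Eb natrB // natrD /rho Es exprD Em.
  have -> : m%:R - i.+1%:R - m%:R = - i.+1%:R :> R by ring.
  have -> : m%:R + i.+1%:R - m%:R = i.+1%:R :> R by ring.
  rewrite sqrrN.
  set A := (-1) ^+ (m - i.+1); set B := (-1) ^+ i.+1 in Eo *.
  have K00 := C0; set P := p.[_]; set K := 'C(_, m + _)%:R.
  set K0 := 'C(_, m)%:R in K00 *.
  have -> : A * B * K0 * (2 * B * (K / K0) * P) = A * (B * B) * (2 * K * P) * (K0 / K0) by field.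
  transitivity (A * K * P + A * (B * B) * K * P); first by ring.
  by rewrite Eo divff //; ring.
move/eqP; rewrite mulf_eq0 mulf_eq0 signr_eq0 (negbTE C0) /= => /eqP //.
Qed.

(** The signed measure [om] integrates every polynomial of degree below [m] to minus its value at 0,
    so [l2 = 2 l1 + om] satisfies the moment identity for any [l1]. It remains to choose [l1] large
    enough for [l2] to be positive: [atoms v] outweighs [om] at the far nodes, the mass [1 - A] left
    at 1 outweighs [c1], and [kap] supplies the geometric lower bound. *)
Let q : R := 2 * x.
Let b (j : nat) : R := 2 * (-1) ^+ j * rho j.
Let v (j : nat) : R := 6 * rho j / ((s j - 1) * (s j - 3)).
Let w (j : nat) : R := 3 * b j / ((s j - 1) * (s j - 3)).
Let atoms (c : nat -> R) (t : nat) : R := \sum_(i < m) (t == node i.+1)%:R * c i.+1.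
Let kap (t : nat) : R := if (t < 2)%N then 0 else q ^+ t.-1.
Let c1 : R := - (3 / 2) + 3 / 2 * \sum_(i < m) b i.+1 / (s i.+1 - 1).
Let c3 : R := 2^-1 - 3 / 2 * \sum_(i < m) b i.+1 / (s i.+1 - 3).
Let A : R := \sum_(t < (node m).+1) (kap t + atoms v t).
Let l1 (t : nat) : R := kap t + atoms v t + (t == 1%N)%:R * (1 - A).
Let om (t : nat) : R := (t == 1%N)%:R * c1 + (t == 3%N)%:R * c3 + atoms w t.
Let l2 (t : nat) : R := 2 * l1 t + om t.

Lemma node_inv_bounds (j : nat) : (0 < j)%N ->
  [/\ (s j - 1)^-1 <= j%:R ^- 2 / 99, (s j - 3)^-1 <= j%:R ^- 2 / 97,
      0 < s j - 1 /\ 0 < s j - 3,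
      ((s j - 1) * (s j - 3))^-1 <= j%:R ^- 2 / 9000 &
      s j / ((s j - 1) * (s j - 3)) <= j%:R ^- 2 / 90].
Proof.
move=> j0; have [<- _] := node_ge j0; set a := j%:R ^+ 2.
have a1 : 1 <= a by rewrite exprn_ege1 // ler1n.
have aN0 : a != 0 by rewrite gt_eqF //; lra.
have H1 : (100 * a - 1)^-1 <= a^-1 / 99.
  by rewrite -invfM lef_pV2 ?posrE; lra.
have H3 : (100 * a - 3)^-1 <= a^-1 / 97.
  by rewrite -invfM lef_pV2 ?posrE; lra.
have ai0 : 0 < a^-1 by rewrite invr_gt0; lra.
have ai1 : a^-1 <= 1 by rewrite invf_le1; lra.
have p1 : 0 < (100 * a - 1)^-1 by rewrite invr_gt0; lra.
have p3 : 0 < (100 * a - 3)^-1 by rewrite invr_gt0; lra.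
split => //; try lra.
  rewrite invfM; apply: le_trans (_ : (a^-1 / 99) * (1 / 97) <= _); last by lra.
  by apply: ler_pM; lra.
have -> : 100 * a / ((100 * a - 1) * (100 * a - 3)) =
          (100 * a - 3)^-1 * (1 + (100 * a - 1)^-1).
  by field; apply/andP; split; rewrite gt_eqF //; lra.
apply: le_trans (_ : a^-1 / 97 * (1 + 1 / 99) <= _); last by lra.
by apply: ler_pM; lra.
Qed.

Lemma norm_base_coef_le j : (j <= m)%N -> `|b j| <= 2.
Proof.
move=> jm; rewrite /b normrM (ger0_norm (rho_ge0 j)) normrM normrX normrN1 expr1n mulr1.
by rewrite ger0_norm // -[leRHS]mulr1 ler_pM2l // rho_le1.
Qed.

Lemma node_mass_ge0 i : 0 <= v i.+1.
Proof.
have [_ _ [h1 h3] _ _] := node_inv_bounds (ltn0Sn i).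
by apply: divr_ge0; [exact: mulr_ge0|apply: mulr_ge0; apply: ltW].
Qed.

Lemma norm_dual_coef i : `|w i.+1| = v i.+1.
Proof.
have [_ _ [h1 h3] _ _] := node_inv_bounds (ltn0Sn i).
rewrite /w /v /b normrM [X in X * _]normrM [X in _ * X * _]normrM (ger0_norm (rho_ge0 _)).
rewrite [X in _ * (X * _) * _]normrM normrX normrN1 expr1n mulr1 normfV normrM.
by rewrite !gtr0_norm //; ring.
Qed.

Lemma sum_atoms c h :
  \sum_(t < (node m).+1) atoms c t * h (t : nat) = \sum_(i < m) c i.+1 * h (node i.+1).
Proof.
rewrite /atoms; under eq_bigr do rewrite mulr_suml.
rewrite exchange_big /=; apply: eq_bigr => i _.
rewrite -(@sum_ord_delta _ (node m).+1 (node i.+1) (fun t => c i.+1 * h t)).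
  by apply: eq_bigr => t _; rewrite mulrA.
by rewrite ltnS /node leq_mul2l leq_sqr ltn_ord.
Qed.

Lemma atoms_small c t : (t < 100)%N -> atoms c t = 0.
Proof.
move=> t100; rewrite /atoms big1 // => i _.
rewrite (_ : (t == _) = false) ?mul0r //; apply/negbTE; rewrite neq_ltn.
apply/orP; left; apply: leq_trans t100 _.
by rewrite /node leq_pmulr // expn_gt0.
Qed.

Lemma atoms_node_mass_ge0 t : 0 <= atoms v t.
Proof. by apply: sumr_ge0 => i _; rewrite mulr_ge0 // node_mass_ge0. Qed.

Lemma atoms_dual_coef_le t : `|atoms w t| <= atoms v t.
Proof.
apply: le_trans (ler_norm_sum _ _ _) _; apply: ler_sum => i _.
by rewrite normrM norm_dual_coef ger0_norm.
Qed.

Lemma ratio_bounds : 0 < q <= 100^-1.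
Proof. by have := x_gt0; have := x_le; rewrite /q; lra. Qed.

Lemma geometric_mass_ge0 t : 0 <= kap t.
Proof.
rewrite /kap; case: ifP => // _; rewrite exprn_ge0 //.
by have /andP [] := ratio_bounds; lra.
Qed.

Lemma sum_geometric_mass_le N (y : R) : 0 <= y <= 2 -> \sum_(t < N) kap t * y ^+ t <= 4 * y * q.
Proof.
move=> y02; have /andP [q0 q1] := ratio_bounds; have /andP [y0 y2] := y02.
(* Two extra terms allow the zero values at 0 and 1 to be split off for every [N]. *)
apply: le_trans (_ : \sum_(t < N.+2) kap t * y ^+ t <= _).
  rewrite 2!big_ord_recr /= -addrA lerDl addr_ge0 // mulr_ge0 ?geometric_mass_ge0 ?exprn_ge0 //.
rewrite 2!big_ord_recl /= /kap /= !mul0r !add0r.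
under eq_bigr => i _ do rewrite /bump /= !add1n /= exprS mulrCA -exprMn exprS.
rewrite -mulr_sumr -mulr_sumr.
have yq : 0 <= q * y <= 2^-1 by apply/andP; split; nra.
have := geometric_sum_le2 N yq; move: (\sum_(i < N) _) => S S2.
have : (q * y) * S <= (q * y) * 2 by rewrite ler_wpM2l //; case/andP: yq.
have : 0 <= q * y by case/andP: yq.
by nra.
Qed.

Lemma rest_mass_bounds : 0 <= A <= 20^-1.
Proof.
apply/andP; split.
  by apply: sumr_ge0 => t _; rewrite addr_ge0 ?geometric_mass_ge0 ?atoms_node_mass_ge0.
rewrite /A big_split /=.
have H1 : \sum_(t < (node m).+1) kap t <= 4 * 1 * q.
  have := @sum_geometric_mass_le (node m).+1 1; rewrite ler01 ler1n => /(_ isT).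
  by under eq_bigr do rewrite expr1n mulr1.
have H2 : \sum_(t < (node m).+1) atoms v t <= 500^-1.
  have := sum_atoms v (fun=> 1); under eq_bigr do rewrite mulr1.
  move=> ->; apply: le_trans (_ : \sum_(i < m) i.+1%:R ^- 2 / 1000 <= _).
    apply: ler_sum => i _; rewrite mulr1 /v.
    have [_ _ [h1 h3] H _] := node_inv_bounds (ltn0Sn i).
    apply: le_trans (_ : 6 * 1 / ((s i.+1 - 1) * (s i.+1 - 3)) <= _).
      rewrite ler_wpM2r ?invr_ge0 ?mulr_ge0 ?(ltW h1) ?(ltW h3) //.
      by rewrite ler_pM2l // rho_le1.
    have : 0 <= (i.+1%:R ^- 2 : R) by rewrite invr_ge0 exprn_ge0.
    move: H; set Z := ((_ - _) * _)^-1; set Y := i.+1%:R ^- 2.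
    by clearbody Z Y; lra.
  rewrite -mulr_suml; have := sum_inv_square_le2 R m; lra.
by have /andP [_] := ratio_bounds; lra.
Qed.

(** Without the far nodes the coefficients would be [-3/2] and [1/2], as in a second divided
    difference at 0, 1, 3. The far nodes shift them only slightly, since [1 / node j] is summable
    with a small total. *)
Lemma near_coef_bounds : [/\ - (8 / 5) <= c1, c1 <= 0, 0 <= c3 & c3 <= 1].
Proof.
have key (c : R) (g : nat -> R) : 0 <= c ->
    (forall i, (i < m)%N -> 0 <= g i.+1 /\ g i.+1 <= i.+1%:R ^- 2 * c) ->
    `|\sum_(i < m) b i.+1 * g i.+1| <= 4 * c.
  move=> c0 H; apply: le_trans (ler_norm_sum _ _ _) _.
  apply: le_trans (_ : \sum_(i < m) i.+1%:R ^- 2 * (2 * c) <= _).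
    apply: ler_sum => i _; have [g0 gc] := H i (ltn_ord i).
    rewrite normrM (ger0_norm g0) mulrCA; apply: ler_pM => //.
    exact: norm_base_coef_le.
  rewrite -mulr_suml.
  have : \sum_(i < m) (i.+1%:R ^- 2 : R) * (2 * c) <= 2 * (2 * c).
    by rewrite -mulr_suml ler_wpM2r ?mulr_ge0 // sum_inv_square_le2.
  by rewrite -mulr_suml; lra.
have K1 : `|\sum_(i < m) b i.+1 / (s i.+1 - 1)| <= 4 * 99^-1.
  apply: (key _ (fun j => (s j - 1)^-1)) => [|i im]; first by rewrite invr_ge0.
  by have [h _ [h1 _] _ _] := node_inv_bounds (ltn0Sn i); rewrite invr_ge0 (ltW h1).
have K3 : `|\sum_(i < m) b i.+1 / (s i.+1 - 3)| <= 4 * 97^-1.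
  apply: (key _ (fun j => (s j - 3)^-1)) => [|i im]; first by rewrite invr_ge0.
  by have [_ h [_ h3] _ _] := node_inv_bounds (ltn0Sn i); rewrite invr_ge0 (ltW h3).
move: K1 K3; rewrite !ler_norml /c1 /c3.
move: (\sum_(i < m) _) (\sum_(i < m) _) => S1 S3.
by move=> /andP [? ?] /andP [? ?]; split; lra.
Qed.

(** [square_nodes_sum] is applied to the second divided difference [p2] of [p] at 0-independent
    points 1 and 3. Its value at a far node carries the denominator [(s - 1) * (s - 3)], which is
    the damping, and the factor 3 makes the coefficient of [p.[0]] in [3 * p2.[0]] equal to 1. *)
Lemma sum_dual_coef (p : {poly R}) : (size p <= m)%N ->
  \sum_(t < (node m).+1) om t * p.[t%:R] = - p.[0].
Proof.
move=> sp.
have size_quot (r r' : {poly R}) a : (size r <= m)%N -> r - r.[a]%:P = r' * ('X - a%:P) ->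
    (size r' <= m)%N.
  move=> sr E; have [->|r'0] := eqVneq r' 0; first by rewrite size_poly0.
  apply: leq_trans (leqnSn _) _.
  have <- : size (r' * ('X - a%:P)) = (size r').+1.
    by rewrite size_Mmonic ?monicXsubC // size_XsubC addn2.
  rewrite -E; apply: leq_trans (size_polyD _ _) _; rewrite geq_max sr size_polyN.
  exact: leq_trans (size_polyC_leq1 _) _.
have div (r : {poly R}) a : exists r', r - r.[a]%:P = r' * ('X - a%:P).
  by apply/factor_theorem; rewrite /root hornerD hornerN hornerC subrr.
have [p1 E1] := div p 1; have [p2 E2] := div p1 3.
have s2 : (size p2 <= m)%N := size_quot _ _ _ (size_quot _ _ _ sp E1) E2.
have V1 y : p.[y] = p.[1] + p1.[y] * (y - 1).
  by have := congr1 (fun r => r.[y]) E1; rewrite /= !hornerE => <-; ring.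
have V2 y : p1.[y] = p1.[3] + p2.[y] * (y - 3).
  by have := congr1 (fun r => r.[y]) E2; rewrite /= !hornerE => <-; ring.
have P13 : p1.[3] = (p.[3] - p.[1]) / 2 by rewrite (V1 3); field.
have P2 i : p2.[s i.+1] = p.[s i.+1] / ((s i.+1 - 1) * (s i.+1 - 3))
    + p.[1] * (2^-1 / (s i.+1 - 1)) - p.[3] * (2^-1 / (s i.+1 - 3)).
  have [_ _ [h1 h3] _ _] := node_inv_bounds (ltn0Sn i).
  rewrite (V1 (s i.+1)) (V2 (s i.+1)) P13; field.
  by rewrite !gt_eqF.
have P20 : 3 * p2.[0] = p.[0] - 3 / 2 * p.[1] + 2^-1 * p.[3].
  by rewrite (V1 0) (V2 0) P13; field.
have B0 : 3 * (p2.[0] + \sum_(i < m) b i.+1 * p2.[s i.+1]) = 0.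
  by rewrite square_nodes_sum ?mulr0.
have ES : 3 * \sum_(i < m) b i.+1 * p2.[s i.+1] =
    \sum_(i < m) w i.+1 * p.[s i.+1] + p.[1] * (c1 + 3 / 2) + p.[3] * (c3 - 2^-1).
  have -> : c1 + 3 / 2 = \sum_(i < m) 3 / 2 * (b i.+1 / (s i.+1 - 1)).
    by rewrite /c1 -mulr_sumr; ring.
  have -> : c3 - 2^-1 = \sum_(i < m) - (3 / 2 * (b i.+1 / (s i.+1 - 3))).
    by rewrite /c3 sumrN -mulr_sumr; ring.
  rewrite !mulr_sumr -!big_split /=; apply: eq_bigr => i _.
  have [_ _ [h1 h3] _ _] := node_inv_bounds (ltn0Sn i).
  by rewrite P2 /w; field; rewrite !gt_eqF.
have m3 : (3 < (node m).+1)%N.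
  by rewrite ltnS (@leq_trans 100) // /node leq_pmulr // expn_gt0 m_gt0.
have m1 : (1 < (node m).+1)%N by apply: leq_trans m3.
rewrite /om; under eq_bigr do rewrite !mulrDl -!mulrA.
rewrite !big_split /= (sum_ord_delta (fun t => c1 * p.[t%:R])) //.
rewrite (sum_ord_delta (fun t => c3 * p.[t%:R])) //.
rewrite (sum_atoms w (fun t => p.[t%:R])) -/(s _).
move: B0; rewrite mulrDr ES P20 => B0; apply/eqP; rewrite -subr_eq0; apply/eqP.
by rewrite -[RHS]B0; field.
Qed.

(** A common upper bound for [l1] and [l2], so that the exponential moment is estimated only
    once. *)
Let U (t : nat) : R :=
  (t == 1%N)%:R * 2 + (t == 3%N)%:R * 2 + 2 * kap t + 3 * atoms v t.

Lemma l1_le_envelope t : l1 t <= U t.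
Proof.
have := geometric_mass_ge0 t; have := atoms_node_mass_ge0 t; have /andP [] := rest_mass_bounds.
by rewrite /l1 /U; case: eqP => _; case: eqP => _ /=; lra.
Qed.

Lemma l2_le_envelope t : l2 t <= U t.
Proof.
have := geometric_mass_ge0 t; have := atoms_node_mass_ge0 t; have /andP [] := rest_mass_bounds.
have [? ? ? ?] := near_coef_bounds; have := atoms_dual_coef_le t; rewrite ler_norml => /andP [].
by rewrite /l2 /l1 /om /U; case: eqP => _; case: eqP => _ /=; lra.
Qed.

Lemma l1_ge t : (0 < t)%N -> 4^-1 * q ^+ t.-1 <= l1 t.
Proof.
move=> t0; have := geometric_mass_ge0 t; have := atoms_node_mass_ge0 t; have /andP [] := rest_mass_bounds.
rewrite /l1; case: t t0 => [//|[|t]] _.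
  by rewrite expr0 mulr1 /=; lra.
by rewrite /kap /=; lra.
Qed.

Lemma l2_ge t : (0 < t)%N -> 4^-1 * q ^+ t.-1 <= l2 t.
Proof.
move=> t0; have := geometric_mass_ge0 t; have := atoms_node_mass_ge0 t; have /andP [] := rest_mass_bounds.
have [? ? ? ?] := near_coef_bounds; have := atoms_dual_coef_le t; rewrite ler_norml => /andP [].
rewrite /l2 /l1 /om; case: t t0 => [//|[|t]] _.
  by rewrite expr0 mulr1 /=; lra.
rewrite /kap /=; case: eqP => _ /=; lra.
Qed.

Lemma sum_l1 : \sum_(t < (node m).+1) l1 t = 1.
Proof.
rewrite /l1 big_split /= -/A.
rewrite (sum_ord_delta (fun=> 1 - A)); first by ring.
by rewrite ltnS /node muln_gt0 expn_gt0 m_gt0.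
Qed.

Lemma pow_tilt_sub1 N : (1 + x) ^+ N - 1 <= N%:R * x * (1 + x) ^+ N.
Proof.
elim: N => [|N IHN]; first by rewrite expr0 subrr mul0r mul0r.
have g1 := exprn_ege1 N tilt_ge1; have := x_gt0.
rewrite exprS -natr1; move: ((1 + x) ^+ N) (N%:R : R) (ler0n R N) g1 IHN => G n n0 G1 IH x0.
have : 0 <= n * x * x * G by rewrite !mulr_ge0 //; lra.
have : 0 <= x * x * G by rewrite !mulr_ge0 //; lra.
by nra.
Qed.

(** Every part of [U] contributes O(x). At the far nodes [rho_tilt] absorbs the tilt, and what
    remains is [x * node j] times the damping. As [node j] grows like [j ^ 2], both denominators are
    needed to leave a summable [j ^ -2]. *)
Lemma tilted_envelope : \sum_(t < (node m).+1) U t * ((1 + x) ^+ t - 1) <= m%:R^-1.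
Proof.
have xm : m%:R^-1 = 200 * x by rewrite xE; field; rewrite gt_eqF.
rewrite xm /U; under eq_bigr do rewrite !mulrDl -!mulrA.
rewrite !big_split /=.
have m3 : (3 < (node m).+1)%N.
  by rewrite ltnS (@leq_trans 100) // /node leq_pmulr // expn_gt0 m_gt0.
have m1 : (1 < (node m).+1)%N by apply: leq_trans m3.
rewrite (sum_ord_delta (fun t => 2 * ((1 + x) ^+ t - 1))) //.
rewrite (sum_ord_delta (fun t => 2 * ((1 + x) ^+ t - 1))) // -!mulr_sumr.
rewrite (sum_atoms v (fun t => (1 + x) ^+ t - 1)).
have [x0 xl] : 0 < x /\ x <= 200^-1 by split.
have H1 : \sum_(t < (node m).+1) kap t * ((1 + x) ^+ t - 1) <= 8 * q.
  apply: le_trans (_ : \sum_(t < (node m).+1) kap t * 2 ^+ t <= _).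
    apply: ler_sum => t _; rewrite ler_wpM2l ?geometric_mass_ge0 //.
    apply: le_trans (_ : (1 + x) ^+ t <= _); first by rewrite gerBl.
    by rewrite lerXn2r ?nnegrE //; lra.
  apply: le_trans (sum_geometric_mass_le _ _) _; first by apply/andP; split; lra.
  by lra.
have H2 : \sum_(i < m) v i.+1 * ((1 + x) ^+ node i.+1 - 1) <= x.
  apply: le_trans (_ : \sum_(i < m) i.+1%:R ^- 2 * (x / 10) <= _).
    apply: ler_sum => i _.
    have [_ _ [h1 h3] _ H] := node_inv_bounds (ltn0Sn i).
    apply: le_trans (ler_wpM2l (node_mass_ge0 i) (pow_tilt_sub1 _)) _.
    have rt := @rho_tilt i.+1 (ltn_ord i).
    rewrite (_ : v i.+1 * _ = (rho i.+1 * (1 + x) ^+ node i.+1) *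
       (6 * x * (s i.+1 / ((s i.+1 - 1) * (s i.+1 - 3))))); last first.
      by rewrite /v -/(s i.+1); field; rewrite !gt_eqF.
    apply: le_trans (_ : 1 * (6 * x * (i.+1%:R ^- 2 / 90)) <= _); last first.
      have Y0 : 0 <= (i.+1%:R ^- 2 : R) by rewrite invr_ge0 exprn_ge0.
      move: (_ ^- 2 : R) Y0 => Y Y0; have : 0 <= Y * x by rewrite mulr_ge0 // ltW.
      by lra.
    have s0 : 0 <= s i.+1 by rewrite /s.
    apply: ler_pM => //; first by rewrite mulr_ge0 ?exprn_ge0.
      by rewrite !mulr_ge0 ?invr_ge0 ?mulr_ge0 ?(ltW h1) ?(ltW h3) ?(ltW x0).
    by rewrite ler_wpM2l // mulr_ge0 // ltW.
  rewrite -mulr_suml; have := sum_inv_square_le2 R m.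
  by move: (\sum_(i < m) _) => S S2; nra.
have H3 : (1 + x) ^+ 3 - 1 <= 7 * x.
  have -> : (1 + x) ^+ 3 - 1 = 3 * x + (3 * x + x ^+ 2) * x by ring.
  by nra.
rewrite expr1; move: H1 H2 H3; rewrite /q.
move: (\sum_(t < _) _) (\sum_(i < _) _) => S1 S2; lra.
Qed.

Lemma light_pair :
  [/\ light_mass m l1, light_mass m l2 &
    forall e, (e < m)%N ->
      \sum_(t < (node m).+1) l1 t * t%:R ^+ e =
      2^-1 * ((e == 0%N)%:R + \sum_(t < (node m).+1) l2 t * t%:R ^+ e)].
Proof.
have qE : q = (100 * m%:R)^-1 by rewrite /q xE; field; rewrite gt_eqF.
have mom e : (e < m)%N -> \sum_(t < (node m).+1) l2 t * t%:R ^+ e =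
    2 * (\sum_(t < (node m).+1) l1 t * t%:R ^+ e) - (e == 0%N)%:R.
  move=> em; under eq_bigr do rewrite /l2 mulrDl -mulrA.
  rewrite big_split /= -mulr_sumr; congr (_ + _).
  have := @sum_dual_coef 'X^e; rewrite size_polyXn => /(_ em).
  have -> : \sum_(t < (node m).+1) om t * ('X^e).[t%:R] =
            \sum_(t < (node m).+1) om t * t%:R ^+ e.
    by apply: eq_bigr => t _; rewrite hornerXn.
  by move=> ->; rewrite hornerXn expr0n.
have sum_l2 : \sum_(t < (node m).+1) l2 t = 1.
  have := mom 0%N m_gt0; under eq_bigr do rewrite expr0 mulr1.
  by under [in RHS]eq_bigr do rewrite expr0 mulr1; rewrite sum_l1 => ->; rewrite eqxx /=; lra.
have tilt l : \sum_(t < (node m).+1) l t = 1 -> (forall t, l t <= U t) ->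
    \sum_(t < (node m).+1) l t * (1 + (200 * m%:R)^-1) ^+ t <= 1 + m%:R^-1.
  move=> lE lU; rewrite -xE -lerBlDl -[X in _ - X]lE -sumrB.
  apply: le_trans tilted_envelope; apply: ler_sum => t _.
  rewrite (_ : _ - l t = l t * ((1 + x) ^+ t - 1)); last by ring.
  by apply: ler_wpM2r (lU t); rewrite subr_ge0; apply: exprn_ege1.
split.
- split; [|move=> t t0|exact: sum_l1|by apply: tilt sum_l1 l1_le_envelope].
    by rewrite /l1 /kap /= atoms_small // mul0r !addr0.
  by rewrite -exprVn -qE l1_ge.
- split; [|move=> t t0|exact: sum_l2|by apply: tilt sum_l2 l2_le_envelope].
    by rewrite /l2 /l1 /om /kap /= !atoms_small // !mul0r !addr0 mulr0.
  by rewrite -exprVn -qE l2_ge.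
by move=> e em; rewrite mom //; field.
Qed.

End HardPair.

(* The dual polynomial is supported on the nodes 0, 1, 3 and 100 j^2: the
   nodes 100 j^2 yield orthogonality to degree < m with Gaussian weights, and
   the extra nodes 1 and 3 damp the weight of t by a further factor t^-2. *)
Lemma exists_light_pair (R : realFieldType) (m : nat) : (0 < m)%N ->
  exists l1 l2 : nat -> R, [/\ light_mass m l1, light_mass m l2 &
    forall e, (e < m)%N ->
      \sum_(t < (node m).+1) l1 t * t%:R ^+ e =
      2^-1 * ((e == 0%N)%:R + \sum_(t < (node m).+1) l2 t * t%:R ^+ e)].
Proof.
move=> m0; have H := light_pair m0 (erefl (200 * m%:R : R)^-1).
by eexists; eexists; exact: H.
Qed.

(** * Low-degree polynomials do not see the tail of a product measure *)

(* [k h t] is a signed measure that interpolates polynomially in [h], between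
   a measure close to [l] for small [h] and the point mass at [t] for [h = H]. *)
Definition interpolating_kernel (R : realFieldType) (N H d : nat) (g B : R)
    (l : nat -> R) (k : nat -> nat -> nat -> R) : Prop :=
  [/\ forall t e, (t < N)%N -> l t != 0 -> exists2 q : {poly R}, (size q <= e.*2.+1)%N &
        forall h, q.[h%:R] = \sum_(w < N) k h t w * w%:R ^+ e,
      forall t w, (t < N)%N -> (w < N)%N -> l t != 0 -> k H t w = (t == w)%:R &
      forall h w, (h <= d)%N -> (w < N)%N ->
        \sum_(t < N) l t * g ^+ t * `|k h t w| <= B * l w].

Lemma size_prod_le (R : nzRingType) (I : Type) (r : seq I) (d : I -> nat)
    (q : I -> {poly R}) : (forall i, size (q i) <= (d i).+1)%N ->
  (size (\prod_(i <- r) q i)%R <= (\sum_(i <- r) d i).+1)%N.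
Proof.
move=> H; elim: r => [|i r IHr]; first by rewrite !big_nil size_poly1.
rewrite !big_cons; apply: leq_trans (size_polyMleq _ _) _.
by have := H i; move: IHr; lia.
Qed.

Section ProductMeasure.
Variables (R : realFieldType) (I : finType) (N : nat) (l : I -> nat -> R).

Definition prod_mass (z : {ffun I -> 'I_N}) : R := \prod_c l c (z c).

Definition expect (P : (I -> R) -> R) : R :=
  \sum_(z : {ffun I -> 'I_N}) prod_mass z * P (fun c => (z c)%:R).

Definition weight (z : {ffun I -> 'I_N}) : nat := (\sum_c z c)%N.

Hypothesis l_ge0 : forall c t, 0 <= l c t.
Hypothesis l_sum : forall c, \sum_(t < N) l c t = 1.

Lemma prod_mass_ge0 z : 0 <= prod_mass z.
Proof. by apply: prodr_ge0. Qed.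

Lemma sum_prod_mass : \sum_z prod_mass z = 1.
Proof.
rewrite -(bigA_distr_bigA (fun c (t : 'I_N) => l c t)) /=.
by rewrite big1 // => c _; rewrite l_sum.
Qed.

Variables (H d theta : nat) (g B : R) (k : I -> nat -> nat -> nat -> R).
Hypothesis g_ge1 : 1 <= g.
Hypothesis k_spec : forall c, interpolating_kernel N H d.*2 g B (l c) (k c).

(** For [z] in the support, integrating [P] against the product kernel at [z] gives a polynomial in
    [h] of degree at most [2d] whose value at [h = H] is [P z]. It is extrapolated from
    [h = 0, ..., 2d], where the tilted kernel, averaged over [z], is dominated coordinate by
    coordinate by the product measure. *)
Lemma tilted_norm_le P : polyfun d P ->
  \sum_z prod_mass z * g ^+ weight z * `|P (fun c => (z c)%:R)| <=
  (2 * H%:R + 1) ^+ d.*2 * d.*2.+1%:R * B ^+ #|I| *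
  \sum_z prod_mass z * `|P (fun c => (z c)%:R)|.
Proof.
move=> [s [sd sP]].
pose ev (z : {ffun I -> 'I_N}) := P (fun c => (z c)%:R).
pose G h (z : {ffun I -> 'I_N}) := \sum_(w : {ffun I -> 'I_N}) (\prod_c k c h (z c) (w c)) * ev w.
have g0 : 0 <= g by apply: le_trans g_ge1.
have GH z : prod_mass z != 0 -> ev z = G H z.
  move=> /prodf_neq0 lz; rewrite /G (bigD1 z) //= big1 => [|c _]; last first.
    by have [_ -> //] := k_spec c; rewrite ?eqxx // lz.
  rewrite mul1r big1 ?addr0 // => w; rewrite eq_sym => /eqP zw.
  have [c zwc] : exists c, z c != w c.
    by apply/existsP; apply: contra_notT zw => /existsPn zw; apply/ffunP => c; apply/eqP; rewrite -[_ == _]negbK zw.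
  rewrite (bigD1 c) //=; have [_ -> //] := k_spec c; last exact: lz.
  by rewrite val_eqE (negbTE zwc) !mul0r.
have Gpoly z : prod_mass z != 0 -> exists2 q : {poly R}, (size q <= d.*2.+1)%N &
    forall h, q.[h%:R] = G h z.
  move=> /prodf_neq0 lz.
  have {}lz c : l c (z c) != 0 by exact: lz.
  have qc c e : exists2 q : {poly R}, (size q <= e.*2.+1)%N &
      forall h, q.[h%:R] = \sum_(w < N) k c h (z c) w * w%:R ^+ e.
    by have [+ _ _] := k_spec c; apply.
  have mono (e : {ffun I -> nat}) : (\sum_c e c <= d)%N ->
      exists2 q : {poly R}, (size q <= d.*2.+1)%N & forall h, q.[h%:R] =
        \sum_(w : {ffun I -> 'I_N}) (\prod_c k c h (z c) (w c)) * \prod_c (w c)%:R ^+ e c.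
    move=> ed.
    have [q Hq] : exists q : I -> {poly R}, forall c, (size (q c) <= (e c).*2.+1)%N /\
        forall h, (q c).[h%:R] = \sum_(w < N) k c h (z c) w * w%:R ^+ e c.
      apply: (@fin_all_exists _ _ (fun c (q : {poly R}) => (size q <= (e c).*2.+1)%N /\
        forall h, q.[h%:R] = \sum_(w < N) k c h (z c) w * w%:R ^+ e c)) => c.
      by have [q q1 q2] := qc c (e c); exists q.
    exists (\prod_c q c) => [|h].
      apply: leq_trans (size_prod_le _ (d := fun c => (e c).*2) _) _.
        by move=> c; case: (Hq c).
      under eq_bigr do rewrite -mul2n.
      by rewrite ltnS -big_distrr /= mul2n leq_double.
    rewrite horner_prod.
    under [RHS]eq_bigr do rewrite -big_split /=.
    rewrite -(bigA_distr_bigA (fun c (w : 'I_N) => k c h (z c) w * w%:R ^+ e c)) /=.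
    by apply: eq_bigr => c _; case: (Hq c).
  have GE h : G h z = \sum_(ce <- s) ce.1 * \sum_(w : {ffun I -> 'I_N})
      (\prod_c k c h (z c) (w c)) * \prod_c (w c)%:R ^+ ce.2 c.
    rewrite /G; under eq_bigr do rewrite /ev sP mulr_sumr.
    rewrite exchange_big /=; apply: eq_bigr => ce _.
    by rewrite mulr_sumr; apply: eq_bigr => w _; rewrite mulrCA.
  have : exists2 q : {poly R}, (size q <= d.*2.+1)%N & forall h, q.[h%:R] =
      \sum_(ce <- s) ce.1 * \sum_(w : {ffun I -> 'I_N})
      (\prod_c k c h (z c) (w c)) * \prod_c (w c)%:R ^+ ce.2 c.
    elim: (s) sd => [_|ce s' IHs sd'].
      by exists 0 => [|h]; rewrite ?size_poly0 // big_nil horner0.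
    have [q1 sq1 q1E] := mono ce.2 (sd' _ (mem_head _ _)).
    have [|q2 sq2 q2E] := IHs; first by move=> ce' ce's; apply: sd'; rewrite inE ce's orbT.
    exists (ce.1 *: q1 + q2) => [|h].
      apply: leq_trans (size_polyD _ _) _; rewrite geq_max sq2 andbT.
      exact: leq_trans (size_scale_leq _ _) sq1.
    by rewrite hornerD hornerZ q1E q2E big_cons.
  by move=> [q sq qE]; exists q => // h; rewrite qE GE.
have Gsum h : (h <= d.*2)%N -> \sum_z prod_mass z * g ^+ weight z * `|G h z| <=
    B ^+ #|I| * \sum_z prod_mass z * `|ev z|.
  move=> hd.
  apply: le_trans (_ : \sum_(z : {ffun I -> 'I_N}) \sum_(w : {ffun I -> 'I_N})
      (\prod_c (l c (z c) * g ^+ z c * `|k c h (z c) (w c)|)) * `|ev w| <= _).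
    apply: ler_sum => z _.
    apply: le_trans (ler_wpM2l _ (ler_norm_sum _ _ _)) _.
      by rewrite mulr_ge0 ?prod_mass_ge0 ?exprn_ge0.
    rewrite mulr_sumr; apply: ler_sum => w _.
    by rewrite normrM normr_prod mulrA !big_split /= /weight expr_sum.
  rewrite exchange_big /= mulr_sumr; apply: ler_sum => w _.
  rewrite -mulr_suml mulrA; apply: ler_wpM2r => //.
  rewrite -(bigA_distr_bigA (fun c (t : 'I_N) => l c t * g ^+ t * `|k c h t (w c)|)) /=.
  apply: le_trans (_ : \prod_c (B * l c (w c)) <= _).
    apply: ler_prod => c _; apply/andP; split.
      by apply: sumr_ge0 => t _; rewrite !mulr_ge0 ?exprn_ge0.
    by have [_ _] := k_spec c; apply.
  by rewrite big_split /= prodr_const.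
apply: le_trans (_ : \sum_z prod_mass z * g ^+ weight z *
    ((2 * H%:R + 1) ^+ d.*2 * \sum_(h < d.*2.+1) `|G h z|) <= _).
  apply: ler_sum => z _; have [->|lz] := eqVneq (prod_mass z) 0; first by rewrite !mul0r.
  rewrite ler_wpM2l ?mulr_ge0 ?prod_mass_ge0 ?exprn_ge0 // -/(ev z) GH //.
  have [q sq qE] := Gpoly z lz.
  have := horner_extrapolation H sq; rewrite qE.
  by under eq_bigr do rewrite qE.
under eq_bigr do rewrite mulrCA mulr_sumr.
rewrite -mulr_sumr exchange_big /= -!mulrA; apply: ler_wpM2l.
  by rewrite exprn_ge0 // addr_ge0 ?mulr_ge0.
rewrite mulr_natl -[X in _ *+ X]card_ord -sumr_const; apply: ler_sum => h _.
by apply: Gsum; rewrite -ltnS.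
Qed.

Hypothesis theta_large :
  2 * ((2 * H%:R + 1) ^+ d.*2 * d.*2.+1%:R * B ^+ #|I|) <= g ^+ theta.

Lemma expect_ge P a : polyfun d P ->
  (forall z, prod_mass z != 0 -> (weight z <= theta)%N -> a <= P (fun c => (z c)%:R)) ->
  a <= expect P.
Proof.
move=> dP Pa.
(* After the shift [Q] is nonnegative at the light vectors, so [near] is at once the integral and
   the [L1] norm of [Q] there. *)
pose Q (y : I -> R) := P y - a.
have dQ : polyfun d Q by apply: polyfunD => //; exact: polyfun_cst.
have g0 : 0 <= g by apply: le_trans g_ge1.
have gt0 n : 0 < g ^+ n by rewrite exprn_gt0 // (lt_le_trans ltr01).
have Qabs := tilted_norm_le dQ.
set S := \sum_z _ in Qabs; set T := \sum_z _ in Qabs.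
pose far := \sum_(z | (theta < weight z)%N) prod_mass z * `|Q (fun c => (z c)%:R)|.
pose near := \sum_(z | ~~ (theta < weight z)%N) prod_mass z * `|Q (fun c => (z c)%:R)|.
have TE : T = far + near by rewrite /T (bigID (fun z => theta < weight z)%N).
have T0 : 0 <= T by apply: sumr_ge0 => z _; rewrite mulr_ge0 ?prod_mass_ge0.
(* Markov's inequality for the tilt: a heavy vector has tilt at least [g ^+ theta]. *)
have farS : g ^+ theta * far <= S.
  rewrite /far mulr_sumr /S [leRHS](bigID (fun z => theta < weight z)%N) /=.
  rewrite -[leLHS]addr0; apply: lerD; last first.
    by apply: sumr_ge0 => z _; rewrite !mulr_ge0 ?prod_mass_ge0 ?exprn_ge0.
  apply: ler_sum => z zt; rewrite mulrCA mulrA ler_wpM2r //.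
  by rewrite ler_wpM2l ?prod_mass_ge0 // ler_weXn2l // ltnW.
have far_le : 2 * far <= T.
  rewrite -(ler_pM2l (gt0 theta)) mulrCA.
  apply: le_trans (_ : 2 * S <= _); first by rewrite ler_pM2l.
  apply: le_trans (_ : 2 * ((2 * H%:R + 1) ^+ d.*2 * d.*2.+1%:R * B ^+ #|I| * T) <= _).
    by rewrite ler_pM2l.
  by rewrite mulrA; apply: ler_wpM2r.
have QE : expect P - a = \sum_z prod_mass z * Q (fun c => (z c)%:R).
  rewrite /expect -{1}[a]mul1r -sum_prod_mass mulr_suml -sumrB.
  by apply: eq_bigr => z _; rewrite -mulrBr.
rewrite -subr_ge0 QE (bigID (fun z => theta < weight z)%N) /=.
have farQ : - far <= \sum_(z | (theta < weight z)%N) prod_mass z * Q (fun c => (z c)%:R).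
  rewrite -sumrN; apply: ler_sum => z _.
  by rewrite -mulrN ler_wpM2l ?prod_mass_ge0 // lerNnormlW.
have -> : \sum_(z | ~~ (theta < weight z)%N) prod_mass z * Q (fun c => (z c)%:R) = near.
  apply: eq_bigr => z; rewrite -leqNgt => zt.
  have [->|lz] := eqVneq (prod_mass z) 0; first by rewrite !mul0r.
  by rewrite ger0_norm // subr_ge0 Pa.
clearbody far near T S; move: farQ; move: (\sum_(z | _) _) => X farQ; lra.
Qed.

End ProductMeasure.

Lemma expectN (R : realFieldType) (I : finType) (N : nat) (l : I -> nat -> R) P :
  expect N l (fun y => - P y) = - expect N l P.
Proof. by rewrite /expect -sumrN; apply: eq_bigr => z _; rewrite mulrN. Qed.

Lemma light_mass_ge0 (R : realFieldType) (m : nat) (l : nat -> R) t :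
  light_mass m l -> 0 <= l t.
Proof.
move=> [l0 lt _ _]; case: t => [|t]; first by rewrite l0.
by apply: le_trans (lt t.+1 _); rewrite ?mulr_ge0 ?invr_ge0 ?exprn_ge0 ?mulr_ge0.
Qed.

(** A counter fixed at 0 needs no interpolation: the kernel is the point mass for every [h]. *)
Lemma zero_mass_kernel (R : realFieldType) (N H d : nat) (g B : R) (l : nat -> R) :
  (0 < N)%N -> 1 <= B -> (forall t, l t = (t == 0%N)%:R) ->
  interpolating_kernel N H d g B l (fun _ t w => (t == w)%:R).
Proof.
move=> N0 B1 lE; split.
- move=> t e tN _; exists (t%:R ^+ e)%:P; first by rewrite (leq_trans (size_polyC_leq1 _)).
  move=> h; rewrite hornerC -(@sum_ord_delta _ N t (fun w => w%:R ^+ e)) //.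
  by apply: eq_bigr => w _; rewrite eq_sym.
- by [].
- move=> h w _ wN; rewrite (bigD1 (Ordinal N0)) //= big1 ?addr0 => [|t].
    rewrite !lE mul1r expr0 mul1r normr_nat [w == _]eq_sym.
    by case: eqP; rewrite ?mulr0 ?mulr1.
  by rewrite -val_eqE /= lE => /negbTE ->; rewrite !mul0r.
Qed.

(** With [y = h / H], the kernel is a fresh sample of [l] with probability [1 - y]; otherwise it
    keeps one unit of [t] and thins the other [t - 1] at rate [y]. Keeping one unit avoids 0, where
    [l] has no mass. At [y = 1] nothing is lost and [t] is returned; for [h <= d] the thinned part
    is dominated by the geometric lower bound of [l]. *)
Lemma light_mass_kernel (R : realFieldType) (m H d : nat) (l : nat -> R) :
  (0 < m)%N -> (0 < H)%N -> (d * (100 * 100 * m ^ 3) <= H)%N -> light_mass m l ->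
  exists k, interpolating_kernel (node m).+1 H d (1 + (200 * m%:R)^-1)
              ((1 + m%:R^-1) ^+ 2) l k.
Proof.
move=> m0 H0 dH lm; have l0 t := light_mass_ge0 t lm; have [lz l_ge l_sum l_tilt] := lm.
pose y h : R := h%:R / H%:R.
have HR : 0 < H%:R :> R by rewrite ltr0n.
have mR : 0 < m%:R :> R by rewrite ltr0n.
exists (fun h t w => (1 - y h) * l w +
  y h * (if w is w'.+1 then binomial_pmf t.-1 (y h) w' else 0)).
split.
- move=> t e tN lt0.
  have t0 : (0 < t)%N by rewrite lt0n; apply: contraNneq lt0 => ->; rewrite lz.
  pose M := \sum_(w < (node m).+1) l w * w%:R ^+ e.
  have [q sq qE] := thinning_poly t.-1 (('X + 1%:P) ^+ e : {poly R}).
  have {}sq : (size q <= e.+1)%N.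
    apply: leq_trans sq _; apply: leq_trans (size_poly_exp_leq _ _) _.
    by rewrite polyC1 size_XaddC mul1n.
  have sumE x : \sum_(w < (node m).+1) (if nat_of_ord w is w'.+1 then
      binomial_pmf t.-1 x w' else 0) * w%:R ^+ e = q.[x].
    rewrite big_ord_recl /= mul0r add0r (qE x (node m)); last by rewrite prednK // -ltnS.
    by apply: eq_bigr => w _; rewrite /bump /= horner_exp !hornerE natr1.
  have kE x : \sum_(w < (node m).+1) ((1 - x) * l w + x * (if nat_of_ord w is w'.+1 then
      binomial_pmf t.-1 x w' else 0)) * w%:R ^+ e = (1 - x) * M + x * q.[x].
    under eq_bigr do rewrite mulrDl -!mulrA.
    by rewrite big_split /= -!mulr_sumr sumE.
  (* The degree in [h] is at most [e + 1], which is within [2e] except for [e = 0]. In that case the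
     total mass is 1 for every [h], so cells absent from a monomial add nothing to the degree. *)
  case: e => [|e] in M q sq qE sumE kE *.
    exists 1; first by rewrite size_poly1.
    move=> h; rewrite kE hornerC.
    have -> : M = 1 by rewrite /M; under eq_bigr do rewrite expr0 mulr1.
    have q1 : q.[1] = 1.
      rewrite (qE 1 (node m)); last by rewrite prednK // -ltnS.
      under eq_bigr do rewrite expr0 hornerC mulr1 binomial_pmf1.
      rewrite -[RHS](@sum_ord_delta _ (node m) t.-1 (fun=> 1)); last by rewrite prednK // -ltnS.
      by apply: eq_bigr => w _; rewrite mulr1.
    by move: q1; rewrite (size1_polyC sq) !hornerC => ->; ring.
  exists (M%:P + (H%:R^-1 *: 'X) * (q \Po (H%:R^-1 *: 'X) - M%:P)) => [|h]; last first.
    rewrite kE hornerD hornerM hornerD hornerN horner_comp !hornerE /y.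
    by rewrite ![_^-1 * h%:R]mulrC; ring.
  have sH : size (H%:R^-1 *: 'X : {poly R}) = 2.
    by rewrite size_scale ?size_polyX // invr_eq0 gt_eqF.
  apply: leq_trans (size_polyD _ _) _; rewrite geq_max; apply/andP; split.
    by apply: leq_trans (size_polyC_leq1 _) _.
  apply: leq_trans (size_polyMleq _ _) _; rewrite sH.
  set k := size _; suff : (k <= e.+2)%N by clearbody k; lia.
  rewrite /k {k}.
  apply: leq_trans (size_polyD _ _) _; rewrite geq_max size_polyN.
  rewrite size_comp_poly2 // sq /=; by apply: leq_trans (size_polyC_leq1 _) _.
- move=> t w tN wN lt0.
  have t0 : (0 < t)%N by rewrite lt0n; apply: contraNneq lt0 => ->; rewrite lz.
  have -> : y H = 1 by rewrite /y divff // gt_eqF.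
  rewrite subrr mul0r add0r mul1r.
  case: w wN => [_|w _]; first by rewrite (gtn_eqF t0).
  by rewrite binomial_pmf1 -{2}(prednK t0) eqSS eq_sym.
move=> h w hd wN.
have y0 : 0 <= y h by rewrite divr_ge0.
have yle : y h * (100 * 100 * m%:R ^+ 3) <= 1.
  rewrite /y mulrAC ler_pdivrMr // mul1r -natrX -!natrM ler_nat.
  by apply: leq_trans dH; rewrite leq_mul2r hd orbT.
have m1 : 1 <= m%:R :> R by rewrite ler1n.
have m3 : m%:R <= m%:R ^+ 3 :> R by rewrite ler_eXnr.
have yH : y h <= (100 * 100 * m%:R ^+ 3)^-1.
  by rewrite -[leRHS]mul1r ler_pdivlMr // !mulr_gt0 ?exprn_gt0.
have y4 : y h <= m%:R^-1 / 4.
  apply: le_trans yH _; rewrite -invfM lef_pV2 ?posrE ?mulr_gt0 ?exprn_gt0 //; lra.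
have y1 : y h <= 1.
  by apply: le_trans y4 _; rewrite -invfM invf_le1 ?mulr_gt0 //; lra.
have ny : (node m)%:R * y h <= (100 * m%:R)^-1.
  apply: le_trans (ler_wpM2l _ yH) _ => //.
  rewrite /node natrM natrX le_eqVlt; apply/orP; left; apply/eqP.
  by field; rewrite gt_eqF.
have y01 : 0 <= y h <= 1 by rewrite y0.
set g := 1 + _^-1.
have g0 : 0 <= g by rewrite addr_ge0 ?invr_ge0 ?mulr_ge0.
case: w wN => [|w] wN.
  rewrite lz big1 ?mulr0 // => t _.
  by rewrite ?mulr0 addr0 normr0 mulr0.
set E := \sum_(t < _) _ in l_tilt.
have E0 : 0 <= E by apply: sumr_ge0 => t _; rewrite mulr_ge0 ?exprn_ge0.
have lw := l_ge w.+1 (ltn0Sn w); rewrite /= -exprVn in lw.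
(* One factor [1 + 1/m] pays for the thinned part of the kernel and the other for the tilt. *)
apply: le_trans (_ : \sum_(t < (node m).+1) l t * g ^+ t *
    (l w.+1 * (1 + m%:R^-1)) <= _); last first.
  rewrite -mulr_suml -/E expr2 -[leRHS]mulrA [_ * l w.+1]mulrC.
  by apply: ler_wpM2r; rewrite ?mulr_ge0 ?addr_ge0 ?invr_ge0.
apply: ler_sum => t _; rewrite ler_wpM2l ?mulr_ge0 ?exprn_ge0 //.
have pm0 := binomial_pmf_ge0 t.-1 w y01.
rewrite ger0_norm; last by apply: addr_ge0; apply: mulr_ge0 => //; rewrite subr_ge0.
have pm : binomial_pmf t.-1 (y h) w <= (100 * m%:R)^-1 ^+ w.
  apply: le_trans (binomial_pmf_le _ _ y01) _.
  rewrite lerXn2r ?nnegrE ?mulr_ge0 ?invr_ge0 ?mulr_ge0 //.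
  apply: le_trans ny; rewrite ler_wpM2r // ler_nat.
  by apply: leq_trans (leq_pred _) _; rewrite -ltnS.
have pm' : y h * binomial_pmf t.-1 (y h) w <= m%:R^-1 / 4 * (100 * m%:R)^-1 ^+ w.
  by apply: ler_pM.
have mi : 0 < m%:R^-1 :> R by rewrite invr_gt0.
have : (1 - y h) * l w.+1 <= l w.+1 by rewrite ler_piMl // gerBl.
have : m%:R^-1 / 4 * (100 * m%:R)^-1 ^+ w <= m%:R^-1 * l w.+1.
  by rewrite -mulrA ler_pM2l.
by rewrite mulrDr mulr1 [l w.+1 * _]mulrC; lra.
Qed.

Lemma light_expect_ge (R : realFieldType) (I : finType) (m d H theta : nat)
    (l : I -> nat -> R) (P : (I -> R) -> R) (a : R) :
  (0 < m)%N -> (0 < H)%N -> (d.*2 * (100 * 100 * m ^ 3) <= H)%N ->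
  (forall c, light_mass m (l c) \/ forall t, l c t = (t == 0%N)%:R) ->
  2 * ((2 * H%:R + 1) ^+ d.*2 * d.*2.+1%:R * (1 + m%:R^-1) ^+ 2 ^+ #|I|)
    <= (1 + (200 * m%:R)^-1) ^+ theta :> R ->
  polyfun d P ->
  (forall z, prod_mass l z != 0 -> (weight z <= theta)%N ->
     a <= P (fun c => (z c : 'I_(node m).+1)%:R)) ->
  a <= expect (node m).+1 l P.
Proof.
move=> m0 H0 dH lc th dP Pa.
have lc_ge0 c t : 0 <= l c t.
  by case: (lc c) => [/light_mass_ge0 //|->]; rewrite ler0n.
have lc_sum c : \sum_(t < (node m).+1) l c t = 1.
  case: (lc c) => [[] //|lE].
  by rewrite big_ord_recl big1 ?addr0 ?lE // => t _; rewrite lE.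
have [k k_spec] : exists k : I -> nat -> nat -> nat -> R, forall c,
    interpolating_kernel (node m).+1 H d.*2 (1 + (200 * m%:R)^-1)
      ((1 + m%:R^-1) ^+ 2) (l c) (k c).
  apply: (@fin_all_exists _ _ (fun c k => interpolating_kernel (node m).+1 H d.*2
    (1 + (200 * m%:R)^-1) ((1 + m%:R^-1) ^+ 2) (l c) k)) => c.
  case: (lc c) => [lm|lE]; first exact: light_mass_kernel.
  exists (fun _ t w => (t == w)%:R); apply: zero_mass_kernel lE => //.
  by rewrite exprn_ege1 // lerDl invr_ge0.
apply: (expect_ge lc_ge0 lc_sum _ k_spec th dP Pa).
by rewrite lerDl invr_ge0 mulr_ge0.
Qed.

(** * Reducing the degree by a factor of m *)

Section BlockMeasure.
Variables (R : realFieldType) (n m : nat) (l1 l2 : nat -> R).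
Hypothesis m_gt0 : (0 < m)%N.
Hypothesis moments : forall e, (e < m)%N ->
  \sum_(t < (node m).+1) l1 t * t%:R ^+ e =
  2^-1 * ((e == 0%N)%:R + \sum_(t < (node m).+1) l2 t * t%:R ^+ e).
Hypothesis l2_sum : \sum_(t < (node m).+1) l2 t = 1.

Definition cell_mass (b u : bool) (t : nat) : R :=
  if b then l1 t else if u then l2 t else (t == 0%N)%:R.

(* For [b = false] the weight is twice the uniform one on the vectors with an
   odd number of false entries. *)
Definition block_weight (b : bool) (u : {ffun 'I_m -> bool}) : R :=
  2^-1 ^+ m * (if b then 1 else 1 - \prod_a (-1) ^+ (~~ u a)).

Lemma block_weight_neq0 u : block_weight false u != 0 -> exists a, ~~ u a.
Proof.
move=> w0; apply/existsP; apply: contraNT w0 => /existsPn uT.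
by rewrite /block_weight big1 ?subrr ?mulr0 // => a _; rewrite (negbTE (uT a)).
Qed.

Lemma block_weight_ge0 b u : 0 <= block_weight b u.
Proof.
rewrite mulr_ge0 ?exprn_ge0 ?invr_ge0 //; case: b => //.
rewrite subr_ge0; apply: le_trans (ler_norm _) _.
rewrite normr_prod big1 // => a _.
by rewrite normrX normrN1 expr1n.
Qed.

Definition cell_moment (b u : bool) (e : nat) : R :=
  \sum_(t < (node m).+1) cell_mass b u t * t%:R ^+ e.

Definition block_moment (b : bool) (e : 'I_m -> nat) : R :=
  \sum_u block_weight b u * \prod_a cell_moment b (u a) (e a).

Lemma cell_moment_zero e : cell_moment false false e = (e == 0%N)%:R.
Proof.
rewrite /cell_moment big_ord_recl big1 ?addr0 ?mul1r /= ?expr0n // => t _.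
by rewrite /cell_mass /= mul0r.
Qed.

Lemma sum_bool_ffun (F : bool -> 'I_m -> R) :
  \sum_(u : {ffun 'I_m -> bool}) \prod_a F (u a) a = \prod_a (F true a + F false a).
Proof.
rewrite -(bigA_distr_bigA (fun a b => F b a)) /=.
by apply: eq_bigr => a _; rewrite big_bool.
Qed.

Lemma block_moment_true e : block_moment true e = \prod_a cell_moment true true (e a).
Proof.
rewrite /block_moment /block_weight mulr1.
have -> : \sum_(u : {ffun 'I_m -> bool}) 2^-1 ^+ m * \prod_a cell_moment true (u a) (e a) =
    \sum_(u : {ffun 'I_m -> bool}) \prod_a (2^-1 * cell_moment true true (e a)).
  apply: eq_bigr => u _; rewrite big_split /= prodr_const card_ord; congr (_ * _).
rewrite (sum_bool_ffun (fun _ a => 2^-1 * cell_moment true true (e a))).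
by apply: eq_bigr => a _; field.
Qed.

Lemma block_moment_false e : block_moment false e =
  \prod_a (2^-1 * (cell_moment false true (e a) + (e a == 0%N)%:R)) -
  \prod_a (2^-1 * (cell_moment false true (e a) - (e a == 0%N)%:R)).
Proof.
rewrite /block_moment /block_weight.
have -> : \sum_(u : {ffun 'I_m -> bool}) 2^-1 ^+ m * (1 - \prod_a (-1) ^+ (~~ u a)) *
      \prod_a cell_moment false (u a) (e a) =
    \sum_(u : {ffun 'I_m -> bool}) \prod_a (2^-1 * cell_moment false (u a) (e a)) -
    \sum_(u : {ffun 'I_m -> bool}) \prod_a (2^-1 * ((-1) ^+ (~~ u a) * cell_moment false (u a) (e a))).
  rewrite -sumrB; apply: eq_bigr => u _.
  by rewrite !big_split /= prodr_const card_ord; ring.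
rewrite (sum_bool_ffun (fun b a => 2^-1 * cell_moment false b (e a))).
rewrite (sum_bool_ffun (fun b a => 2^-1 * ((-1) ^+ (~~ b) * cell_moment false b (e a)))).
congr (_ - _); apply: eq_bigr => a _; rewrite cell_moment_zero /=; ring.
Qed.

(** To degree below [m], [l1] looks like a fair mixture of [l2] and the point mass at 0, so a true
    block looks like [m] independent fair choices. Conditioning the choices on an odd number of
    zeros is invisible to fewer than [m] cells: some exponent is 0, and its factor [1 - 1] kills the
    second product. *)
Lemma block_moment_match e : (\sum_a e a < m)%N -> block_moment true e = block_moment false e.
Proof.
move=> em; rewrite block_moment_true block_moment_false.
have ea a : (e a < m)%N by apply: leq_ltn_trans em; rewrite (bigD1 a) //= leq_addr.
have [a0 a0E] : exists a, e a = 0%N.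
  apply/exists_eqP; apply: contraTT em => /existsPn H.
  rewrite -leqNgt -{1}[m]card_ord -sum1_card; apply: leq_sum => a _.
  by rewrite lt0n; have := H a; rewrite /=.
rewrite [X in _ - X](bigD1 a0) //= a0E eqxx.
have -> : cell_moment false true 0 = 1.
  by rewrite /cell_moment /cell_mass -[RHS]l2_sum; apply: eq_bigr => t _; rewrite expr0 mulr1.
rewrite subrr mulr0 mul0r subr0; apply: eq_bigr => a _.
by rewrite [LHS]moments // addrC.
Qed.

Lemma block_weight_sum b : \sum_u block_weight b u = 1.
Proof.
have T1 : \sum_u block_weight true u = 1.
  rewrite /block_weight sumr_const card_ffun card_bool card_ord mulr1.
  by rewrite -[_ *+ _]mulr_natr natrX -exprMn mulVf ?pnatr_eq0 // expr1n.
case: b => //; rewrite /block_weight.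
under eq_bigr do rewrite mulrBr mulr1; rewrite sumrB.
rewrite -[X in X - _](_ : \sum_u block_weight true u = _); last first.
  by apply: eq_bigr => u _; rewrite /block_weight mulr1.
rewrite T1 -mulr_sumr.
rewrite (sum_bool_ffun (fun b _ => (-1) ^+ (~~ b))) /=.
case: (m) m_gt0 => [//|m' _]; rewrite big_ord_recl /= expr1 expr0 subrr mul0r mulr0 subr0 //.
Qed.

Local Notation cell := ('I_n * 'I_m)%type.
Local Notation choices := {ffun 'I_n -> {ffun 'I_m -> bool}}.

Definition measure_of (b : 'I_n -> bool) (U : choices) (c : cell) : nat -> R :=
  cell_mass (b c.1) (U c.1 c.2).

Definition choice_weight (b : 'I_n -> bool) (U : choices) : R :=
  \prod_i block_weight (b i) (U i).

(** The law of a false block is a mixture of product laws, whereas the tail estimate is for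
    products. The choice [U] is therefore averaged outside [expect], with nonnegative weights. *)
Definition mixed_expect (b : 'I_n -> bool) (P : (cell -> R) -> R) : R :=
  \sum_(U : choices) choice_weight b U * expect (node m).+1 (measure_of b U) P.

Lemma choice_weight_ge0 b U : 0 <= choice_weight b U.
Proof. by apply: prodr_ge0 => i _; exact: block_weight_ge0. Qed.

Lemma choice_weight_sum b : \sum_U choice_weight b U = 1.
Proof.
rewrite /choice_weight -(bigA_distr_bigA (fun i u => block_weight (b i) u)) /=.
by rewrite big1 // => i _; rewrite block_weight_sum.
Qed.

Lemma mixed_expect_monomial b (e : cell -> nat) :
  mixed_expect b (fun z => \prod_c z c ^+ e c) =
  \prod_i block_moment (b i) (fun a => e (i, a)).
Proof.
rewrite /mixed_expect /block_moment.
rewrite (bigA_distr_bigA (fun i u => block_weight (b i) u *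
   \prod_a cell_moment (b i) (u a) (e (i, a)))) /=.
apply: eq_bigr => U _; rewrite big_split /=; congr (_ * _).
rewrite (pair_bigA _ (fun i a => cell_moment (b i) (U i a) (e (i, a)))) /=.
transitivity (\sum_(z : {ffun cell -> 'I_(node m).+1})
    \prod_c (measure_of b U c (z c) * (z c)%:R ^+ e c)).
  by apply: eq_bigr => z _; rewrite big_split.
rewrite -(bigA_distr_bigA (fun c (t : 'I_(node m).+1) => measure_of b U c t * t%:R ^+ e c)) /=.
by apply: eq_bigr => -[i a] _.
Qed.

(** The mean of a monomial factors over blocks. A block of degree below [m] gives a constant, any
    other block an affine function of its bit, and at most [D / m] blocks are of the latter kind. *)
Lemma mixed_expect_polyfun (sigma : bool) D (P : (cell -> R) -> R) : polyfun D P ->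
  exists2 Q : ('I_n -> R) -> R, polyfun (D %/ m) Q &
    forall x : 'I_n -> bool, Q (fun i => (x i)%:R) = mixed_expect (fun i => x i (+) sigma) P.
Proof.
move=> [s [sD sP]].
pose V b (e : cell -> nat) i := block_moment b (fun a => e (i, a)).
pose Qm (e : cell -> nat) (y : 'I_n -> R) :=
  \prod_i (V sigma e i + (V (~~ sigma) e i - V sigma e i) * y i).
exists (fun y => \sum_(ce <- s | ce \in s) ce.1 * Qm ce.2 y).
  apply: polyfun_sum => ce /sD ceD; apply: polyfunZ.
  pose del i : nat := (m <= \sum_a ce.2 (i, a))%N.
  apply: (@polyfunW _ _ (\sum_i del i)%N).
    rewrite leq_divRL //; apply: leq_trans ceD.
    have -> : (\sum_c ce.2 c = \sum_i \sum_a ce.2 (i, a))%N.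
      by rewrite pair_bigA; apply: eq_bigr => -[].
    rewrite big_distrl /=.
    apply: leq_sum => i _; rewrite /del; by case: (leqP m) => [em|_]; rewrite ?mul1n ?mul0n.
  have H i : polyfun (del i) (fun y : 'I_n -> R =>
      V sigma ce.2 i + (V (~~ sigma) ce.2 i - V sigma ce.2 i) * y i).
    rewrite /del; case: leqP => em.
      apply: polyfunD; first exact: polyfun_cst.
      by apply: polyfunZ; exact: polyfun_var.
    apply: (@eq_polyfun _ _ _ (fun=> V sigma ce.2 i)); last exact: polyfun_cst.
    move=> y; have E := block_moment_match em.
    by rewrite /V; case: (sigma); rewrite /= E subrr mul0r addr0.
  exact: (polyfun_prod (index_enum 'I_n) H).
move=> x.
have -> : mixed_expect (fun i => x i (+) sigma) P =
    \sum_(ce <- s) ce.1 * mixed_expect (fun i => x i (+) sigma) (fun z => \prod_c z c ^+ ce.2 c).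
  rewrite /mixed_expect /expect; under eq_bigr do
    (under eq_bigr do rewrite sP mulr_sumr; rewrite exchange_big /= mulr_sumr).
  rewrite exchange_big /=; apply: eq_bigr => ce _.
  rewrite mulr_sumr; apply: eq_bigr => U _; rewrite [RHS]mulrCA.
  by congr (_ * _); rewrite mulr_sumr; apply: eq_bigr => z _; rewrite mulrCA.
rewrite [RHS]big_seq; apply: eq_bigr => ce _; congr (_ * _).
rewrite mixed_expect_monomial; apply: eq_bigr => i _.
by rewrite /V; case: (x i); case: (sigma) => /=; rewrite ?mulr1 ?mulr0; ring.
Qed.

End BlockMeasure.

(** * Reducing the degree by the distance of a code *)

Section Slots.
Variables (R : realFieldType) (theta : nat) (I : finType).
Local Notation code := (option I).
Local Notation placement := {ffun 'I_theta -> code}.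

(** Slots holding [None] are idle, so that every vector of weight up to [theta] can be placed. *)
Definition placements (z : I -> nat) : {set placement} :=
  [set v : placement | [forall c, #|[set j | v j == Some c]| == z c]].

Lemma sum_slots (phi : code -> R) z v : v \in placements z ->
  \sum_j phi (v j) = theta%:R * phi None + \sum_c (phi (Some c) - phi None) * (z c)%:R.
Proof.
rewrite inE => /forallP vz.
transitivity (\sum_(j < theta) (phi None + \sum_c (phi (Some c) - phi None) * (v j == Some c)%:R)).
  apply: eq_bigr => j _; case: (v j) => [c|].
    rewrite (bigD1 c) //= eqxx mulr1 big1 => [|c' c'c]; first by ring.
    by rewrite (inj_eq Some_inj) eq_sym (negbTE c'c) mulr0.
  by rewrite big1 ?addr0 // => c _; rewrite mulr0.
rewrite big_split /= sumr_const card_ord -[phi None *+ theta]mulr_natl; congr (_ + _).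
rewrite exchange_big /=; apply: eq_bigr => c _.
rewrite -mulr_sumr; congr (_ * _); rewrite -(eqP (vz c)) -sum1_card natr_sum.
rewrite big_mkcond [RHS]big_mkcond; apply: eq_bigr => j _.
by rewrite inE; case: eqP.
Qed.

Lemma placements_tperm z (s t : 'I_theta) (v : placement) :
  ([ffun j => v (tperm s t j)] \in placements z) = (v \in placements z).
Proof.
rewrite !inE; apply: eq_forallb => c; congr (_ == _).
rewrite -(card_imset _ (@perm_inj _ (tperm s t))); apply: eq_card => j.
rewrite -{1}(tpermK s t j) (mem_imset _ _ (@perm_inj _ _)) !inE ffunE.
by rewrite tpermK.
Qed.

Lemma sum_swap z (s t : 'I_theta) (F : placement -> R) :
  \sum_(v in placements z) F [ffun j => v (tperm s t j)] = \sum_(v in placements z) F v.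
Proof.
have inv : involutive (fun v : placement => [ffun j => v (tperm s t j)]).
  by move=> v; apply/ffunP => j; rewrite !ffunE tpermK.
rewrite [RHS](reindex_inj (inv_inj inv)) /=.
by apply: eq_bigl => v; rewrite placements_tperm.
Qed.

(** Induction on the number of slots involved. The sum of [phi j0] over all slots is affine in the
    counts. Multiplied by the product over [s], each slot outside [s] yields, by symmetry, the
    wanted average; each slot in [s] yields a product over [s] alone with two factors merged. *)
Lemma slot_product_polyfun (s : seq 'I_theta) (phi : 'I_theta -> code -> R) : uniq s ->
  exists2 Q : (I -> R) -> R, polyfun (size s) Q & forall z,
    \sum_(v in placements z) \prod_(j <- s) phi j (v j) =
    #|placements z|%:R * Q (fun c => (z c)%:R).
Proof.
elim: s phi => [|j0 s IHs] phi /=.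
  move=> _; exists (fun=> 1); first exact: polyfun_cst.
  by move=> z; rewrite mulr1 -sum1_card natr_sum; apply: eq_bigr => v _; rewrite big_nil.
move=> /andP [j0s us].
have st : (size s < theta)%N.
  have u : uniq (j0 :: s) by rewrite /= j0s.
  by have := max_card (mem (j0 :: s)); rewrite (card_uniqP u) card_ord.
have [Q dQ QE] := IHs phi us.
pose merge t j : code -> R := if j == t then (fun k => phi j0 k * phi j k) else phi j.
have [Qt HQt] : exists Qt : 'I_theta -> (I -> R) -> R, forall t,
    polyfun (size s) (Qt t) /\ forall z,
    \sum_(v in placements z) \prod_(j <- s) merge t j (v j) =
    #|placements z|%:R * Qt t (fun c => (z c)%:R).
  apply: (@fin_all_exists _ _ (fun t (Qt : (I -> R) -> R) => polyfun (size s) Qt /\ forall z,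
    \sum_(v in placements z) \prod_(j <- s) merge t j (v j) =
    #|placements z|%:R * Qt (fun c => (z c)%:R))) => t.
  by have [q q1 q2] := IHs (merge t) us; exists q.
pose lin (y : I -> R) := theta%:R * phi j0 None + \sum_c (phi j0 (Some c) - phi j0 None) * y c.
have dlin : polyfun 1 lin.
  apply: polyfunD; first exact: polyfun_cst.
  by apply: polyfun_sum => c _; apply: polyfunZ; exact: polyfun_var.
(* The number of slots outside [s], nonzero because [j0] is one of them. *)
pose k : R := (theta - size s)%:R.
have k0 : k != 0 by rewrite pnatr_eq0 subn_eq0 -ltnNge.
exists (fun y => k^-1 * (lin y * Q y + (-1) * \sum_(t <- s) Qt t y)).
  apply: polyfunZ; apply: polyfunD; first exact: (polyfunM dlin dQ).
  apply: polyfunZ; apply: polyfun_sum => t _.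
  by case: (HQt t) => dQt _; exact: polyfunW dQt.
move=> z; set y := (fun c => (z c)%:R).
have mergeE t v : t \in s ->
    \prod_(j <- s) merge t j (v j) = phi j0 (v t) * \prod_(j <- s) phi j (v j).
  move=> ts; transitivity (\prod_(j <- s) ((if j == t then phi j0 (v t) else 1) * phi j (v j))).
    by apply: eq_bigr => j _; rewrite /merge; case: eqP => [->|_]; rewrite ?mul1r.
  by rewrite big_split /= -big_mkcond -big_filter filter_pred1_uniq // big_seq1.
have fresh t : t \notin s ->
    \sum_(v in placements z) phi j0 (v t) * \prod_(j <- s) phi j (v j) =
    \sum_(v in placements z) \prod_(j <- j0 :: s) phi j (v j).
  move=> ts; rewrite -[RHS](sum_swap z j0 t); apply: eq_bigr => v _.
  rewrite big_cons ffunE tpermL; congr (_ * _).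
  rewrite big_seq [RHS]big_seq; apply: eq_bigr => j js; rewrite ffunE tpermD //.
    by apply: contraNneq j0s => ->.
  by apply: contraNneq ts => ->.
have key : lin y * (#|placements z|%:R * Q y) =
    k * (\sum_(v in placements z) \prod_(j <- j0 :: s) phi j (v j)) +
    #|placements z|%:R * \sum_(t <- s) Qt t y.
  rewrite -QE mulr_sumr.
  transitivity (\sum_(v in placements z) \sum_t phi j0 (v t) * \prod_(j <- s) phi j (v j)).
    by apply: eq_bigr => v vz; rewrite -mulr_suml (sum_slots (phi j0) vz).
  rewrite exchange_big /= (bigID (fun t => t \in s)) /= addrC; congr (_ + _).
    rewrite (eq_bigr _ (fun t ts => fresh t ts)) sumr_const mulr_natl; congr (_ *+ _).
    have := cardC (mem s); rewrite (card_uniqP us) card_ord => E.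
    by apply/eqP; rewrite -(eqn_add2l (size s)) subnKC ?(ltnW st) // -[X in _ == X]E.
  rewrite mulr_sumr big_uniq //=; apply: eq_bigr => t ts.
  have [_ <-] := HQt t; apply: eq_bigr => v _; rewrite mergeE //.
have -> : \sum_(v in placements z) \prod_(j <- j0 :: s) phi j (v j) =
    k^-1 * (lin y * (#|placements z|%:R * Q y) - #|placements z|%:R * \sum_(t <- s) Qt t y).
  by rewrite key addrK mulKf.
ring.
Qed.

Lemma placements_nonempty (z : I -> nat) : (\sum_c z c <= theta)%N ->
  exists v, v \in placements z.
Proof.
move=> zt.
pose s := flatten [seq nseq (z c) (Some c) | c <- enum I] ++ nseq (theta - \sum_c z c) None.
have ss : size s = theta.
  rewrite size_cat size_flatten size_nseq /shape -map_comp sumnE big_map.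
  have -> : (\sum_(c <- enum I) (size \o (fun c => nseq (z c) (Some c))) c = \sum_c z c)%N.
    by rewrite big_enum; apply: eq_bigr => c _; rewrite /= size_nseq.
  by rewrite subnKC.
exists [ffun j : 'I_theta => nth None s j]; rewrite inE; apply/forallP => c; apply/eqP.
have -> : #|[set j | [ffun j : 'I_theta => nth None s j] j == Some c]| = count_mem (Some c) s.
  rewrite -sum1_card -sum1_count (big_nth None) big_mkord ss.
  by apply: eq_bigl => j; rewrite inE ffunE.
rewrite count_cat count_nseq mul0n addn0 count_flatten -map_comp sumnE big_map big_enum.
rewrite (bigD1 c) //= count_nseq /= eqxx mul1n big1 ?addn0 // => c' c'c.
by rewrite /= count_nseq /= (inj_eq Some_inj) (negbTE c'c).
Qed.

Variables (len L : nat).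
Local Notation word := {ffun 'I_len -> bool}.
Variables (dec : word -> code) (nu : code -> word -> R).
Hypothesis L_gt0 : (0 < L)%N.
Hypothesis nu_ge0 : forall k y, 0 <= nu k y.
Hypothesis nu_sum : forall k, \sum_y nu k y = 1.
Hypothesis nu_dec : forall k y, nu k y != 0 -> dec y = k.
Hypothesis nu_moment : forall (B : {set 'I_len}) k k', (#|B| < L)%N ->
  \sum_y nu k y * \prod_(b in B) (y b)%:R = \sum_y nu k' y * \prod_(b in B) (y b)%:R.

Local Notation bit := ('I_theta * 'I_len)%type.
Local Notation words := {ffun 'I_theta -> word}.

Definition bits_of (y : words) (c : bit) : R := (y c.1 c.2)%:R.

Definition has_counts (z : I -> nat) (y : words) : Prop :=
  forall c, #|[set j | dec (y j) == Some c]| = z c.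

(** A slot of which a monomial reads fewer than [L] bits has the same average for every code, so
    after averaging at most [d / L] slots matter. The conclusion speaks of lower and upper bounds
    instead of membership in a set, because the tail estimate preserves only such bounds. *)
Lemma decode_polyfun d (p : (bit -> R) -> R) : polyfun d p ->
  exists2 P : (I -> R) -> R, polyfun (d %/ L) P & forall z, (\sum_c z c <= theta)%N ->
    forall a,
    ((forall y, has_counts z y -> a <= p (bits_of y)) -> a <= P (fun c => (z c)%:R)) /\
    ((forall y, has_counts z y -> p (bits_of y) <= a) -> P (fun c => (z c)%:R) <= a).
Proof.
move=> [s [sd sp]].
pose A (v : placement) := \sum_(y : words) (\prod_j nu (v j) (y j)) * p (bits_of y).
pose phi (e : bit -> nat) j k := \sum_(y : word) nu k y * \prod_b (y b)%:R ^+ e (j, b) : R.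
have phi_const e j k : (\sum_b e (j, b) < L)%N -> phi e j k = phi e j None.
  move=> eL; pose B := [set b | (0 < e (j, b))%N].
  have BL : (#|B| < L)%N.
    apply: leq_ltn_trans eL; rewrite -sum1_card big_mkcond /=; apply: leq_sum => b _.
    by rewrite inE; case: (e (j, b)).
  have E k' : phi e j k' = \sum_y nu k' y * \prod_(b in B) (y b)%:R.
    apply: eq_bigr => y _; congr (_ * _); rewrite [RHS]big_mkcond; apply: eq_bigr => b _.
    rewrite inE; case: (e (j, b)) => [|n] //=.
    by case: (y b); rewrite ?expr1n // expr0n.
  by rewrite !E; exact: nu_moment.
have AE v : A v = \sum_(ce <- s) ce.1 * \prod_j phi ce.2 j (v j).
  rewrite /A; under eq_bigr do rewrite sp mulr_sumr.
  rewrite exchange_big /=; apply: eq_bigr => ce _.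
  rewrite /phi (bigA_distr_bigA (fun j y => nu (v j) y * \prod_b (y b)%:R ^+ ce.2 (j, b))) /=.
  rewrite mulr_sumr; apply: eq_bigr => y _; rewrite mulrCA; congr (_ * _).
  rewrite big_split /=; congr (_ * _).
  by rewrite pair_bigA /=; apply: eq_bigr => -[].
have Pm (e : {ffun bit -> nat}) : (\sum_c e c <= d)%N ->
    exists2 Q : (I -> R) -> R, polyfun (d %/ L) Q & forall z,
      \sum_(v in placements z) \prod_j phi e j (v j) =
      #|placements z|%:R * Q (fun c => (z c)%:R).
  move=> ed; pose J := enum [pred j | (L <= \sum_b e (j, b))%N].
  have [Q dQ QE] := slot_product_polyfun (phi e) (enum_uniq _ : uniq J).
  exists (fun y => (\prod_(j | (\sum_b e (j, b) < L)%N) phi e j None) * Q y).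
    apply: polyfunZ; apply: polyfunW dQ.
    rewrite leq_divRL // -cardE -sum1_card big_distrl /=; apply: leq_trans ed.
    have -> : (\sum_c e c = \sum_j \sum_b e (j, b))%N.
      by rewrite pair_bigA; apply: eq_bigr => -[].
    rewrite big_mkcond /=; apply: leq_sum => j _; rewrite inE.
    by case: (leqP L) => [em|_]; rewrite ?mul1n.
  move=> z; rewrite [RHS]mulrCA -QE mulr_sumr; apply: eq_bigr => v _.
  rewrite (bigID (fun j => (\sum_b e (j, b) < L)%N)) /=; congr (_ * _).
    by apply: eq_bigr => j /phi_const.
  rewrite [RHS]big_enum_cond /=; apply: eq_bigl => j.
  by rewrite inE -leqNgt andbT.
have [P dP PE] : exists2 P : (I -> R) -> R, polyfun (d %/ L) P & forall z,
    \sum_(v in placements z) A v = #|placements z|%:R * P (fun c => (z c)%:R).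
  suff [P dP PE] : exists2 P : (I -> R) -> R, polyfun (d %/ L) P & forall z,
      \sum_(v in placements z) \sum_(ce <- s) ce.1 * \prod_j phi ce.2 j (v j) =
      #|placements z|%:R * P (fun c => (z c)%:R).
    by exists P => // z; rewrite -PE; apply: eq_bigr => v _.
  elim: (s) sd => [_|ce s' IHs sd'].
    exists (fun=> 0); first exact: polyfun_cst.
    by move=> z; rewrite mulr0 big1 // => v _; rewrite big_nil.
  have [Q1 dQ1 Q1E] := Pm ce.2 (sd' _ (mem_head _ _)).
  have [|Q2 dQ2 Q2E] := IHs; first by move=> ce' ce's; apply: sd'; rewrite inE ce's orbT.
  exists (fun y => ce.1 * Q1 y + Q2 y).
    by apply: polyfunD => //; exact: polyfunZ.
  move=> z; under eq_bigr do rewrite big_cons.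
  by rewrite big_split /= Q2E -mulr_sumr Q1E; ring.
exists P => // z zt a.
have [v0 v0z] := placements_nonempty zt.
have c0 : 0 < #|placements z|%:R :> R.
  by rewrite ltr0n; apply/card_gt0P; exists v0.
have w_ge0 v (y : words) : 0 <= \prod_j nu (v j) (y j) by apply: prodr_ge0.
have w_sum v : \sum_(y : words) \prod_j nu (v j) (y j) = 1.
  rewrite -(bigA_distr_bigA (fun j y => nu (v j) y)) /=.
  by rewrite big1 // => j _; rewrite nu_sum.
have counts v (y : words) : v \in placements z -> \prod_j nu (v j) (y j) != 0 -> has_counts z y.
  rewrite inE => /forallP vz /prodf_neq0 w0 c; rewrite -(eqP (vz c)).
  by apply: eq_card => j; rewrite !inE (nu_dec (w0 j isT)).
have avg : P (fun c => (z c)%:R) * #|placements z|%:R = \sum_(v in placements z) A v.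
  by rewrite PE mulrC.
split => H.
  rewrite -(ler_pM2r c0) avg mulr_natr -sumr_const; apply: ler_sum => v vz.
  rewrite -[a]mul1r -(w_sum v) mulr_suml; apply: ler_sum => y _.
  have [->|w0] := eqVneq (\prod_j nu (v j) (y j)) 0; first by rewrite !mul0r.
  by rewrite ler_wpM2l // H //; exact: counts w0.
rewrite -(ler_pM2r c0) avg mulr_natr -sumr_const; apply: ler_sum => v vz.
rewrite -[a]mul1r -(w_sum v) mulr_suml; apply: ler_sum => y _.
have [->|w0] := eqVneq (\prod_j nu (v j) (y j)) 0; first by rewrite !mul0r.
by rewrite ler_wpM2l // H //; exact: counts w0.
Qed.

End Slots.

(** * A family of codes of constant rate and linear distance *)

Section Code.
Variables (mu len : nat).
Local Notation word := {ffun 'I_len -> bool}.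
Local Notation generator := {ffun 'I_mu -> word}.
Local Notation message := {ffun 'I_mu -> bool}.
Implicit Types (w : generator) (u : message) (y : word).

Definition encode w u : word := [ffun b => \big[addb/false]_(i | u i) w i b].

Definition syndrome w y : message := [ffun i => \big[addb/false]_b (w i b && y b)].

Definition wt y : nat := #|[set b | y b]|.

Definition light_words (L : nat) : {set word} := [set y | (wt y < L)%N].

(** For a nonzero message the codeword of a uniform generator is uniform: adding a word [a] to the
    row [i0] permutes the generators and translates the codeword by [a]. *)
Lemma card_light_encode u (L : nat) : (exists i, u i) ->
  (#|[set w | encode w u \in light_words L]| * 2 ^ len =
   #|generator| * #|light_words L|)%N.
Proof.
move=> [i0 ui0].
pose shift (a : word) w : generator :=
  [ffun i => if i == i0 then [ffun b => w i b (+) a b] else w i].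
have shiftK a : involutive (shift a).
  move=> w; apply/ffunP => i; rewrite !ffunE; case: eqP => // _.
  by apply/ffunP => b; rewrite !ffunE -addbA addbb addbF.
have encode_shift a w : encode (shift a w) u = [ffun b => encode w u b (+) a b].
  apply/ffunP => b; rewrite !ffunE (bigD1 i0) //= [in RHS](bigD1 i0) //=.
  rewrite !ffunE eqxx ffunE -!addbA [a b (+) _]addbC; congr (_ (+) (_ (+) _)).
  by apply: eq_bigr => i /andP [_ /negbTE ii0]; rewrite ffunE ii0.
have E (a : word) : #|[set w | encode w u \in light_words L]| =
    (\sum_w ([ffun b => encode w u b (+) a b] \in light_words L))%N.
  rewrite -sum1_card big_mkcond /= (reindex_inj (inv_inj (shiftK a))) /=.
  by apply: eq_bigr => w _; rewrite inE encode_shift; case: (_ \in _).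
transitivity (\sum_(a : word) #|[set w | encode w u \in light_words L]|)%N.
  by rewrite sum_nat_const card_ffun card_bool card_ord mulnC.
rewrite (eq_bigr _ (fun a _ => E a)) exchange_big /=.
rewrite -sum_nat_const; apply: eq_bigr => w _.
pose tr (a : word) : word := [ffun b => encode w u b (+) a b].
have trK : involutive tr.
  by move=> a; apply/ffunP => b; rewrite !ffunE addbA addbb addFb.
rewrite (reindex_inj (inv_inj trK)) /= -sum1_card [RHS]big_mkcond /=.
by apply: eq_bigr => a _; rewrite -/(tr (tr a)) trK; case: (_ \in _).
Qed.

(** The Gilbert-Varshamov argument: a union bound over the nonzero messages. *)
Lemma exists_generator (L : nat) : (2 ^ mu * #|light_words L| < 2 ^ len)%N ->
  exists w, forall u, (exists i, u i) -> (L <= wt (encode w u))%N.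
Proof.
move=> vol.
pose bad u := [set w | encode w u \in light_words L].
have cover_lt : (#|\bigcup_(u : message | [exists i, u i]) bad u| < #|generator|)%N.
  rewrite -(ltn_pmul2r (expn_gt0 2 len)).
  apply: (@leq_ltn_trans (2 ^ mu * (#|generator| * #|light_words L|))).
    apply: (@leq_trans (\sum_(u : message) #|generator| * #|light_words L|)); last first.
      by rewrite sum_nat_const card_ffun card_bool card_ord.
    apply: (@leq_trans (\sum_(u : message | [exists i, u i]) #|bad u| * 2 ^ len)).
      rewrite -big_distrl leq_mul2r; apply/orP; right.
      elim/big_rec2: _ => [|u k A _ IH]; first by rewrite cards0.
      by rewrite cardsU; apply: leq_trans (leq_subr _ _) _; rewrite leq_add2l.
    rewrite big_mkcond /=; apply: leq_sum => u _; case: ifP => // /existsP uN.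
    by rewrite (card_light_encode _ uN).
  rewrite mulnCA ltn_pmul2l //.
  by apply/card_gt0P; exists [ffun=> [ffun=> false]].
have [w /= wnb] : exists w, w \notin \bigcup_(u : message | [exists i, u i]) bad u.
  apply/existsP; apply: contraTT cover_lt => /existsPn H; rewrite -leqNgt.
  by apply: subset_leq_card; apply/subsetP => w _; have := H w; rewrite negbK.
exists w => u uN; rewrite leqNgt; apply: contra wnb => wl.
by apply/bigcupP; exists u; [apply/existsP|rewrite !inE].
Qed.

End Code.

(** Give a word a factor 3 for each false bit. All words together weigh [4 ^ (12 t)], and a light
    word weighs at least [3 ^ (11 t)]. Rate and distance are chosen so that [2 ^ 15 < 3 ^ 11]
    suffices. *)
Lemma card_light_words (t : nat) : (0 < t)%N ->
  (2 ^ (3 * t) * #|light_words (12 * t) t| < 2 ^ (12 * t))%N.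
Proof.
move=> t0; set S := light_words _ _.
pose f (b : bool) := if b then 1%N else 3%N.
have tot : (\sum_(y : {ffun 'I_(12 * t) -> bool}) \prod_b f (y b) = 4 ^ (12 * t))%N.
  rewrite -(bigA_distr_bigA (fun _ b => f b)) /=.
  under eq_bigr do rewrite big_bool.
  by rewrite prod_nat_const card_ord.
have SE : (#|S| * 3 ^ (11 * t) <= 4 ^ (12 * t))%N.
  rewrite -tot -sum_nat_const big_mkcond /=; apply: leq_sum => y _.
  case: ifP => //; rewrite inE => yt.
  have -> : (\prod_b f (y b) = 3 ^ #|[set b | ~~ y b]|)%N.
    rewrite -prod_nat_const [RHS]big_mkcond /=; apply: eq_bigr => b _.
    by rewrite inE /f; case: (y b).
  rewrite leq_exp2l //; have := cardsC [set b | y b]; rewrite card_ord.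
  have -> : #|[set b | ~~ y b]| = #|~: [set b | y b]| by apply: eq_card => b; rewrite !inE.
  by move: yt; rewrite /wt; lia.
rewrite -(ltn_pmul2r (expn_gt0 3 (11 * t))) -mulnA.
apply: leq_ltn_trans (leq_mul (leqnn _) SE) _.
have -> : (4 ^ (12 * t) = 2 ^ (12 * t) * 2 ^ (12 * t))%N by rewrite -expnMn.
rewrite mulnCA ltn_pmul2l ?expn_gt0 // -expnD -mulnDl !expnM ltn_exp2r //.
Qed.

(** * Cosets of the dual code cannot be told apart by few bits *)

Section Fibers.
Variables (R : realFieldType) (mu len L : nat).
Local Notation word := {ffun 'I_len -> bool}.
Local Notation message := {ffun 'I_mu -> bool}.
Variable w : {ffun 'I_mu -> word}.
Hypothesis w_dist : forall u : message, (exists i, u i) -> (L <= wt (encode w u))%N.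

Let sg (b : bool) : R := (-1) ^+ b.

Lemma sg_big (I : finType) (P : pred I) (F : I -> bool) :
  sg (\big[addb/false]_(i | P i) F i) = \prod_(i | P i) sg (F i).
Proof. by apply: (big_morph sg) => // b b'; rewrite /sg signr_addb. Qed.

(** Expanding the indicator of a syndrome into characters gives one term per message [u]. For
    nonzero [u] the codeword has weight at least [L], hence a true bit outside [B], and the two
    values of [y] there cancel. Only [u = 0] survives, and its term does not involve [kappa]. *)
Lemma fiber_moment (kappa : message) (B : {set 'I_len}) : (#|B| < L)%N ->
  \sum_(y : word) (syndrome w y == kappa)%:R * \prod_(b in B) (y b)%:R =
  2^-1 ^+ mu * 2 ^+ #|~: B| :> R.
Proof.
move=> BL.
have ind (y : word) : (syndrome w y == kappa)%:R = 2^-1 ^+ mu * \sum_(u : message)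
    (\prod_(i | u i) sg (kappa i)) * \prod_b sg (encode w u b && y b) :> R.
  transitivity (\prod_i (2^-1 * (sg (syndrome w y i) * sg (kappa i) + 1)) : R).
    have [->|/eqP ne] := eqVneq (syndrome w y) kappa.
      by rewrite big1 // => i _; rewrite /sg -expr2 sqrr_sign; field.
    have [i ne'] : exists i, syndrome w y i != kappa i.
      apply/existsP; apply: contra_notT ne => /existsPn H; apply/ffunP => i.
      by apply/eqP; rewrite -[_ == _]negbK H.
    rewrite (bigD1 i) //= (_ : _ * sg _ = -1) ?addNr ?mulr0 ?mul0r //.
    by move: ne'; rewrite /sg; case: (syndrome w y i); case: (kappa i); rewrite //= ?expr1 ?expr0 ?mulr1 ?mul1r.
  rewrite big_split /= prodr_const card_ord; congr (_ * _).
  pose F (i : 'I_mu) (b : bool) : R := if b then sg (syndrome w y i) * sg (kappa i) else 1.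
  transitivity (\sum_(u : message) \prod_i F i (u i)).
    by rewrite -(bigA_distr_bigA F) /=; apply: eq_bigr => i _; rewrite big_bool.
  apply: eq_bigr => u _; rewrite -big_mkcond /= big_split /= mulrC; congr (_ * _).
  transitivity (\prod_(i | u i) \prod_b sg (w i b && y b)).
    by apply: eq_bigr => i _; rewrite ffunE sg_big.
  rewrite exchange_big /=; apply: eq_bigr => b _; rewrite ffunE.
  case: (y b); last by rewrite big1 ?andbF // => i _; rewrite andbF.
  by rewrite andbT sg_big; apply: eq_bigr => i _; rewrite andbT.
under eq_bigr do rewrite ind -mulrA mulr_suml.
rewrite -mulr_sumr; congr (_ * _); rewrite exchange_big /=.
pose G (u : message) b (v : bool) : R := sg (encode w u b && v) * (if b \in B then v%:R else 1).
have inner (u : message) : \sum_(y : word) (\prod_(i | u i) sg (kappa i)) *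
      \prod_b sg (encode w u b && y b) * \prod_(b in B) (y b)%:R =
    (\prod_(i | u i) sg (kappa i)) * \prod_b (G u b true + G u b false).
  transitivity (\sum_(y : word) (\prod_(i | u i) sg (kappa i)) * \prod_b G u b (y b)).
    apply: eq_bigr => y _; rewrite -mulrA; congr (_ * _).
    by rewrite [X in _ * X]big_mkcond -big_split.
  rewrite -mulr_sumr; congr (_ * _).
  by rewrite -(bigA_distr_bigA (G u)) /=; apply: eq_bigr => b _; rewrite big_bool.
under eq_bigr do rewrite inner.
rewrite (bigD1 [ffun=> false]) //= [X in _ + X]big1 ?addr0 => [|u uN].
  rewrite big_pred0 ?mul1r => [|i]; last by rewrite ffunE.
  rewrite -prodr_const [RHS]big_mkcond; apply: eq_bigr => b _.
  rewrite inE /G (_ : encode w _ b = false); last first.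
    by rewrite ffunE big_pred0 // => i; rewrite ffunE.
  by rewrite /= /sg expr0 !mul1r; case: ifP => _ /=; rewrite ?addr0.
have [i ui] : exists i, u i.
  apply/existsP; apply: contraNT uN => /existsPn H; apply/eqP/ffunP => i.
  by rewrite ffunE; apply/negbTE.
have [b bB eb] : exists2 b, b \notin B & encode w u b.
  have := w_dist (ex_intro _ i ui); rewrite leqNgt => wl.
  have /subsetPn [b] : ~~ ([set b | encode w u b] \subset B).
    by apply: contra wl => /subset_leq_card H; apply: leq_ltn_trans BL.
  by rewrite inE => eb bB; exists b.
rewrite (bigD1 b) //= {1 2}/G (negbTE bB) eb /= /sg expr1 expr0 !mulr1 addNr mul0r mulr0 //.
Qed.

End Fibers.

Lemma exists_code (R : realFieldType) (I : finType) (t : nat) :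
  (0 < t)%N -> (#|I| < 2 ^ (3 * t))%N ->
  exists (dec : {ffun 'I_(12 * t) -> bool} -> option I)
         (nu : option I -> {ffun 'I_(12 * t) -> bool} -> R),
    [/\ forall k y, 0 <= nu k y, forall k, \sum_y nu k y = 1,
        forall k y, nu k y != 0 -> dec y = k &
        forall (B : {set 'I_(12 * t)}) k k', (#|B| < t)%N ->
          \sum_y nu k y * \prod_(b in B) (y b)%:R =
          \sum_y nu k' y * \prod_(b in B) (y b)%:R].
Proof.
move=> t0 It; have [w wd] := exists_generator (card_light_words t0).
pose message := {ffun 'I_(3 * t) -> bool}.
have cK : (#|{: option I}| <= #|{: message}|)%N.
  by rewrite card_option card_ffun card_bool card_ord.
pose iota (k : option I) : message := enum_val (widen_ord cK (enum_rank k)).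
have iota_inj : injective iota.
  move=> k k' /enum_val_inj /(congr1 val) /= /ord_inj; exact: enum_rank_inj.
(* The common size of the fibers, namely [fiber_moment] at the empty set. *)
pose c : R := 2^-1 ^+ (3 * t) * 2 ^+ (12 * t).
have c0 : 0 < c by rewrite mulr_gt0 ?exprn_gt0 ?invr_gt0.
(* A syndrome outside the image of [iota] decodes to [None], so ill-formed words are idle. *)
exists (fun y => odflt None [pick k | syndrome w y == iota k]).
exists (fun k y => c^-1 * (syndrome w y == iota k)%:R).
have mom k (B : {set 'I_(12 * t)}) : (#|B| < t)%N ->
    \sum_y c^-1 * (syndrome w y == iota k)%:R * \prod_(b in B) (y b)%:R =
    c^-1 * (2^-1 ^+ (3 * t) * 2 ^+ #|~: B|).
  move=> Bt; rewrite -(fiber_moment R wd (iota k) Bt) mulr_sumr.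
  by apply: eq_bigr => y _; rewrite mulrA.
split.
- by move=> k y; rewrite mulr_ge0 // invr_ge0 ltW.
- move=> k; transitivity (\sum_y c^-1 * (syndrome w y == iota k)%:R *
      \prod_(b in (set0 : {set 'I_(12 * t)})) (y b)%:R).
    by apply: eq_bigr => y _; rewrite big_set0 mulr1.
  by rewrite mom ?cards0 // setC0 cardsT card_ord mulVf ?gt_eqF.
- move=> k y; case: (syndrome w y =P iota k) => [sy _|_]; last by rewrite mulr0 eqxx.
  case: pickP => [k' /eqP|/(_ k)]; last by rewrite sy eqxx.
  by rewrite sy => /iota_inj <-.
- by move=> B k k' Bt; rewrite !mom.
Qed.

(** * Circuits *)

Section CircuitFacts.
Local Open Scope nat_scope.
Variable n : nat.
Implicit Types (g : gate n) (gs : seq (gate n)) (w : wire n) (x : cube n).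

Definition gate0 : gate n := MkGate And [::].

Lemma bigmax_le_all (T : Type) (s : seq T) (F : T -> nat) M :
  (\max_(a <- s) F a <= M) = all (fun a => F a <= M) s.
Proof. by elim: s => [|a s IHs]; rewrite ?big_nil ?big_cons //= geq_max IHs. Qed.

Definition gate_ok (k : nat) g : bool := (0 < size (fan g)) && all (wire_below k) (fan g).

Definition gate_height (hs : seq nat) g : nat := (\max_(w <- fan g) wire_height hs w).+1.

Lemma gate_vals_rcons x gs g :
  gate_vals x (rcons gs g) = rcons (gate_vals x gs) (gate_val x (gate_vals x gs) g).
Proof. by rewrite /gate_vals foldl_rcons. Qed.

Lemma gate_heights_rcons gs g :
  gate_heights (rcons gs g) = rcons (gate_heights gs) (gate_height (gate_heights gs) g).
Proof. by rewrite /gate_heights foldl_rcons. Qed.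

Lemma size_gate_vals x gs : size (gate_vals x gs) = size gs.
Proof. by elim/last_ind: gs => // gs g IH; rewrite gate_vals_rcons !size_rcons IH. Qed.

Lemma size_gate_heights gs : size (gate_heights gs) = size gs.
Proof. by elim/last_ind: gs => // gs g IH; rewrite gate_heights_rcons !size_rcons IH. Qed.

Lemma gates_wf_rcons gs g :
  gates_wf (rcons gs g) <-> gates_wf gs /\ gate_ok (size gs) g.
Proof.
split => [wf|[wf gok]].
  split => [gs1 gs2 g' E|]; last by apply/andP; apply: (wf gs [::]); rewrite cats1.
  by apply: (wf gs1 (rcons gs2 g)); rewrite E rcons_cat.
move=> gs1 gs2 g'; case/lastP: gs2 => [|gs2 g2].
  by rewrite cats1 => /rcons_inj [<- <-]; apply/andP.
by rewrite -rcons_cons -rcons_cat => /rcons_inj [/wf].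
Qed.

Lemma wire_val_cat x vs vs' w : wire_below (size vs) w ->
  wire_val x (vs ++ vs') w = wire_val x vs w.
Proof. by case: w => //= j jv; rewrite nth_cat jv. Qed.

Lemma gate_val_cat x vs vs' g : all (wire_below (size vs)) (fan g) ->
  gate_val x (vs ++ vs') g = gate_val x vs g.
Proof.
rewrite /gate_val; case: (op g); elim: (fan g) => //= w s IHs /andP [wv sv].
  by rewrite IHs // wire_val_cat.
by rewrite IHs // wire_val_cat.
Qed.

Lemma gate_height_cat hs hs' g : all (wire_below (size hs)) (fan g) ->
  gate_height (hs ++ hs') g = gate_height hs g.
Proof.
rewrite /gate_height => H; congr _.+1; elim: (fan g) H => [|w s IHs] /=; first by rewrite !big_nil.
move=> /andP [wv sv]; rewrite !big_cons IHs //; congr maxn.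
by case: w wv => //= j jv; rewrite nth_cat jv.
Qed.

Lemma gates_wf_cat gs gs' : gates_wf gs -> all (gate_ok (size gs)) gs' -> gates_wf (gs ++ gs').
Proof.
move=> wf; elim/last_ind: gs' => [|gs' g IH]; first by rewrite cats0.
rewrite all_rcons => /andP [/andP [g0 gb] gs'ok]; rewrite -rcons_cat gates_wf_rcons.
split; first exact: IH.
rewrite /gate_ok g0; apply: sub_all gb => -[] //= j jb.
by rewrite size_cat (leq_trans jb) // leq_addr.
Qed.

Lemma gate_vals_cat x gs gs' : all (gate_ok (size gs)) gs' ->
  gate_vals x (gs ++ gs') = gate_vals x gs ++ [seq gate_val x (gate_vals x gs) g | g <- gs'].
Proof.
elim/last_ind: gs' => [|gs' g IH]; first by rewrite !cats0.
rewrite all_rcons => /andP [/andP [g0 gb] gs'ok].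
by rewrite -rcons_cat gate_vals_rcons IH // map_rcons rcons_cat gate_val_cat // size_gate_vals.
Qed.

Lemma gate_heights_cat gs gs' : all (gate_ok (size gs)) gs' ->
  gate_heights (gs ++ gs') =
  gate_heights gs ++ [seq gate_height (gate_heights gs) g | g <- gs'].
Proof.
elim/last_ind: gs' => [|gs' g IH]; first by rewrite !cats0.
rewrite all_rcons => /andP [/andP [g0 gb] gs'ok].
by rewrite -rcons_cat gate_heights_rcons IH // map_rcons rcons_cat gate_height_cat //
  size_gate_heights.
Qed.

(** A gate reads only earlier gates, so it may be evaluated against the final list of values instead
    of the prefix present when it was added. *)
Lemma nth_gate_vals x gs j : gates_wf gs -> j < size gs ->
  nth false (gate_vals x gs) j = gate_val x (gate_vals x gs) (nth gate0 gs j).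
Proof.
elim/last_ind: gs => // gs g IH /gates_wf_rcons [wf /andP [_ gb]].
rewrite size_rcons ltnS leq_eqVlt gate_vals_rcons !nth_rcons size_gate_vals -cats1.
case/orP => [/eqP ->|jg].
  by rewrite ltnn eqxx gate_val_cat // size_gate_vals.
rewrite jg IH // gate_val_cat // size_gate_vals.
move: wf; rewrite -{1}(cat_take_drop j gs) (drop_nth gate0 jg) => /(_ _ _ _ erefl) [_].
by apply: sub_all => -[] //= i; rewrite size_take jg => /ltn_trans; apply.
Qed.

Lemma nth_gate_heights gs j : gates_wf gs -> j < size gs ->
  nth 0 (gate_heights gs) j = gate_height (gate_heights gs) (nth gate0 gs j).
Proof.
elim/last_ind: gs => // gs g IH /gates_wf_rcons [wf /andP [_ gb]].
rewrite size_rcons ltnS leq_eqVlt gate_heights_rcons !nth_rcons size_gate_heights -cats1.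
case/orP => [/eqP ->|jg].
  by rewrite ltnn eqxx gate_height_cat // size_gate_heights.
rewrite jg IH // gate_height_cat // size_gate_heights.
move: wf; rewrite -{1}(cat_take_drop j gs) (drop_nth gate0 jg) => /(_ _ _ _ erefl) [_].
by apply: sub_all => -[] //= i; rewrite size_take jg => /ltn_trans; apply.
Qed.

Lemma nth_gate_ok gs j : gates_wf gs -> j < size gs -> gate_ok j (nth gate0 gs j).
Proof.
move=> wf jg; apply/andP; move: wf.
rewrite -{1}(cat_take_drop j gs) (drop_nth gate0 jg) => /(_ _ _ _ erefl).
by rewrite size_take jg.
Qed.

(** * Appending a layer of mutually independent gates *)

Section Layer.
Variables (gs : seq (gate n)) (X : finType) (G : X -> gate n).

Definition layer : seq (gate n) := gs ++ [seq G e | e <- enum X].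
Definition layer_index (e : X) : nat := size gs + enum_rank e.

Hypothesis gs_wf : gates_wf gs.
Hypothesis G_ok : forall e, gate_ok (size gs) (G e).

Lemma size_layer : size layer = size gs + #|X|.
Proof. by rewrite size_cat size_map cardE. Qed.

Lemma layer_index_lt e : layer_index e < size layer.
Proof. by rewrite size_layer ltn_add2l. Qed.

Let all_ok : all (gate_ok (size gs)) [seq G e | e <- enum X].
Proof. by rewrite all_map; apply/allP => e _ /=. Qed.

Lemma layer_wf : gates_wf layer.
Proof. exact: gates_wf_cat. Qed.

Lemma nth_enum_map (T : Type) (a : T) (F : X -> T) e :
  nth a [seq F e | e <- enum X] (enum_rank e) = F e.
Proof. by rewrite (nth_map e) ?nth_enum_rank // -cardE. Qed.

Lemma layer_gate e : nth gate0 layer (layer_index e) = G e.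
Proof. by rewrite nth_cat ltnNge leq_addr /= addKn nth_enum_map. Qed.

Lemma layer_vals x : gate_vals x layer =
  gate_vals x gs ++ [seq gate_val x (gate_vals x gs) (G e) | e <- enum X].
Proof. by rewrite gate_vals_cat // -map_comp. Qed.

Lemma layer_heights : gate_heights layer =
  gate_heights gs ++ [seq gate_height (gate_heights gs) (G e) | e <- enum X].
Proof. by rewrite gate_heights_cat // -map_comp. Qed.

Lemma layer_val x e : nth false (gate_vals x layer) (layer_index e) =
  gate_val x (gate_vals x gs) (G e).
Proof.
by rewrite layer_vals nth_cat size_gate_vals ltnNge leq_addr /= addKn nth_enum_map.
Qed.

Lemma layer_height e : nth 0 (gate_heights layer) (layer_index e) =
  gate_height (gate_heights gs) (G e).
Proof.
by rewrite layer_heights nth_cat size_gate_heights ltnNge leq_addr /= addKn nth_enum_map.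
Qed.

End Layer.

End CircuitFacts.

(** * The gadget circuit and substitution into the circuit of [f] *)

Definition op_is (o o' : gate_op) : bool :=
  match o, o' with And, And | Or, Or => true | _, _ => false end.

Section Gadget.
Local Open Scope nat_scope.
Variables (n m theta len : nat).
Local Notation word := {ffun 'I_len -> bool}.
Local Notation cell := ('I_n * 'I_m)%type.
Local Notation bit := ('I_theta * 'I_len)%type.
Variable dec : word -> option cell.
Hypotheses (m_gt0 : 0 < m) (len_gt0 : 0 < len) (theta_gt0 : 0 < theta).
Hypothesis dec_onto : forall c, exists v, dec v = Some c.

Local Notation nbits := #|{: bit}|.

Definition words_of (y : cube nbits) : {ffun 'I_theta -> word} :=
  [ffun j => [ffun b => y (enum_rank ((j, b) : bit))]].

Definition gadget (y : cube nbits) (i : 'I_n) : bool :=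
  [forall a, [exists j, dec (words_of y j) == Some (i, a)]].

(** Each layer is built in both polarities, the negative one by De Morgan, because only inputs can
    be negated. Here [e.1] selects between equality of a slot with a word and its negation. *)
Definition literal_layer (e : bool * ('I_theta * word)) : gate nbits :=
  MkGate (if e.1 then And else Or)
    [seq Input (e.1 (+) e.2.2 b) (enum_rank ((e.2.1, b) : bit)) | b <- enum 'I_len].

Definition base1 : seq (gate nbits) := layer [::] literal_layer.
Definition index1 := @layer_index nbits [::] (bool * ('I_theta * word))%type.

(** The words that decode to the cell are enumerated; their number is polynomial because their
    length is logarithmic. *)
Definition cell_layer (e : bool * cell) : gate nbits :=
  MkGate (if e.1 then Or else And)
    [seq Gate _ (index1 (e.1, t)) | t <- enum [pred t : 'I_theta * word | dec t.2 == Some e.2]].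

Definition base2 : seq (gate nbits) := layer base1 cell_layer.
Definition index2 := @layer_index nbits base1 (bool * cell)%type.

Definition gadget_layer (e : bool * 'I_n) : gate nbits :=
  MkGate (if e.1 then And else Or) [seq Gate _ (index2 (e.1, (e.2, a))) | a <- enum 'I_m].

Definition base3 : seq (gate nbits) := layer base2 gadget_layer.
Definition index3 := @layer_index nbits base2 (bool * 'I_n)%type.

Lemma literal_ok e : gate_ok 0 (literal_layer e).
Proof.
rewrite /gate_ok /literal_layer /= size_map -cardE card_ord len_gt0 /=.
by rewrite all_map; apply/allP.
Qed.

Lemma cell_ok e : gate_ok (size base1) (cell_layer e).
Proof.
rewrite /gate_ok /cell_layer /= size_map -cardE; apply/andP; split.
  have [v dv] := dec_onto e.2; apply/card_gt0P.
  by exists (Ordinal theta_gt0, v); rewrite inE /= dv.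
by rewrite all_map; apply/allP => t _ /=; exact: layer_index_lt.
Qed.

Lemma gadget_ok e : gate_ok (size base2) (gadget_layer e).
Proof.
rewrite /gate_ok /gadget_layer /= size_map -cardE card_ord m_gt0 /=.
by rewrite all_map; apply/allP => a _ /=; exact: layer_index_lt.
Qed.

Lemma gates_wf_nil : gates_wf ([::] : seq (gate nbits)).
Proof. by case. Qed.

Lemma base1_wf : gates_wf base1. Proof. exact: layer_wf gates_wf_nil literal_ok. Qed.
Lemma base2_wf : gates_wf base2. Proof. exact: layer_wf base1_wf cell_ok. Qed.
Lemma base3_wf : gates_wf base3. Proof. exact: layer_wf base2_wf gadget_ok. Qed.

Lemma literal_val y e : nth false (gate_vals y base1) (index1 e) =
  ~~ e.1 (+) (words_of y e.2.1 == e.2.2).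
Proof.
rewrite layer_val; last exact: literal_ok.
case: e => -[] [j v]; rewrite /gate_val /literal_layer /=.
  rewrite all_map ?addFb; apply/allP/eqP => [H|<-].
    apply/ffunP => b; have /= := H b (mem_enum _ b).
    by rewrite !ffunE; case: (v b); case: (y _).
  by move=> b _ /=; rewrite !ffunE; case: (y _).
rewrite has_map ?addTb; apply/hasP/idP => [[b _ /=]|].
  by apply: contraL => /eqP <-; rewrite !ffunE addbb.
move=> ne; have [b] : exists b, words_of y j b != v b.
  by apply/existsP; apply: contraNT ne => /existsPn H; apply/eqP/ffunP => b; apply/eqP; rewrite -[_ == _]negbK H.
by exists b; rewrite ?mem_enum //=; move: p; rewrite !ffunE; case: (v b); case: (y _).
Qed.

Lemma cell_val y e : nth false (gate_vals y base2) (index2 e) =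
  ~~ e.1 (+) [exists j, dec (words_of y j) == Some e.2].
Proof.
rewrite layer_val; last exact: cell_ok.
case: e => -[] c; rewrite /gate_val /cell_layer /=.
  rewrite has_map ?addFb; apply/hasP/existsP => [[[j v]]|[j dj]].
    by rewrite mem_enum inE /= => dv; rewrite literal_val /= ?addFb => /eqP E; exists j; rewrite E.
  by exists (j, words_of y j); rewrite ?mem_enum ?inE //= literal_val /= eqxx.
rewrite all_map ?addTb; apply/allP/existsPn => [H j|H [j v]].
  apply/negP => dj; have := H (j, words_of y j); rewrite mem_enum inE /= literal_val /= eqxx.
  by move=> /(_ dj).
by rewrite mem_enum inE /= literal_val /= ?addTb => dv; apply: contraNneq (H j) => ->.
Qed.

Lemma gadget_val y e : nth false (gate_vals y base3) (index3 e) = ~~ e.1 (+) gadget y e.2.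
Proof.
rewrite layer_val; last exact: gadget_ok.
case: e => -[] i; rewrite /gate_val /gadget_layer /=.
  rewrite all_map ?addFb; apply/allP/forallP => [H a|H a _].
    by have := H a (mem_enum _ a); rewrite /= cell_val.
  by rewrite /= cell_val; exact: H.
rewrite has_map ?addTb -[RHS]/(~~ gadget y i) /gadget negb_forall.
apply/hasP/existsP => [[a _]|[a H]].
  by rewrite /= cell_val; exists a.
by exists a; rewrite ?mem_enum //= cell_val.
Qed.

Lemma gadget_height e : nth 0 (gate_heights base3) (index3 e) <= 3.
Proof.
have h1 e' : nth 0 (gate_heights base1) (index1 e') <= 1.
  rewrite layer_height; last exact: literal_ok.
  by rewrite /gate_height ltnS bigmax_le_all all_map; apply/allP.
have h2 e' : nth 0 (gate_heights base2) (index2 e') <= 2.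
  rewrite layer_height; last exact: cell_ok.
  by rewrite /gate_height ltnS bigmax_le_all all_map; apply/allP => t _ /=; exact: h1.
rewrite layer_height; last exact: gadget_ok.
by rewrite /gate_height ltnS bigmax_le_all all_map; apply/allP => t _ /=; exact: h2.
Qed.

Lemma size_base3 : size base3 = 2 * (theta * 2 ^ len + n * m + n).
Proof.
rewrite !size_layer /= !card_prod card_ffun !card_bool !card_ord; lia.
Qed.

Lemma size_base23 : size base2 <= size base3.
Proof. by rewrite [leqRHS]size_layer leq_addr. Qed.

Variable sigma : bool.

(** Negating all copies of the gadget exchanges And and Or at their top gates. This freedom serves
    to align them with the bottom gates of the circuit of [f]. *)
Definition inner_input (y : cube nbits) : cube n := [ffun i => sigma (+) gadget y i].

Definition wire_index (w : wire n) : nat :=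
  match w with
  | Input neg i => index3 (~~ (neg (+) sigma), i)
  | Gate j => size base3 + j
  end.

(* A child gate with the same operation as its parent is replaced by its own
   inputs; this is what saves one level of depth. *)
Definition inline (ms : seq (gate nbits)) (o : gate_op) (w : wire n) : seq (wire nbits) :=
  let g := nth (gate0 _) ms (wire_index w) in
  if op_is (op g) o then fan g else [:: Gate _ (wire_index w)].

Definition inline_gate ms (g : gate n) : gate nbits :=
  MkGate (op g) (flatten [seq inline ms (op g) w | w <- fan g]).

Definition compose (gs : seq (gate n)) : seq (gate nbits) :=
  foldl (fun ms g => rcons ms (inline_gate ms g)) base3 gs.

Lemma compose_rcons gs g : compose (rcons gs g) = rcons (compose gs) (inline_gate (compose gs) g).
Proof. by rewrite /compose foldl_rcons. Qed.

Lemma size_compose gs : size (compose gs) = size base3 + size gs.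
Proof.
elim/last_ind: gs => [|gs g IH]; first by rewrite addn0.
by rewrite compose_rcons !size_rcons IH addnS.
Qed.

Lemma wire_index_lt gs w : wire_below (size gs) w -> wire_index w < size (compose gs).
Proof.
rewrite size_compose; case: w => [neg i _|j jgs] /=; last by rewrite ltn_add2l.
by apply: leq_trans (layer_index_lt _ _ _) (leq_addr _ _).
Qed.

Lemma inline_gate_ok gs g : gates_wf (compose gs) -> gate_ok (size gs) g ->
  gate_ok (size (compose gs)) (inline_gate (compose gs) g).
Proof.
move=> wf /andP [g0 gb].
have ok w : wire_below (size gs) w -> (0 < size (inline (compose gs) (op g) w)) &&
    all (wire_below (size (compose gs))) (inline (compose gs) (op g) w).
  move=> /wire_index_lt lt; rewrite /inline; case: ifP => _ /=; last by rewrite lt.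
  have /andP [-> H] := nth_gate_ok wf lt; rewrite /=.
  by apply: sub_all H => -[] //= j /ltn_trans; apply.
rewrite /gate_ok /=; apply/andP; split.
  case: (fan g) g0 gb => //= w s _ /andP [/ok /andP [w0 _] _].
  by rewrite size_cat ltn_addr.
elim: (fan g) gb => //= w s IHs /andP [/ok /andP [_ wb] sb].
by rewrite all_cat wb IHs.
Qed.

Lemma compose_wf gs : gates_wf gs -> gates_wf (compose gs).
Proof.
elim/last_ind: gs => [_|gs g IH]; first exact: base3_wf.
move=> /gates_wf_rcons [/IH wf gok]; rewrite compose_rcons gates_wf_rcons.
by split => //; exact: inline_gate_ok.
Qed.

Lemma compose_vals y gs : gates_wf gs ->
  gate_vals y (compose gs) = gate_vals y base3 ++ gate_vals (inner_input y) gs.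
Proof.
elim/last_ind: gs => [_|gs g IH]; first by rewrite cats0.
move=> wf'; have /gates_wf_rcons [wf /andP [_ gb]] := wf'; have {}IH := IH wf.
have cwf := compose_wf wf.
rewrite compose_rcons !gate_vals_rcons -rcons_cat -IH; congr rcons.
set V := gate_vals y (compose gs).
have wv w : wire_below (size gs) w ->
    nth false V (wire_index w) = wire_val (inner_input y) (gate_vals (inner_input y) gs) w.
  rewrite /V IH nth_cat size_gate_vals; case: w => [neg i _|j jgs] /=.
    rewrite layer_index_lt gadget_val /= negbK ffunE.
    by case: neg; case: sigma; case: gadget.
  by rewrite ltnNge leq_addr /= addKn.
have gv w : wire_below (size gs) w -> nth false V (wire_index w) =
    gate_val y V (nth (gate0 _) (compose gs) (wire_index w)).
  by move=> /wire_index_lt lt; rewrite /V nth_gate_vals.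
rewrite /gate_val /inline_gate /=; case E : (op g).
  have -> s : all (wire_val y V) (flatten s) = all (all (wire_val y V)) s.
    by elim: s => //= a s IHs; rewrite all_cat IHs.
  rewrite all_map; elim: (fan g) gb => //= w s IHs /andP [wb sb].
  rewrite IHs // -wv //; congr andb; rewrite /inline; case: ifP => [o|_ /=]; last by rewrite andbT.
  by rewrite gv // /gate_val; case: (op _) o.
have -> s : has (wire_val y V) (flatten s) = has (has (wire_val y V)) s.
  by elim: s => //= a s IHs; rewrite has_cat IHs.
rewrite has_map; elim: (fan g) gb => //= w s IHs /andP [wb sb].
rewrite IHs // -wv //; congr orb; rewrite /inline; case: ifP => [o|_ /=]; last by rewrite orbF.
by rewrite gv // /gate_val; case: (op _) o.
Qed.

Lemma compose_prefix gs : exists2 r, compose gs = base3 ++ r & size r = size gs.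
Proof.
elim/last_ind: gs => [|gs g [r E sr]]; first by exists [::]; rewrite ?cats0.
by exists (rcons r (inline_gate (compose gs) g)); rewrite ?size_rcons ?sr // compose_rcons {1}E rcons_cat.
Qed.

Lemma compose_gate_op gs j : j < size gs ->
  op (nth (gate0 _) (compose gs) (size base3 + j)) = op (nth (gate0 _) gs j).
Proof.
elim/last_ind: gs => // gs g IH; rewrite size_rcons ltnS leq_eqVlt compose_rcons !nth_rcons.
rewrite size_compose ltn_add2l eqn_add2l => /orP [/eqP ->|jg]; first by rewrite ltnn eqxx.
by rewrite jg IH.
Qed.

Lemma compose_gadget gs e : nth (gate0 _) (compose gs) (index3 e) = gadget_layer e.
Proof.
have [r -> _] := compose_prefix gs.
by rewrite nth_cat layer_index_lt layer_gate.
Qed.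

Definition gate_fed g : bool := all (fun w : wire nbits => ~~ is_input w) (fan g).

Definition narrow_bottom g : bool := all (@is_input nbits) (fan g) ==> (size (fan g) <= len).

Lemma gate_fed_narrow k g : gate_ok k g -> gate_fed g -> narrow_bottom g.
Proof.
by rewrite /gate_fed /narrow_bottom => /andP []; case: (fan g) => //= w s _ _ /andP [/negbTE ->].
Qed.

Lemma base3_narrow : all narrow_bottom base3.
Proof.
rewrite /base3 /layer all_cat /base2 /layer all_cat /base1 /layer cat0s !all_map.
apply/andP; split; first (apply/andP; split); apply/allP => e _ /=.
- by rewrite /narrow_bottom size_map -cardE card_ord leqnn implybT.
- by apply: gate_fed_narrow (cell_ok e) _; rewrite /gate_fed all_map; apply/allP.
by apply: gate_fed_narrow (gadget_ok e) _; rewrite /gate_fed all_map; apply/allP.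
Qed.

(** Inlining reaches no deeper than the gadget layer, whose gates read gates. Hence only literal
    gates are fed by inputs, and they have fan-in [len]. *)
Lemma compose_fed gs : gates_wf gs -> all gate_fed (drop (size base2) (compose gs)).
Proof.
elim/last_ind: gs => [_|gs g IH].
  rewrite /compose /= /base3 /layer drop_size_cat // all_map.
  by apply/allP => e _; rewrite /gate_fed /= all_map; apply/allP.
move=> /gates_wf_rcons [/IH {}IH /andP [_ gb]]; rewrite compose_rcons drop_rcons; last first.
  by rewrite size_compose (leq_trans size_base23) // leq_addr.
rewrite all_rcons IH andbT /gate_fed /=.
elim: (fan g) gb => //= w s IHs /andP [wb sb]; rewrite all_cat IHs // andbT.
rewrite /inline; case: ifP => // _.
have lt := wire_index_lt wb.
have le : size base2 <= wire_index w.
  by case: (w) => [neg i|j] /=; [exact: leq_addr|rewrite (leq_trans size_base23) // leq_addr].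
rewrite -{1}(subnKC le) -nth_drop.
by apply: (all_nthP (gate0 _) IH); rewrite size_drop ltn_sub2r // (leq_ltn_trans le).
Qed.

Lemma compose_narrow gs : gates_wf gs -> all narrow_bottom (compose gs).
Proof.
elim/last_ind: gs => [_|gs g IH]; first exact: base3_narrow.
move=> wf; have := compose_fed wf; move: wf => /gates_wf_rcons [wf gok].
rewrite compose_rcons all_rcons drop_rcons; last first.
  by rewrite size_compose (leq_trans size_base23) // leq_addr.
rewrite all_rcons => /andP [fed _]; rewrite IH // andbT.
by apply: gate_fed_narrow (inline_gate_ok (compose_wf wf) gok) fed.
Qed.

Lemma gate_heights_prefix k (gs gs' : seq (gate k)) :
  exists hs, gate_heights (gs ++ gs') = gate_heights gs ++ hs.
Proof.
elim/last_ind: gs' => [|gs' g [hs E]]; first by exists [::]; rewrite !cats0.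
exists (rcons hs (gate_height (gate_heights gs ++ hs) g)).
by rewrite -rcons_cat gate_heights_rcons E rcons_cat.
Qed.

Lemma compose_gadget_height gs e : nth 0 (gate_heights (compose gs)) (index3 e) <= 3.
Proof.
have [r -> _] := compose_prefix gs; have [hs ->] := gate_heights_prefix base3 r.
by rewrite nth_cat size_gate_heights layer_index_lt gadget_height.
Qed.

Section Height.
Variables (good : pred (wire n)) (bound : gate_op -> nat -> nat).
Hypothesis bound_literal : forall o h neg i, 0 < h -> good (Input neg i) ->
  (if op_is (if ~~ (neg (+) sigma) then And else Or) o then 2 else 3) <= bound o h.
Hypothesis bound_gate : forall o o' h h', h' < h ->
  (if op_is o' o then bound o' h' else (bound o' h').+1) <= bound o h.

(** [bound o h] concerns the inputs of a gate of operation [o] and original height [h], not the gate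
    itself, so inlining a child of the same operation passes its bound on unchanged. *)
Lemma compose_height gs j : gates_wf gs -> all (fun g => all good (fan g)) gs -> j < size gs ->
  nth 0 (gate_heights (compose gs)) (size base3 + j) <=
  (bound (op (nth (gate0 _) gs j)) (nth 0 (gate_heights gs) j)).+1.
Proof.
elim/last_ind: gs j => // gs g IH j /gates_wf_rcons [wf /andP [_ gb]].
rewrite all_rcons => /andP [gg gsg]; have {}IH k := IH k wf gsg.
have cwf := compose_wf wf.
rewrite compose_rcons !gate_heights_rcons size_rcons ltnS leq_eqVlt !nth_rcons.
rewrite !size_gate_heights size_compose ltn_add2l eqn_add2l.
case/orP => [/eqP ->|jg]; last by rewrite jg IH.
rewrite ltnn eqxx /gate_height ltnS bigmax_le_all /=.
set h := (\max_(w <- fan g) _).+1.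
have hw : all (fun w => wire_height (gate_heights gs) w < h) (fan g).
  by have := leqnn (\max_(w <- fan g) wire_height (gate_heights gs) w); rewrite bigmax_le_all.
clearbody h; elim: (fan g) gb gg hw => //= w s IHs /andP [wb sb] /andP [gw gs'] /andP [hw hs'].
rewrite all_cat IHs // andbT /inline; set HS := gate_heights (compose gs).
have lt := wire_index_lt wb.
have fanH k : nth 0 HS (wire_index w) <= k.+1 ->
    all (fun w' => wire_height HS w' <= k) (fan (nth (gate0 _) (compose gs) (wire_index w))).
  by rewrite nth_gate_heights // /gate_height ltnS bigmax_le_all.
case: w wb gw hw lt fanH => [neg i _ gi h0|i ilt _ hi] lt fanH.
  have H3 := compose_gadget_height gs (~~ (neg (+) sigma), i).
  have := bound_literal (op g) (leq_ltn_trans (leq0n _) h0) gi.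
  rewrite compose_gadget /= in fanH *; case: ifP => _ le.
    by apply: sub_all (fanH 2 H3) => w' /leq_trans; apply.
  by rewrite /= andbT (leq_trans H3).
have Hi := IH _ ilt.
have := bound_gate (op g) (op (nth (gate0 _) gs i)) hi.
rewrite /= in fanH *; rewrite compose_gate_op //; case: ifP => _ le.
  by apply: sub_all (fanH _ Hi) => w' /leq_trans; apply.
by rewrite /= andbT (leq_trans Hi).
Qed.

End Height.

End Gadget.

(** * Depth of the composed circuit by a parity argument *)

Section Composition.
Local Open Scope nat_scope.
Variables (n m theta len : nat).
Variable dec : {ffun 'I_len -> bool} -> option ('I_n * 'I_m).
Hypotheses (m_gt0 : 0 < m) (len_gt0 : 0 < len) (theta_gt0 : 0 < theta).
Hypothesis dec_onto : forall c, exists v, dec v = Some c.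

(** In a monotone circuit all gadgets enter with the same top operation [A]. A gate is in phase if
    it is an [A] gate at odd height or the other kind at even height; an edge between equal
    operations is merged, so only gates out of phase need an extra level. [sigma] is chosen so that
    the output gate is in phase at height [d], and at smaller height there is a level to spare. *)
Lemma composed_circuit (C : circuit n) (d : nat) : 1 <= d -> circuit_depth C <= d ->
  exists (sigma : bool) (C' : circuit #|{: 'I_theta * 'I_len}|),
    [/\ computes C' (fun y => circuit_eval C (inner_input dec sigma y)),
        circuit_size C' = 2 * (theta * 2 ^ len + n * m + n) + circuit_size C,
        bottom_fanin C' <= len &
        circuit_depth C' <= d + (if monotone_circuit C then 2 else 3)].
Proof.
move=> d1 Cd; have wf := @gates_wfP _ C; have owf := output_wfP C.
(* If the output is a literal, the default is harmless: the circuit is a gadget of depth 3, and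
   [1 <= d]. *)
pose top := if output C is Gate j then op (nth (gate0 n) (gates C) j) else And.
pose sigma := if top is And then ~~ odd d else odd d.
have out_lt : wire_below (size (compose theta dec sigma (gates C)))
    (Gate #|{: 'I_theta * 'I_len}| (wire_index theta dec sigma (output C))).
  exact: wire_index_lt.
exists sigma, (MkCircuit (compose_wf m_gt0 len_gt0 theta_gt0 dec_onto wf) out_lt).
split.
- move=> y; rewrite /circuit_eval /= compose_vals // nth_cat size_gate_vals.
  case: (output C) owf => [neg i _|j jC] /=.
    rewrite layer_index_lt gadget_val //= negbK ffunE.
    by case: neg; case: (sigma); case: gadget.
  by rewrite ltnNge leq_addr /= addKn.
- by rewrite /circuit_size /= size_compose size_base3.
- rewrite /bottom_fanin /=.
  have := compose_narrow m_gt0 len_gt0 theta_gt0 dec_onto sigma wf.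
  elim: (compose _ _ _ _) => [|g gs IHs] /=; first by rewrite big_nil.
  rewrite big_cons => /andP [/implyP gn /IHs le]; case: ifP => // /gn gl.
  by rewrite geq_max gl.
rewrite /circuit_depth /= in Cd *.
have := @compose_height n m theta len dec m_gt0 len_gt0 theta_gt0 dec_onto sigma.
move=> CH; case: ifP => [mono|_]; last first.
  (* Gadgets of both polarities occur, so no phase fits all of them and one more level is
     allowed. *)
  have := CH predT (fun _ h => h.+2).
  have lit (o : gate_op) h neg (i : 'I_n) : 0 < h -> predT (Input neg i) ->
      (if op_is (if ~~ (neg (+) sigma) then And else Or) o then 2 else 3) <= h.+2.
    by case: ifP => _; case: h.
  move=> /(_ lit) H.
  have /H {}H : forall o o' : gate_op, forall h h', h' < h ->
      (if op_is o' o then h'.+2 else h'.+3) <= h.+2.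
    by move=> o o' h h' hh; case: ifP => _; lia.
  case E : (output C) owf Cd => [neg i|j] /= => [_ _|jC Cd].
    by apply: (@leq_trans 3); [exact: compose_gadget_height|lia].
  have := H _ _ wf _ jC; rewrite (_ : all _ _) => [/(_ isT)|]; first by move: Cd; lia.
  by elim: (gates C) => //= g gs ->; rewrite andbT all_predT.
pose A := if sigma then Or else And.
pose cond o h := op_is o A (+) odd h.
pose bound o h := (h.+1 + cond o h)%N.
have op_flip o o' : op_is o' o = false -> op_is o' A = ~~ op_is o A.
  by rewrite /A; case: o; case: o'; case: (sigma).
have op_same o o' : op_is o' o -> o' = o by case: o; case: o'.
have lit (o : gate_op) h neg (i : 'I_n) : 0 < h -> positive_wire (Input neg i) ->
    (if op_is (if ~~ (neg (+) sigma) then And else Or) o then 2 else 3) <= bound o h.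
  rewrite /bound /cond /A; case: neg => //; case: h => [//|[|h]] _ _.
    by case: o; case: (sigma).
  by case: ifP => _; lia.
have gat (o o' : gate_op) h h' : h' < h ->
    (if op_is o' o then bound o' h' else (bound o' h').+1) <= bound o h.
  move=> hh; rewrite /bound; case: ifP => oo.
    by rewrite (op_same _ _ oo); case: (cond o h'); case: (cond o h); lia.
  move: hh; rewrite leq_eqVlt => /orP [/eqP <-|hh].
    rewrite /cond (op_flip _ _ oo) /= addbN addNb; lia.
  by case: (cond o' h'); case: (cond o h); lia.
case/andP: mono => mono _.
case E : (output C) owf Cd => [neg i|j] /= => [_ _|jC Cd].
  by apply: (@leq_trans 3); [exact: compose_gadget_height|lia].
have := CH _ _ lit gat _ _ wf mono jC; move/leq_trans; apply.
rewrite /bound; have [lt|ge] := ltnP (nth 0 (gate_heights (gates C)) j) d.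
  by case: (cond _ _); lia.
have -> : nth 0 (gate_heights (gates C)) j = d by apply/eqP; rewrite eqn_leq Cd.
suff -> : cond (op (nth (gate0 n) (gates C) j)) d = false by lia.
rewrite /cond /A /sigma /top E.
by case: (op _); case: (odd d).
Qed.

End Composition.

(** * The degree of the composed function *)

Lemma polyfun_reindex (R : comNzRingType) (I J : finType) (h : I -> J) D (P : (I -> R) -> R) :
  polyfun D P -> polyfun D (fun z : J -> R => P (fun i => z (h i))).
Proof.
move=> [s [sD sP]].
apply: (@eq_polyfun _ _ _ (fun z : J -> R =>
  \sum_(ce <- s | ce \in s) ce.1 * \prod_i z (h i) ^+ ce.2 i)).
  by move=> z; rewrite sP [RHS]big_seq.
apply: polyfun_sum => ce /sD ceD; apply: polyfunZ; apply: polyfunW ceD _.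
apply: (@polyfun_prod _ _ _ _ _ (fun i (z : J -> R) => z (h i) ^+ ce.2 i)) => i.
elim: (ce.2 i) => [|e IHe]; first exact: polyfun_cst.
apply: (@eq_polyfun _ _ _ (fun z : J -> R => z (h i) * z (h i) ^+ e)).
  by move=> z; rewrite exprS.
by rewrite -add1n; apply: polyfunM IHe; exact: polyfun_var.
Qed.

(** With [x = 1 / (2m)], Bernoulli gives [(1 - x) ^ m >= 1/2], hence [(1 + x) ^ m <= 2], and
    [1 + 2 x <= (1 + x) ^ 2]. *)
Lemma one_plus_inv_pow_le4 (R : realFieldType) (m : nat) : (0 < m)%N ->
  (1 + m%:R^-1) ^+ m <= 4 :> R.
Proof.
move=> m0; have mR : 1 <= m%:R :> R by rewrite ler1n.
set x : R := (2 * m%:R)^-1.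
have x0 : 0 < x by rewrite invr_gt0; lra.
have x1 : x <= 2^-1 by rewrite lef_pV2 ?posrE; lra.
have mx : m%:R^-1 = 2 * x by rewrite /x; field; rewrite gt_eqF //; lra.
have mxh : m%:R * x = 2^-1 by rewrite /x; field; rewrite gt_eqF //; lra.
have h : 2^-1 <= (1 - x) ^+ m.
  apply: le_trans (_ : 1 + m%:R * - x <= _); first by rewrite mulrN mxh; lra.
  by apply: bernoulli_ge; lra.
have p1 : ((1 + x) * (1 - x)) ^+ m <= 1 by apply: exprn_ile1; nra.
have h2 : (1 + x) ^+ m <= 2.
  move: p1; rewrite exprMn; have : 0 <= (1 + x) ^+ m by rewrite exprn_ge0; lra.
  by move: ((1 + x) ^+ m) ((1 - x) ^+ m) h => a b h a0 ab; nra.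
apply: le_trans (_ : ((1 + x) ^+ 2) ^+ m <= _).
  apply: lerXn2r; rewrite ?nnegrE ?mx; [lra|by rewrite exprn_ge0; lra|].
  by rewrite -subr_ge0 (_ : _ - _ = x ^+ 2) ?sqr_ge0 //; ring.
rewrite -exprM mulnC exprM; have : 0 <= (1 + x) ^+ m by rewrite exprn_ge0; lra.
by move: ((1 + x) ^+ m) h2 => a a2 a0; rewrite expr2; nra.
Qed.

(** By Bernoulli, [200 m] steps of the tilt gain a factor 2, and [48 n t] doublings are required:
    [40 n t] for the extrapolation, [3 n t] for the number of nodes, [4 n t] for the kernels of all
    counters and [n t] for the leading 2. *)
Definition slots (n m t : nat) : nat := (200 * 48 * (n * m * t))%N.

Lemma slots_large (R : realFieldType) (n m t : nat) :
  (0 < m)%N -> (0 < n)%N -> (0 < t)%N -> (n <= 2 ^ t)%N -> (m <= n)%N ->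
  2 * ((2 * (200 * 100 * (n * m ^ 3))%N%:R + 1) ^+ n.*2 * n.*2.+1%:R *
       (1 + m%:R^-1) ^+ 2 ^+ (n * m))
    <= (1 + (200 * m%:R)^-1) ^+ slots n m t :> R.
Proof.
move=> m0 n0 t0 nt mn.
have nt1 : (1 <= n * t)%N by rewrite muln_gt0 n0.
apply: le_trans (_ : 2 ^+ (48 * (n * t)) <= _); last first.
  have -> : slots n m t = (200 * m * (48 * (n * t)))%N by rewrite /slots; ring.
  rewrite [leRHS]exprM lerXn2r ?nnegrE ?exprn_ge0 ?addr_ge0 ?invr_ge0 ?mulr_ge0 //.
  have := @bernoulli_ge R (200 * m%:R)^-1 (200 * m)%N.
  have -> : (200 * m)%N%:R * (200 * m%:R)^-1 = 1 :> R.
    by rewrite natrM mulfV // mulf_neq0 ?pnatr_eq0 -?lt0n.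
  by apply; apply: le_trans (_ : 0 <= _); rewrite ?invr_ge0 ?mulr_ge0 // lerN10.
have b1 : (2 * (200 * 100 * (n * m ^ 3))%N%:R + 1) ^+ n.*2 <= 2 ^+ (40 * (n * t)) :> R.
  have -> : (40 * (n * t) = 20 * t * n.*2)%N by rewrite -mul2n; ring.
  rewrite [leRHS]exprM lerXn2r ?nnegrE ?exprn_ge0 ?addr_ge0 ?mulr_ge0 //.
  rewrite -natrM natr1 -natrX ler_nat.
  have h4 : (n * m ^ 3 <= 2 ^ (4 * t))%N.
    have -> : (2 ^ (4 * t) = (2 ^ t) ^ 4)%N by rewrite -expnM mulnC.
    rewrite mulnC [leqRHS]expnSr leq_mul // leq_exp2r //; exact: leq_trans nt.
  have h16 : (2 ^ 16 <= 2 ^ (16 * t))%N by rewrite leq_exp2l // leq_pmulr.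
  (* [2 ^ (16 t)] covers the numerical constant and [2 ^ (4 t)] covers [n * m ^ 3]. *)
  have -> : (20 * t = 16 * t + 4 * t)%N by ring.
  rewrite expnD; apply: leq_trans (leq_mul h16 (leqnn _)).
  apply: (@leq_trans ((200 * 200).+1 * 2 ^ (4 * t))).
    have : (0 < 2 ^ (4 * t))%N by rewrite expn_gt0.
    move: (n * m ^ 3)%N (2 ^ (4 * t))%N h4 => A B; lia.
  by rewrite leq_mul2r; apply/orP; right; rewrite !expnS expn0; lia.
have b2 : n.*2.+1%:R <= 2 ^+ (3 * (n * t)) :> R.
  rewrite -natrX ler_nat; apply: (@leq_trans (2 ^ (3 * t))); last first.
    by rewrite leq_exp2l // leq_mul2l /= leq_pmull.
  have -> : (3 * t = t + (t + t))%N by ring.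
  have t2 : (2 <= 2 ^ t)%N by rewrite -{1}[2%N]expn1 leq_exp2l.
  rewrite !expnD; move: (2 ^ t)%N nt t2 => T nT T2; rewrite -addnn.
  by apply: (@leq_trans (T * 4)); [lia|rewrite leq_mul2l (leq_mul T2 T2) orbT].
have b3 : (1 + m%:R^-1) ^+ 2 ^+ (n * m) <= 2 ^+ (4 * (n * t)) :> R.
  have -> : (1 + m%:R^-1) ^+ 2 ^+ (n * m) = ((1 + m%:R^-1) ^+ m) ^+ n.*2 :> R.
    by rewrite -!exprM -mul2n; congr (_ ^+ _); ring.
  have -> : (4 * (n * t) = 2 * t * n.*2)%N by rewrite -mul2n; ring.
  rewrite [leRHS]exprM lerXn2r ?nnegrE ?exprn_ge0 ?addr_ge0 ?invr_ge0 //.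
  apply: le_trans (one_plus_inv_pow_le4 R m0) _.
  rewrite exprM (_ : 4 = (2 ^+ 2) ^+ 1 :> R); last by ring.
  by rewrite ler_weXn2l // expr2; lra.
have -> : (48 * (n * t) = n * t + (40 * (n * t) + 3 * (n * t) + 4 * (n * t)))%N by ring.
rewrite (exprD _ (n * t)) (exprD _ (40 * (n * t) + 3 * (n * t))) (exprD _ (40 * (n * t))).
apply: ler_pM => //.
- by rewrite !mulr_ge0 ?exprn_ge0 ?addr_ge0 ?invr_ge0 ?mulr_ge0.
- by rewrite -{1}[2]expr1 ler_weXn2l // ler1n.
apply: ler_pM => //; first by rewrite !mulr_ge0 ?exprn_ge0 ?addr_ge0 ?mulr_ge0.
  by rewrite !exprn_ge0 // addr_ge0 ?invr_ge0.
by apply: ler_pM => //; rewrite exprn_ge0 // addr_ge0 ?mulr_ge0.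
Qed.

Section Degree.
Variables (R : realFieldType) (n m t : nat).
Hypotheses (m_gt0 : (0 < m)%N) (n_gt0 : (0 < n)%N) (t_gt0 : (0 < t)%N).
Hypotheses (nt : (n <= 2 ^ t)%N) (mn : (m <= n)%N).
Local Notation cell := ('I_n * 'I_m)%type.
Local Notation word := {ffun 'I_(12 * t) -> bool}.
Local Notation theta := (slots n m t).
Variables (dec : word -> option cell) (nu : option cell -> word -> R).
Hypothesis nu_ge0 : forall k y, 0 <= nu k y.
Hypothesis nu_sum : forall k, \sum_y nu k y = 1.
Hypothesis nu_dec : forall k y, nu k y != 0 -> dec y = k.
Hypothesis nu_moment : forall (B : {set 'I_(12 * t)}) k k', (#|B| < t)%N ->
  \sum_y nu k y * \prod_(b in B) (y b)%:R = \sum_y nu k' y * \prod_(b in B) (y b)%:R.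

Definition all_hit (y : {ffun 'I_theta -> word}) (i : 'I_n) : bool :=
  [forall a, [exists j, dec (y j) == Some (i, a)]].

Lemma degree_reduction (sigma : bool) d (p : (('I_theta * 'I_(12 * t)) -> R) -> R) :
  polyfun d p -> (d < n * t)%N ->
  exists2 Q : ('I_n -> R) -> R, polyfun (d %/ t %/ m) Q & forall (x : 'I_n -> bool) a,
    ((forall y, (forall i, all_hit y i = x i (+) sigma) -> a <= p (@bits_of R _ _ y)) ->
       a <= Q (fun i => (x i)%:R)) /\
    ((forall y, (forall i, all_hit y i = x i (+) sigma) -> p (@bits_of R _ _ y) <= a) ->
       Q (fun i => (x i)%:R) <= a).
Proof.
move=> dp dnt.
have [P dP PE] := decode_polyfun t_gt0 nu_ge0 nu_sum nu_dec nu_moment dp.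
have [l1 [l2 [L1 L2 mom]]] := exists_light_pair R m_gt0.
have l2_sum : \sum_(s < (node m).+1) l2 s = 1 by case: L2.
have [Q dQ QE] := mixed_expect_polyfun m_gt0 mom l2_sum sigma dP.
exists Q => // x a; rewrite QE; set b := fun i => x i (+) sigma.
(* The bound [d < n * t] enters here: the tail estimate is for polynomials of degree at most [n]. *)
have Dn : (d %/ t <= n)%N by rewrite ltnW // ltn_divLR.
have dPn : polyfun n P by exact: polyfunW dP.
have key P' a' : polyfun n P' ->
    (forall z : cell -> nat, (\sum_c z c <= theta)%N ->
       (forall i, b i = [forall a, (0 < z (i, a))%N]) -> a' <= P' (fun c => (z c)%:R)) ->
    a' <= mixed_expect l1 l2 b P'.
  move=> dP' H; rewrite /mixed_expect.
  rewrite -[a']mul1r -(choice_weight_sum R m_gt0 b) mulr_suml; apply: ler_sum => U _.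
  have [->|U0] := eqVneq (choice_weight R b U) 0; first by rewrite !mul0r.
  rewrite ler_wpM2l ?choice_weight_ge0 //.
  apply: (@light_expect_ge _ _ m n (200 * 100 * (n * m ^ 3)) theta _ _ _ m_gt0) => //.
  - by rewrite !muln_gt0 n_gt0 ?expn_gt0 ?m_gt0.
  - by rewrite -mul2n leq_eqVlt; apply/orP; left; apply/eqP; ring.
  - move=> c; rewrite /measure_of /cell_mass; case: (b c.1); first by left.
    by case: (U c.1 c.2); [left|right].
  - by rewrite card_prod !card_ord; exact: slots_large.
  move=> z /prodf_neq0 z0 zt; apply: (H (fun c => z c)) => // i.
  have {}z0 c : measure_of l1 l2 b U c (z c) != 0 by exact: z0.
  have l10 : l1 0%N = 0 by case: L1.
  (* In a true block [l1] avoids 0, so all counters are positive; in a false block the choice has a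
     false entry, whose counter is 0. *)
  case bi : (b i); symmetry.
    apply/forallP => a0; have := z0 (i, a0); rewrite /measure_of /cell_mass /= bi lt0n.
    by apply: contraNneq => ->; rewrite l10.
  have := U0; rewrite /choice_weight => /prodf_neq0 /(_ i isT); rewrite bi.
  move=> /block_weight_neq0 [a0 ua0]; apply/negbTE; rewrite negb_forall; apply/existsP; exists a0.
  have := z0 (i, a0); rewrite /measure_of /cell_mass /= bi (negbTE ua0) -leqNgt leqn0.
  by case: (nat_of_ord _ == 0%N) => //; rewrite eqxx.
have hit (z : cell -> nat) y : (forall i, b i = [forall a, (0 < z (i, a))%N]) ->
    has_counts dec z y -> forall i, all_hit y i = x i (+) sigma.
  move=> bz zy i; rewrite -/(b i) bz; apply: eq_forallb => a0.
  rewrite -zy card_gt0; apply/existsP/set0Pn => -[j dj]; exists j; rewrite inE // in dj *.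
split => H.
  apply: key => // z zt bz; have [+ _] := PE z zt a; apply => y zy.
  by apply: H; exact: hit zy.
have mN : mixed_expect l1 l2 b (fun z => (-1) * P z) = - mixed_expect l1 l2 b P.
  rewrite /mixed_expect -sumrN; apply: eq_bigr => U _; rewrite -mulrN -expectN.
  by congr (_ * _); apply: eq_bigr => z _; rewrite mulN1r.
rewrite -lerN2 -mN; apply: key => [|z zt bz]; first exact: polyfunZ.
rewrite mulN1r lerN2; have [_ +] := PE z zt a; apply => y zy.
by apply: H; exact: hit zy.
Qed.

End Degree.

(** * Convex target sets and the choice of parameters *)

From mathcomp Require Import boolp classical_sets reals ereal exp convex.
From mathcomp Require Import interval_inference.

Local Open Scope classical_set_scope.

Lemma convex_set_between (R : realType) (A : set R^o) (u v q : R) :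
  convex_set A -> A u -> A v -> u <= q -> q <= v -> A q.
Proof.
move=> cA Au Av uq qv.
have [uv|uv] := eqVneq u v; first by have -> : q = u by apply/eqP; rewrite eq_le uq uv qv.
have lt : 0 < v - u by rewrite subr_gt0 lt_neqAle uv (le_trans uq qv).
have t0 : 0 <= (v - q) / (v - u) by rewrite divr_ge0 ?subr_ge0 // ltW // -subr_gt0.
have t1 : (v - q) / (v - u) <= 1 by rewrite ler_pdivrMr // mul1r lerD2l lerN2.
have E : (v - q) / (v - u) * u + (1 - (v - q) / (v - u)) * v = q.
  by field; rewrite gt_eqF.
by have /set_mem := cA u v (Itv01 t0 t1) (mem_set Au) (mem_set Av); rewrite -[in A q]E.
Qed.

(** The least and greatest of the finitely many values enclose [q]. There is at least one value,
    since otherwise the lower-bound hypothesis would hold vacuously at [q + 1]. *)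
Lemma convex_set_squeeze (R : realType) (A : set R^o) (T : finType) (P : pred T)
    (v : T -> R) (q : R) : convex_set A -> (forall t, P t -> A (v t)) ->
  (forall a, (forall t, P t -> a <= v t) -> a <= q) ->
  (forall a, (forall t, P t -> v t <= a) -> q <= a) -> A q.
Proof.
move=> cA Av lo hi.
have [t0 Pt0] : exists t, P t.
  apply/existsP; case: (boolP [exists t, P t]) => // /existsPn nP.
  have := lo (q + 1) (fun t Pt => False_ind _ (negP (nP t) Pt)).
  by rewrite gerDl ler10.
case: (arg_minP v Pt0) => i Pi vi; case: (arg_maxP v Pt0) => j Pj vj.
by apply: (convex_set_between cA (Av i Pi) (Av j Pj)); [apply: lo|apply: hi].
Qed.

(** * Logarithms, rounding and the final constants *)

Lemma log2_ge1 (R : realType) (n : nat) : (2 <= n)%N -> 1 <= log2 (n%:R : R).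
Proof.
move=> n2; have l2 : 0 < ln (2 : R) by rewrite ln_gt0 // ltr1n.
by rewrite /log2 ler_pdivlMr // mul1r ler_ln ?posrE ?ltr0n ?ler_nat // (leq_trans _ n2).
Qed.

Lemma up_log_log2 (R : realType) (n : nat) : (2 <= n)%N ->
  log2 (n%:R : R) <= (up_log 2 n)%:R /\ (up_log 2 n)%:R <= 2 * log2 (n%:R : R).
Proof.
move=> n2; have l2 : 0 < ln (2 : R) by rewrite ln_gt0 // ltr1n.
have n0 : (0 < n)%N by apply: leq_trans n2.
have lX e : ln ((2 ^ e)%N%:R : R) = e%:R * ln 2 by rewrite natrX lnXn // mulr_natl.
have /andP [lo hi] := up_log_bounds (isT : 1 < 2)%N n2.
have t0 : (0 < up_log 2 n)%N by rewrite up_log_gt0 n2.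
split.
  rewrite /log2 ler_pdivrMr // -lX ler_ln ?posrE ?ltr0n ?expn_gt0 // ler_nat.
  exact: up_logP.
have l1 : ((up_log 2 n).-1)%:R <= log2 (n%:R : R).
  rewrite /log2 ler_pdivlMr // -lX ler_ln ?posrE ?ltr0n ?expn_gt0 // ler_nat.
  exact: ltnW.
have -> : (up_log 2 n)%:R = (up_log 2 n).-1%:R + 1 :> R by rewrite natr1 prednK.
by have := log2_ge1 R n2; lra.
Qed.

Lemma exists_nat_ceil (R : realType) (r : R) (n : nat) : 1 <= r -> r <= n%:R ->
  exists m : nat, [/\ (0 < m)%N, (m <= n)%N, r <= m%:R & m%:R <= 2 * r].
Proof.
move=> r1 rn; have ex : exists m : nat, r <= m%:R by exists n.
case: (ex_minnP ex) => m rm mmin.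
have m0 : (0 < m)%N by rewrite -(ltr0n R); apply: lt_le_trans rm; lra.
exists m; split => //; first exact: mmin.
have : ~~ (r <= m.-1%:R) by apply/negP => /mmin; rewrite leqNgt prednK // leqnn.
rewrite -ltNge; have -> : m%:R = m.-1%:R + 1 :> R by rewrite natr1 prednK.
by lra.
Qed.

(** With [al] and [be] the two exponents, [(1 + 1/k) * al = 1] and [2 * al = 1 + be]. So [N ^ al] is
    at most of order [n * ell ^ (1 + be)], and dividing by [log2 N ^ be] leaves [n * ell]. *)
Lemma degree_scale (R : realType) (k : R) (n N : nat) (B : R) :
  (2 <= n)%N -> (n <= N)%N -> 1 <= k -> 1 <= B ->
  N%:R <= B * (n%:R `^ (1 + k^-1) * log2 (n%:R : R) ^+ 2) ->
  N%:R `^ (1 - (k + 1)^-1) / log2 (N%:R : R) `^ (1 - 2 / (k + 1)) <=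
  B * (n%:R * log2 (n%:R : R)).
Proof.
move=> n2 nN k1 B1; set ell := log2 (n%:R : R) => NB.
have n0 : (0 < n)%N by apply: leq_trans n2.
have nR : 0 < n%:R :> R by rewrite ltr0n.
have ell1 : 1 <= ell by exact: log2_ge1.
have l2 : 0 < ln (2 : R) by rewrite ln_gt0 // ltr1n.
have ellN : ell <= log2 (N%:R : R).
  by rewrite /ell /log2 ler_pM2r ?invr_gt0 // ler_ln ?posrE ?ltr0n ?ler_nat // (leq_trans n0).
set al : R := 1 - (k + 1)^-1; set be : R := 1 - 2 / (k + 1).
have ki : 0 < (k + 1)^-1 <= 2^-1.
  by rewrite invr_gt0 lef_pV2 ?posrE; lra.
have al0 : 0 <= al <= 1 by rewrite /al; lra.
have be0 : 0 <= be by rewrite /be; lra.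
have albe : 2 * al = 1 + be by rewrite /al /be; lra.
have nal : (1 + k^-1) * al = 1 by rewrite /al; field; apply/andP; split; rewrite gt_eqF //; lra.
case/andP: al0 => al0 al1; clearbody al be ell.
have X0 : 0 <= n%:R `^ (1 + k^-1) * ell ^+ 2 by rewrite mulr_ge0 ?powR_ge0 ?sqr_ge0.
have step : N%:R `^ al <= B * (n%:R * ell `^ (1 + be)).
  apply: le_trans (_ : (B * (n%:R `^ (1 + k^-1) * ell ^+ 2)) `^ al <= _).
    by apply: ge0_ler_powR; rewrite ?nnegrE ?mulr_ge0 ?powR_ge0 ?sqr_ge0 //; lra.
  rewrite powRM //; last by lra.
  rewrite powRM ?powR_ge0 ?sqr_ge0 // -powRrM nal powRr1 // -powR_mulrn; last by lra.
  rewrite -powRrM albe ler_wpM2r ?mulr_ge0 ?powR_ge0 //.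
  by apply: ler1_powR; lra.
have ellb : 0 < ell `^ be by rewrite powR_gt0; lra.
have LNb : ell `^ be <= log2 (N%:R : R) `^ be.
  by apply: ge0_ler_powR; rewrite ?nnegrE //; lra.
rewrite ler_pdivrMr; last exact: lt_le_trans LNb.
apply: le_trans step _.
rewrite powRD; last by apply/implyP => _; rewrite gt_eqF //; lra.
rewrite powRr1; last by lra.
rewrite -!mulrA ler_pM2l; last by lra.
rewrite ler_pM2l // ler_pM2l //; lra.
Qed.

(** From an approximant of degree below [n * t], the value of the averaged polynomial at [x] is
    squeezed between values at inputs whose gadgets spell [x], all in one convex target set. The
    result approximates [f] in degree below [n / m <= D]. *)
Lemma composed_adeg (R : realType) (I0 I1 Is : set R^o) (n m t : nat) (f : cube n -> bool)
    (dec : {ffun 'I_(12 * t) -> bool} -> option ('I_n * 'I_m))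
    (nu : option ('I_n * 'I_m) -> {ffun 'I_(12 * t) -> bool} -> R) (sigma : bool) (D : R) :
  (0 < m)%N -> (0 < n)%N -> (0 < t)%N -> (n <= 2 ^ t)%N -> (m <= n)%N ->
  convex_set I0 -> convex_set I1 ->
  (forall k y, 0 <= nu k y) -> (forall k, \sum_y nu k y = 1) ->
  (forall k y, nu k y != 0 -> dec y = k) ->
  (forall (B : {set 'I_(12 * t)}) k k', (#|B| < t)%N ->
     \sum_y nu k y * \prod_(b in B) (y b)%:R = \sum_y nu k' y * \prod_(b in B) (y b)%:R) ->
  (D%:E <= bool_adeg I0 I1 Is f)%E -> n%:R <= D * m%:R ->
  ((n * t)%N%:R%:E <=
   bool_adeg I0 I1 Is (fun y => f (@inner_input n m (slots n m t) _ dec sigma y)))%E.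
Proof.
move=> m0 n0 t0 nt mn cI0 cI1 nu0 nu1 nud num degf nD.
apply: le_ereal_inf_tmp => _ [p pF <-]; rewrite lee_fin ler_nat leqNgt; apply/negP => pnt.
pose ev (z : ('I_(slots n m t) * 'I_(12 * t)) -> R) := mpoly.meval (fun i => z (enum_val i)) p.
have dev : polyfun (tdeg p) ev := polyfun_reindex (fun i => enum_val i) (polyfun_meval p).
have [Q dQ QE] := degree_reduction m0 n0 t0 nt mn nu0 nu1 nud num sigma dev pnt.
have [q dq qE] := polyfun_mpoly dQ.
have qf : approximant I0 I1 Is (@cube_pt R n) (fun x => Some (f x)) q.
  move=> x; rewrite /= qE.
  pose hit (y : {ffun 'I_(slots n m t) -> {ffun 'I_(12 * t) -> bool}}) :=
    [forall i, all_hit dec y i == x i (+) sigma].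
  have main (A : set R^o) : convex_set A ->
      (forall y, hit y -> A (ev (@bits_of R _ _ y))) -> A (Q (cube_pt R x)).
    move=> cA HA; have QEx a := QE x a.
    apply: (convex_set_squeeze cA HA) => a H.
      by have [+ _] := QEx a; apply => y Hy; apply: H; apply/forallP => i; apply/eqP.
    by have [_ +] := QEx a; apply => y Hy; apply: H; apply/forallP => i; apply/eqP.
  have val y : hit y -> (if f x then I1 else I0) (ev (@bits_of R _ _ y)).
    move=> /forallP Hy.
    pose y' : cube #|{: 'I_(slots n m t) * 'I_(12 * t)}| :=
      [ffun k => y (enum_val k).1 (enum_val k).2].
    have wy : words_of y' = y.
      by apply/ffunP => j; apply/ffunP => b; rewrite !ffunE enum_rankK.
    have := pF y'; rewrite /= (_ : inner_input dec sigma y' = x).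
      have -> : cube_pt R y' = (fun i => @bits_of R _ _ y (enum_val i)).
        by apply/funext => i; rewrite /cube_pt ffunE.
      by case: (f x).
    apply/ffunP => i; rewrite ffunE /gadget wy.
    by have /eqP := Hy i; rewrite /all_hit => ->; rewrite addbC -addbA addbb addbF.
  by case: (f x) val => val; apply: main.
have : (D%:E <= (tdeg q)%:R%:E)%E.
  by apply: le_trans degf _; apply: ereal_inf_lbound; exists q.
rewrite lee_fin => Dq.
have : (n%:R <= (tdeg q * m)%N%:R :> R).
  by apply: le_trans nD _; rewrite natrM ler_wpM2r.
rewrite ler_nat leqNgt => /negP; apply.
apply: (@leq_ltn_trans (tdeg p %/ t)); last by rewrite ltn_divLR.
by apply: leq_trans (leq_trunc_div _ m); rewrite leq_mul2r dq orbT.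
Qed.

(** As [2 ^ (t - 1) < n], both [2 ^ t] and [t] are at most [n ^ 2]; powers of [n >= 2] absorb the
    constants. *)
Lemma composed_size (n m t : nat) : (2 <= n)%N -> (0 < m <= n)%N -> (0 < t)%N ->
  (2 ^ t.-1 < n)%N -> (2 * (slots n m t * 2 ^ (12 * t) + n * m + n) <= n ^ 50)%N.
Proof.
move=> n2 /andP [m0 mn] t0 tn.
have n0 : (0 < n)%N by apply: leq_trans n2.
have t2 : (2 ^ t <= n ^ 2)%N.
  by rewrite -(prednK t0) expnS expnSr expn1 leq_mul // ltnW.
have tn' : (t <= n ^ 2)%N by apply: leq_trans t2; exact: ltnW (ltn_expl _ _).
have b1 : (2 ^ (12 * t) <= n ^ 24)%N.
  by rewrite mulnC expnM (_ : 24 = 2 * 12)%N // [leqRHS]expnM leq_exp2r.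
have b2 : (200 * 48 <= n ^ 16)%N.
  apply: (@leq_trans (2 ^ 16)); last by rewrite leq_exp2r.
  by rewrite !expnS expn0; lia.
have b3 : (slots n m t <= n ^ 20)%N.
  rewrite /slots (_ : 20 = 16 + (1 + 1 + 2))%N // (expnD n 16) (expnD n (1 + 1)) (expnD n 1) !expn1.
  by apply: leq_mul b2 _; apply: leq_mul tn'; apply: leq_mul.
have b4 : (slots n m t * 2 ^ (12 * t) <= n ^ 44)%N.
  by rewrite (_ : 44 = 20 + 24)%N // expnD leq_mul.
have b5 : (n * m <= n ^ 44)%N.
  apply: (@leq_trans (n ^ 2)); first by rewrite expnSr expn1 leq_mul2l mn orbT.
  by rewrite leq_exp2l.
have b6 : (n <= n ^ 44)%N by rewrite -{1}[n]expn1 leq_exp2l.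
apply: (@leq_trans (8 * n ^ 44)); first by lia.
rewrite (_ : 50 = 6 + 44)%N // expnD leq_mul2r; apply/orP; right.
apply: (@leq_trans (2 ^ 3)) => //; apply: (@leq_trans (2 ^ 6)); first by rewrite leq_exp2l.
by rewrite leq_exp2r.
Qed.

Theorem theorem4p8 (R : realType) :
  exists (a b c e : R) (q : nat),
    [/\ 0 < a, 0 < b, 0 < c & 0 < e] /\
    forall (I0 I1 Is : set R^o),
      I0 !=set0 -> I1 !=set0 -> Is !=set0 ->
      convex_set I0 -> convex_set I1 -> convex_set Is ->
    forall (n : nat) (f : cube n -> bool) (k : R),
      (2 <= n)%N -> 1 <= k ->
      ((n%:R `^ (1 - k^-1))%:E <= bool_adeg I0 I1 Is f)%E ->
    forall (s d : nat) (C : circuit n),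
      (1 <= d)%N -> computes C f ->
      (circuit_size C <= s)%N -> (circuit_depth C <= d)%N ->
    exists (N : nat) (F : cube N -> bool),
      [/\ a * (n%:R `^ (1 + k^-1) * log2 (n%:R : R) ^+ 2) <= N%:R,
          N%:R <= b * (n%:R `^ (1 + k^-1) * log2 (n%:R : R) ^+ 2),
          ((c * (N%:R `^ (1 - (k + 1)^-1)
                 / log2 (N%:R : R) `^ (1 - 2 / (k + 1))))%:E
             <= bool_adeg I0 I1 Is F)%E &
          exists C' : circuit N,
            [/\ computes C' F,
                (circuit_size C' <= s + n ^ q)%N,
                (bottom_fanin C')%:R <= e * log2 (n%:R : R) &
                (circuit_depth C' <= d + (if monotone_circuit C then 2 else 3))%N]].
Proof.
(* [slots n m t] words of length [12 t] make [N = K * n * m * t ^ 2]. The factor 8 comes from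
   [m <= 2 * n^(1/k)] and [t <= 2 * log2 n], and 24 from the bottom fan-in [12 * t]. *)
pose K : R := 200 * 48 * 12.
exists 1, (8 * K), (8 * K)^-1, 24, 50; split.
  by split => //; rewrite ?invr_gt0 /K; lra.
move=> I0 I1 Is _ _ _ cI0 cI1 _ n f k n2 k1 degf s d C d1 Cf Cs Cd.
have n0 : (0 < n)%N by apply: leq_trans n2.
have n1R : 1 <= n%:R :> R by rewrite ler1n.
have ki : 0 < k^-1 <= 1 by rewrite invr_gt0 invf_le1 //; lra.
case/andP: ki => ki0 ki1.
pose r : R := n%:R `^ k^-1.
have r1 : 1 <= r by rewrite -(powRr0 n%:R); apply: ler_powR => //; exact: ltW.
have rn : r <= n%:R by exact: ler1_powR.
have [m [m0 mn rm m2r]] := exists_nat_ceil r1 rn.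
have nN0 : n%:R != 0 :> R by rewrite pnatr_eq0 -lt0n.
have nr : n%:R `^ (1 + k^-1) = n%:R * r by rewrite powRD ?nN0 ?implybT // powRr1.
have nD : n%:R <= n%:R `^ (1 - k^-1) * m%:R :> R.
  apply: le_trans (_ : n%:R `^ (1 - k^-1) * r <= _); last by rewrite ler_wpM2l ?powR_ge0.
  by rewrite -powRD ?nN0 ?implybT // subrK powRr1.
pose t := up_log 2 n.
have t0 : (0 < t)%N by rewrite up_log_gt0 n2.
have nt : (n <= 2 ^ t)%N by exact: up_logP.
have [ellt t2ell] := up_log_log2 R n2; rewrite -/t in ellt t2ell.
have ell1 := log2_ge1 R n2.
have cardI : (#|{: 'I_n * 'I_m}| < 2 ^ (3 * t))%N.
  rewrite card_prod !card_ord (@leq_ltn_trans (2 ^ (2 * t))) //.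
    by rewrite mul2n -addnn expnD leq_mul // (leq_trans mn).
  by rewrite ltn_exp2l // ltn_mul2r t0.
have [dec [nu [nu0 nu1 nud num]]] := exists_code R t0 cardI.
(* The law [nu (Some c)] has total mass 1, so it charges some word, and that word decodes to
   [Some c]. *)
have dec_onto c : exists v, dec v = Some c.
  have : \sum_y nu (Some c) y != 0 by rewrite nu1 oner_neq0.
  apply: contra_neqP => H; apply: big1 => y _; apply/eqP.
  by apply: contra_notT H => /nud; exists y.
have len0 : (0 < 12 * t)%N by rewrite muln_gt0.
have th0 : (0 < slots n m t)%N by rewrite /slots !muln_gt0 n0 m0.
have [sigma [C' [C'f C's C'b C'd]]] := composed_circuit m0 len0 th0 dec_onto d1 Cd.
have NE : #|{: 'I_(slots n m t) * 'I_(12 * t)}|%:R = K * (n%:R * m%:R * t%:R ^+ 2) :> R.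
  by rewrite card_prod !card_ord /slots !natrM /K; ring.
exists #|{: 'I_(slots n m t) * 'I_(12 * t)}|, (fun y => f (inner_input dec sigma y)).
set ell := log2 _ in ellt t2ell ell1 *.
have [r0 ell0 tR mR] : [/\ 0 <= r, 0 <= ell, 0 <= t%:R :> R & 0 <= m%:R :> R].
  by split => //; lra.
have nm : n%:R * r * ell ^+ 2 <= n%:R * m%:R * t%:R ^+ 2.
  by apply: ler_pM; [exact: mulr_ge0|exact: sqr_ge0|exact: ler_wpM2l|exact: lerXn2r].
have nmX : n%:R * m%:R * t%:R ^+ 2 <= 8 * (n%:R * r * ell ^+ 2).
  have -> : 8 * (n%:R * r * ell ^+ 2) = n%:R * (2 * r) * (2 * ell) ^+ 2 by ring.
  apply: ler_pM; [exact: mulr_ge0|exact: sqr_ge0|exact: ler_wpM2l|].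
  by apply: lerXn2r t2ell; rewrite nnegrE; lra.
have X0 : 0 <= n%:R * r * ell ^+ 2 by apply: mulr_ge0; [exact: mulr_ge0|exact: sqr_ge0].
have Nhi : #|{: 'I_(slots n m t) * 'I_(12 * t)}|%:R <=
    8 * K * (n%:R `^ (1 + k^-1) * ell ^+ 2) :> R.
  by rewrite NE nr /K; lra.
split => //.
- by rewrite NE nr /K; lra.
- have nN : (n <= #|{: 'I_(slots n m t) * 'I_(12 * t)}|)%N.
    rewrite card_prod !card_ord.
    have -> : (slots n m t * (12 * t) = n * (200 * 48 * 12 * (m * t * t)))%N.
      by rewrite /slots; ring.
    by rewrite leq_pmulr // !muln_gt0 m0 t0.
  apply: (@le_trans _ _ (n * t)%N%:R%:E); last first.
    have H := @composed_adeg R I0 I1 Is n m t f dec nu sigma _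
      m0 n0 t0 nt mn cI0 cI1 nu0 nu1 nud num degf nD.
    exact: H.
  rewrite lee_fin ler_pdivrMl; last by rewrite /K; lra.
  apply: le_trans (degree_scale n2 nN k1 _ Nhi) _; first by rewrite /K; lra.
  by rewrite natrM ler_pM2l; [rewrite ler_wpM2l|rewrite /K; lra].
exists C'; split => //.
- by move=> y; rewrite C'f Cf.
- rewrite C's addnC leq_add //; apply: composed_size => //; first by rewrite m0.
  exact: up_log_gtn.
- apply: le_trans (_ : (12 * t)%N%:R <= _); first by rewrite ler_nat.
  by rewrite natrM; lra.
Qed.
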